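(* Let $M\in\mathbb{N}^*$. Consider the control-affine system $\dot x=f_0(x)+u f_1(x)$ on $\mathbb{R}^d$, where $f_0$ is of class $C^{M+1}$ and $f_1$ is of class $C^M$ on a neighborhood of $0$, and $f_0(0)=0$. If this system is $W^{-1,\infty}$-STLC, then, for every $k\in\mathbb{N}^*$ such that $2k\le M$, $$\mathrm{ad}_{f_1}^{2k}(f_0)(0)\in S_{\{1,\dots,2k-1\}}(f)(0).$$
   Context: System. $d\ge1$, $x(t)\in\mathbb{R}^d$, and the control $u(t)\in\mathbb{R}$ is scalar. For $t>0$ and $u\in L^1((0,t);\mathbb{R})$, $x(\cdot;u)$ is the unique maximal mild solution with $x(0)=0$; only times and controls small enough for it to be defined up to time $t$ are considered. STLC. With $u_1(s):=\int_0^s u$ and $\|u\|_{W^{-1,\infty}}:=\|u_1\|_{L^\infty(0,t)}$, the system is $W^{-1,\infty}$-STLC when for every $t,\rho>0$ there exists $\delta>0$ such that for every $x^\star\in B(0,\delta)$ there exists $u\in L^1((0,t);\mathbb{R})$ with $\|u\|_{W^{-1,\infty}}\le\rho$ and $x(t;u)=x^\star$. Brackets at $0$ in finite regularity. $\mathrm{Br}(X)$ is the free magma over $X=\{X_0,X_1\}$ (formal iterated brackets) and $n_1(b)$ is the number of occurrences of $X_1$ in $b$. For smooth vector fields, $[f,g]:=(Dg)f-(Df)g$, and $f_b$ is obtained from $b\in\mathrm{Br}(X)$ by replacing $X_i$ by $f_i$ and formal brackets by Lie brackets. If $f_0\in C^N$ with $f_0(0)=0$ and $f_1\in C^{N-1}$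 near $0$ ($N\in\mathbb{N}^*$), let $\hat f_0$ (resp. $\hat f_1$) be the Taylor polynomial at $0$ of $f_0$ of order $N$ (resp. of $f_1$ of order $N-1$); for $b\in\mathrm{Br}(X)$ with $1\le n_1(b)\le N$, define $f_b(0):=\hat f_b(0)$ (this does not depend on the choice of such $N\ge n_1(b)$). Here $\mathrm{ad}_{f_1}^{2k}(f_0)(0):=f_b(0)$ for $b=\mathrm{ad}_{X_1}^{2k}(X_0)=(X_1,(X_1,\cdots(X_1,X_0)\cdots))$, and $S_A(f)(0):=\mathrm{span}\{f_b(0): b\in\mathrm{Br}(X),\ n_1(b)\in A\}$. *)

(* Defs.v *)
From HB Require Import structures.
From mathcomp Require Import all_boot all_order all_algebra.
From mathcomp Require Import all_classical all_reals all_analysis.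

Set Implicit Arguments.
Unset Strict Implicit.
Unset Printing Implicit Defensive.

Import Order.TTheory GRing.Theory Num.Theory.
Import numFieldNormedType.Exports.

Local Open Scope classical_set_scope.
Local Open Scope ring_scope.

(* Points and vectors of R^d are row vectors; the norm of 'rV[R]_d is the
   sup norm. *)

(* Class C^n on an open set U. In finite dimension the differential of g is of
   class C^n iff x |-> 'D_v g x = 'd g x v is, for every fixed v. *)
Fixpoint class_C (R : realType) (V W : normedModType R) (n : nat) (U : set V)
    (g : V -> W) : Prop :=
  match n with
  | 0 => forall x, U x -> {for x, continuous g}
  | n'.+1 => (forall x, U x -> differentiable g x) /\
             (forall v, class_C n' U ('D_v g))
  end.

(* The partial derivative d_{i_1} ... d_{i_k} g, for s = [:: i_1; ...; i_k]. *)
Definition partials (R : realType) (d : nat) (s : seq 'I_d)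
    (g : 'rV[R]_d -> 'rV[R]_d) : 'rV[R]_d -> 'rV[R]_d :=
  foldr (fun i h => 'D_(delta_mx 0 i) h) g s.

(* Taylor polynomial at 0 of order N, i.e.
   sum_(k <= N) 1/k! D^k g(0)(x, ..., x). *)
Definition taylor (R : realType) (d N : nat) (g : 'rV[R]_d -> 'rV[R]_d)
    (x : 'rV[R]_d) : 'rV[R]_d :=
  \sum_(k < N.+1) (k`!%:R)^-1 *:
    \sum_(s : k.-tuple 'I_d) (\prod_(i <- s) x 0 i) *: partials s g 0.

Inductive magma : Type := X0 | X1 | Br of magma & magma.

Fixpoint n1 (b : magma) : nat :=
  match b with
  | X0 => 0
  | X1 => 1
  | Br b1 b2 => n1 b1 + n1 b2
  end.

Definition ad_X1 (n : nat) (b : magma) : magma := iter n (Br X1) b.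

Definition lie_bracket (R : realType) (d : nat) (f g : 'rV[R]_d -> 'rV[R]_d) :
    'rV[R]_d -> 'rV[R]_d :=
  fun x => 'd g x (f x) - 'd f x (g x).

Fixpoint bracket (R : realType) (d : nat) (f0 f1 : 'rV[R]_d -> 'rV[R]_d)
    (b : magma) : 'rV[R]_d -> 'rV[R]_d :=
  match b with
  | X0 => f0
  | X1 => f1
  | Br b1 b2 => lie_bracket (bracket f0 f1 b1) (bracket f0 f1 b2)
  end.

(* f_b(0) for f0 of class C^N, f1 of class C^(N-1) and 1 <= n1 b <= N. *)
Definition bracket_at0 (R : realType) (d N : nat)
    (f0 f1 : 'rV[R]_d -> 'rV[R]_d) (b : magma) : 'rV[R]_d :=
  bracket (taylor N f0) (taylor N.-1 f1) b 0.

(* Linear span of an arbitrary, possibly infinite, set of vectors. *)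
Definition lspan (K : fieldType) (V : vectType K) (A : set V) : set V :=
  [set v | exists2 s : seq V, [set` s] `<=` A & v \in span s].

Definition S_at0 (R : realType) (d N : nat) (f0 f1 : 'rV[R]_d -> 'rV[R]_d)
    (A : set nat) : set 'rV[R]_d :=
  lspan [set bracket_at0 N f0 f1 b | b in [set b | A (n1 b)]].

Definition L1_control (R : realType) (t : R) (u : R -> R) : Prop :=
  (@lebesgue_measure R).-integrable `]0, t[ (EFin \o u).

Definition primitive (R : realType) (u : R -> R) (s : R) : R :=
  \int[@lebesgue_measure R]_(r in `]0, s[) u r.

Definition norm_Wm1oo (R : realType) (t : R) (u : R -> R) : \bar R :=
  'N[@lebesgue_measure R]_+oo [EFin \o (primitive u \_ `]0, t[)].

(* x is the mild solution on [0, t], starting from 0, of x' = f0(x) + u f1(x)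
   in the state domain U on which the vector fields live. *)
Definition mild_solution (R : realType) (d : nat) (U : set 'rV[R]_d)
    (f0 f1 : 'rV[R]_d -> 'rV[R]_d) (u : R -> R) (t : R) (x : R -> 'rV[R]_d) :
    Prop :=
  [/\ {within `[0, t], continuous x},
      (forall s, s \in `[0, t] -> U (x s)) &
      forall s, s \in `[0, t] -> forall i : 'I_d,
        x s 0 i = \int[@lebesgue_measure R]_(r in `]0, s[)
                    (f0 (x r) 0 i + u r * f1 (x r) 0 i)].

Definition Wm1oo_STLC (R : realType) (d : nat) (U : set 'rV[R]_d)
    (f0 f1 : 'rV[R]_d -> 'rV[R]_d) : Prop :=
  forall t rho : R, 0 < t -> 0 < rho ->
    exists2 delta : R, 0 < delta &
      forall xstar : 'rV[R]_d, ball 0 delta xstar ->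
        exists u : R -> R,
          [/\ L1_control t u, (norm_Wm1oo t u <= rho%:E)%E &
              exists2 x : R -> 'rV[R]_d,
                mild_solution U f0 f1 u t x & x t = xstar].

(* Main.v *)
Require Import Defs.
From HB Require Import structures.
From mathcomp Require Import all_boot all_order all_algebra.
From mathcomp Require Import all_classical all_reals all_analysis.
From mathcomp Require Import -(notations) mpoly.
From mathcomp Require Import ring lra zify.

(** Put [n = 2 k] and let [g] be the value at 0 of the bracket [ad_{f1}^n f0].
    If [f1 0 = 0] every bracket vanishes at 0 and there is nothing to prove.
    Otherwise suppose that [g] lies outside the span of the [f_b(0)] with
    [1 <= n1 b <= n - 1]; then the points [- c g], for small [c > 0], cannot be
    reached by controls with a small primitive, in short time.  The reason is
    that, in the direction [g], the state is driven by the integral [I] of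
    [v^n], where [v] is the primitive of the control, and [I >= 0] because [n]
    is even.

    The control is removed by following the flow [Phi] of [f1]: the point
    [y(s) = Phi(- v(s), x(s))] solves
      [y' = sum_j v^j / j! ad_{f1}^j(f0)(y) + O((|v| + |y|)^(n+1))].
    Here [f0] and [f1] are only finitely differentiable.  The series is therefore
    cut at [j = n] and built from the Taylor polynomials of [f0] and [f1]; the
    remainders enter the differential inequality for the defect with the same
    power [n + 1] ([pullback_step_error]).  The primitive [v] is small in the sup
    norm, but its total variation is not bounded; the equation is therefore
    integrated by adding up its increments over short time steps
    ([sum_increments], [driven_reduced]), and no derivative of [v] appears.

    The size of a trajectory is measured by [sig > 0], with
    [sig^n = I(t) + |x(t)|].  Call a polynomial of order [m + 1] when all its
    iterated derivatives along words of brackets with at most [m] letters [X1]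
    vanish at 0.  For [m < n] it is [O(sig^(m+1))] along [y] ([vanish_order]):
    in its equation the [j]-th term is [v^j] times a polynomial of order
    [m + 1 - j], the term [j = 0] is again of order [m + 1] and is absorbed for
    small times, and the others are estimated by induction and by
    [|v|^j sig^(n-j) <= |v|^n + sig^n].

    Since [g] is outside the span, there is a polynomial [phi] of order [n] with
    [dphi(0) g = 1] ([privileged_function]): start with a linear form that is 1
    at [g] and 0 on the span, and correct it by homogeneous polynomials of
    increasing degree.  In the equation of [phi(y)] the terms [j < n] are small
    with respect to [|v|^n + sig^n], by Young's inequality with a small weight,
    and the term [j = n] is [v^n / n!] to first order, so that
    [phi(y(t)) = I(t) / n! + o(sig^n)] ([privileged_drift]).  As [f1 0] is not
    zero, [|v(t)|] is bounded by a multiple of [|x(t)| + |y(t)|]; this makes the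
    passage from [y(t)] back to [x(t)] harmless, and
    [dphi(0) x(t) = I(t) / n! + o(I(t) + |x(t)|)] ([endpoint_drift]).  With
    [x(t) = - c g] the left-hand side is [- c], a contradiction
    ([unreachable_direction]). *)

Set Implicit Arguments.
Unset Strict Implicit.
Unset Printing Implicit Defensive.
Import Order.TTheory GRing.Theory Num.Theory.
Import numFieldNormedType.Exports.
Local Open Scope classical_set_scope.
Local Open Scope ring_scope.

(** * Polynomial vector fields and their derivations *)

Section PolynomialFields.
Variables (R : numFieldType) (d : nat).
Local Notation P := (mpoly d R).

Definition evp (p : P) (x : 'rV[R]_d) : R := meval (fun i => x 0 i) p.

Lemma evpD x : {morph evp^~ x : p q / p + q}.
Proof. by move=> p q; rewrite /evp mevalD. Qed.
Lemma evpB x : {morph evp^~ x : p q / p - q}.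
Proof. by move=> p q; rewrite /evp mevalB. Qed.
Lemma evpM x : {morph evp^~ x : p q / p * q}.
Proof. by move=> p q; rewrite /evp mevalM. Qed.
Lemma evpZ x c p : evp (c *: p) x = c * evp p x.
Proof. by rewrite /evp mevalZ. Qed.
Lemma evpC x c : evp (mpolyC d c) x = c.
Proof. by rewrite /evp mevalC. Qed.
Lemma evpX x i : evp (mpolyX R (mnm1 i)) x = x 0 i.
Proof. by rewrite /evp mevalXU. Qed.
Lemma evp0 x : evp 0 x = 0.
Proof. by rewrite /evp meval0. Qed.
Lemma evp_sum x I (r : seq I) (Q : pred I) (F : I -> P) :
  evp (\sum_(i <- r | Q i) F i) x = \sum_(i <- r | Q i) evp (F i) x.
Proof. by apply: (big_morph (evp^~ x)); [exact: evpD | exact: evp0]. Qed.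

Definition vfield := 'I_d -> P.

Definition lder (f : vfield) (p : P) : P := \sum_i f i * mderiv i p.

(** The sign is that of [lie_bracket]. *)
Definition vbr (f g : vfield) : vfield := fun i => lder f (g i) - lder g (f i).

Definition val0 (f : vfield) : 'rV[R]_d := \row_i evp (f i) 0.

Lemma lderD f : {morph lder f : p q / p + q}.
Proof.
move=> p q; rewrite /lder -big_split; apply: eq_bigr => i _ /=.
by rewrite mderivD mulrDr.
Qed.

Lemma lder0 f : lder f 0 = 0.
Proof. by rewrite /lder big1 // => i _; rewrite mderiv0 mulr0. Qed.

Lemma lderZ f c p : lder f (c *: p) = c *: lder f p.
Proof.
by rewrite /lder scaler_sumr; apply: eq_bigr => i _; rewrite mderivZ scalerAr.
Qed.

Lemma lderB f : {morph lder f : p q / p - q}.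
Proof. by move=> p q; rewrite lderD -scaleN1r lderZ scaleN1r. Qed.

Lemma lderC f c : lder f (mpolyC d c) = 0.
Proof. by rewrite /lder big1 // => i _; rewrite mderivC mulr0. Qed.

Lemma lderM f p q : lder f (p * q) = lder f p * q + p * lder f q.
Proof.
rewrite /lder mulr_suml mulr_sumr -big_split; apply: eq_bigr => i _ /=.
by rewrite mderivM; ring.
Qed.

Lemma lder_sum f I (r : seq I) (Q : pred I) (F : I -> P) :
  lder f (\sum_(i <- r | Q i) F i) = \sum_(i <- r | Q i) lder f (F i).
Proof. by apply: (big_morph (lder f)); [exact: lderD | exact: lder0]. Qed.

(** The second derivatives of [p] cancel in the commutator, by symmetry. *)
Lemma lder_vbr f g p :
  lder f (lder g p) - lder g (lder f p) = lder (vbr f g) p.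
Proof.
have expand (u v : vfield) : lder u (lder v p) =
    \sum_j lder u (v j) * mderiv j p +
    \sum_i \sum_j u i * (v j * mderiv i (mderiv j p)).
  rewrite [lder v p]/lder lder_sum [in RHS]exchange_big -big_split /=.
  apply: eq_bigr => j _; rewrite lderM; congr (_ + _).
  rewrite {1}/lder mulr_sumr; apply: eq_bigr => i _; ring.
rewrite !expand [X in _ - (_ + X)]exchange_big /=.
rewrite [lder (vbr f g) p]/lder opprD addrACA -sumrB.
rewrite [X in _ + X](_ : _ = 0) ?addr0.
  by apply: eq_bigr => j _; rewrite /vbr mulrBl.
apply/eqP; rewrite subr_eq0; apply/eqP; apply: eq_bigr => i _.
by apply: eq_bigr => j _; rewrite mderiv_comm; ring.
Qed.

Lemma evp_lder0 f p : evp (lder f p) 0 = \sum_i val0 f 0 i * evp (mderiv i p) 0.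
Proof.
by rewrite /lder evp_sum; apply: eq_bigr => i _; rewrite evpM mxE.
Qed.

Definition lders (fs : seq vfield) (p : P) : P := foldr lder p fs.

Lemma lders_cat fs gs p : lders (fs ++ gs) p = lders fs (lders gs p).
Proof. by rewrite /lders foldr_cat. Qed.

Lemma lders_rcons fs g p : lders (rcons fs g) p = lders fs (lder g p).
Proof. by rewrite -cats1 lders_cat. Qed.

Lemma lders0 fs : lders fs 0 = 0.
Proof. by elim: fs => //= f fs ->; rewrite lder0. Qed.
Lemma ldersD fs : {morph lders fs : p q / p + q}.
Proof. by move=> p q; elim: fs => //= f fs ->; rewrite lderD. Qed.
Lemma ldersB fs : {morph lders fs : p q / p - q}.
Proof. by move=> p q; elim: fs => //= f fs ->; rewrite lderB. Qed.
Lemma ldersZ fs c p : lders fs (c *: p) = c *: lders fs p.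
Proof. by elim: fs => //= f fs ->; rewrite lderZ. Qed.
Lemma lders_sum fs I (r : seq I) (Q : pred I) (F : I -> P) :
  lders fs (\sum_(i <- r | Q i) F i) = \sum_(i <- r | Q i) lders fs (F i).
Proof. by apply: (big_morph (lders fs)); [exact: ldersD | exact: lders0]. Qed.

Lemma mderiv_lder i p : mderiv i p = lder (fun j => mpolyC d (j == i)%:R) p.
Proof.
rewrite /lder (bigD1 i) //= big1 ?addr0 => [|j /negPf ji].
  by rewrite eqxx mul1r.
by rewrite ji mpolyC0 mul0r.
Qed.

Section Homogeneous.
Variables (r : nat) (ell : 'I_r -> P).

(** The contraction of the tensor [c] with [q] copies of the vector [ell]. Keeping the
    coefficients as a function of words turns a derivation into a shift of [c]. *)
Fixpoint hpol (q : nat) (c : seq 'I_r -> R) : P :=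
  match q with
  | 0 => mpolyC d (c [::])
  | q'.+1 => \sum_l ell l * hpol q' (fun s => c (l :: s))
  end.

(** Adjacent transpositions suffice for invariance under all permutations of the word. *)
Definition symmetric_coef (c : seq 'I_r -> R) := forall s1 l m s2,
  c (s1 ++ l :: m :: s2) = c (s1 ++ m :: l :: s2).

Lemma symmetric_coef_cons c l :
  symmetric_coef c -> symmetric_coef (fun s => c (l :: s)).
Proof. by move=> sc s1 m m' s2; exact: (sc (l :: s1)). Qed.

(** Euler's rule: each of the [q.+1] factors [ell] can be the one that is
    differentiated, and by symmetry all contribute the same. *)
Lemma lder_hpol f q c : symmetric_coef c ->
  lder f (hpol q.+1 c) =
  q.+1%:R *: \sum_m lder f (ell m) * hpol q (fun s => c (m :: s)).
Proof.
elim: q c => [|q IH] c sc.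
  rewrite scale1r /= lder_sum; apply: eq_bigr => l _.
  by rewrite lderM lderC mulr0 addr0.
have -> : hpol q.+2 c = \sum_l ell l * hpol q.+1 (fun s => c (l :: s)) by [].
rewrite lder_sum -[q.+2]addn1 natrD scalerDl scale1r addrC.
under eq_bigr => l _ do rewrite lderM (IH _ (symmetric_coef_cons l sc)).
rewrite big_split /=; congr (_ + _).
under eq_bigr => l _ do rewrite -scalerAr mulr_sumr.
rewrite -scaler_sumr; congr (_ *: _).
rewrite exchange_big /=; apply: eq_bigr => m _.
rewrite mulr_sumr; apply: eq_bigr => l _.
under [in LHS]eq_fun => s do rewrite (sc [::] l m s) /=.
by rewrite mulrCA.
Qed.

Hypothesis ell0 : forall l, evp (ell l) 0 = 0.

Fixpoint contract (fs : seq vfield) (c : seq 'I_r -> R) : R :=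
  match fs with
  | [::] => c [::]
  | f :: fs' =>
      \sum_m evp (lder f (ell m)) 0 * contract fs' (fun s => c (m :: s))
  end.

Lemma evp_hpol0 q c : (0 < q)%N -> evp (hpol q c) 0 = 0.
Proof.
case: q => // q _; rewrite /= evp_sum big1 // => l _.
by rewrite evpM ell0 mul0r.
Qed.

(** Fewer than [q] derivations leave a factor [ell] undifferentiated, which vanishes at 0. *)
Lemma lders_hpol_lt fs h q c : symmetric_coef c -> (size fs < q)%N ->
  evp (lders fs (h * hpol q c)) 0 = 0.
Proof.
elim/last_ind: fs h q c => [|fs f IH] h q c sc.
  by move=> q0; rewrite evpM evp_hpol0 // mulr0.
rewrite size_rcons; case: q => // q; rewrite ltnS => lt_fs.
rewrite lders_rcons lderM ldersD evpD IH ?add0r //; last exact: ltnW.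
rewrite lder_hpol // -scalerAr mulr_sumr ldersZ lders_sum evpZ evp_sum.
rewrite big1 ?mulr0 // => m _; rewrite mulrA IH //.
exact: symmetric_coef_cons.
Qed.

(** With exactly as many derivations as factors every [ell] has to be differentiated
    once, and [h] is left untouched. This is what lets a correction by [hpol] alter the
    iterated derivatives of one length without touching the shorter ones. *)
Lemma lders_hpol fs h c : symmetric_coef c ->
  evp (lders fs (h * hpol (size fs) c)) 0 =
  (size fs)`!%:R * evp h 0 * contract (rev fs) c.
Proof.
elim/last_ind: fs h c => [|fs f IH] h c sc.
  by rewrite evpM evpC mul1r.
rewrite size_rcons lders_rcons lderM ldersD evpD lders_hpol_lt // add0r.
rewrite lder_hpol // -scalerAr mulr_sumr ldersZ lders_sum evpZ evp_sum.
rewrite rev_rcons /= factS natrM [LHS]mulr_sumr [RHS]mulr_sumr; apply: eq_bigr => m _.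
rewrite [h * _]mulrA IH; last exact: symmetric_coef_cons.
rewrite evpM; ring.
Qed.

End Homogeneous.

End PolynomialFields.

(** * Vanishing along words of brackets, and the privileged function *)

Section Order.
Variables (R : numFieldType) (d : nat).
Local Notation P := (mpoly d R).
Variables (F0 F1 : vfield R d).
Hypothesis F00 : val0 F0 = 0.

Fixpoint vmag (b : magma) : vfield R d :=
  match b with
  | X0 => F0
  | X1 => F1
  | Br b1 b2 => vbr (vmag b1) (vmag b2)
  end.

(** Letters [X0] are free, because [F0] vanishes at 0. *)
Definition weight (bs : seq magma) : nat := sumn (map n1 bs).

Lemma weight_cat bs cs : weight (bs ++ cs) = (weight bs + weight cs)%N.
Proof. by rewrite /weight map_cat sumn_cat. Qed.

Definition word_der (bs : seq magma) : P -> P := lders (map vmag bs).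

Definition at0 (p : P) (bs : seq magma) : R := evp (word_der bs p) 0.

(** Functions of order above [m], for the filtration of the words by their weight. *)
Definition vanish (m : nat) (p : P) : Prop :=
  forall bs, (weight bs <= m)%N -> at0 p bs = 0.

Lemma at0Z c p bs : at0 (c *: p) bs = c * at0 p bs.
Proof. by rewrite /at0 /word_der ldersZ evpZ. Qed.

Lemma at0D p q bs : at0 (p + q) bs = at0 p bs + at0 q bs.
Proof. by rewrite /at0 /word_der ldersD evpD. Qed.

Lemma vanishZ m c p : vanish m p -> vanish m (c *: p).
Proof. by move=> vp bs le_bs; rewrite at0Z vp ?mulr0. Qed.

Lemma vanishD m p q : vanish m p -> vanish m q -> vanish m (p + q).
Proof. by move=> vp vq bs le_bs; rewrite at0D vp // vq // addr0. Qed.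

Lemma vanish0 m : vanish m 0.
Proof. by move=> bs _; rewrite /at0 /word_der lders0 evp0. Qed.

Lemma vanish_evp0 m p : vanish m p -> evp p 0 = 0.
Proof. by move=> /(_ [::] (leq0n _)). Qed.

(** The bracket [b] becomes one more letter of each word, with its own weight. *)
Lemma vanish_lder m b p : (n1 b <= m)%N -> vanish m p ->
  vanish (m - n1 b) (lder (vmag b) p).
Proof.
move=> le_bm vp bs le_bs.
rewrite /at0 /word_der -lders_rcons -map_rcons; apply: vp.
by move: le_bs le_bm; rewrite -cats1 weight_cat /weight /=; lia.
Qed.

(** A bracket without [X1] is built from [F0] alone, and [F0] vanishes at 0. *)
Lemma val0_vmag0 b : n1 b = 0%N -> val0 (vmag b) = 0.
Proof.
elim: b => [||b1 IH1 b2 IH2] //= /eqP; rewrite addn_eq0 => /andP[/eqP b10 /eqP b20].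
apply/rowP => i; rewrite !mxE evpB !evp_lder0 (IH1 b10) (IH2 b20).
by rewrite !big1 ?subrr // => j _; rewrite mxE mul0r.
Qed.

Lemma at0_cons p b bs :
  at0 p (b :: bs) = \sum_i val0 (vmag b) 0 i * evp (mderiv i (word_der bs p)) 0.
Proof. exact: evp_lder0. Qed.

(** Exchanging two neighbouring derivations costs a shorter word of the same
    weight: two letters are merged into their bracket. *)
Lemma at0_swap p s1 b b' s2 :
  at0 p (s1 ++ b :: b' :: s2) - at0 p (s1 ++ b' :: b :: s2) =
  at0 p (s1 ++ Br b b' :: s2).
Proof.
rewrite /at0 /word_der -evpB !map_cat !lders_cat -ldersB /=; congr (evp (lders _ _) 0).
exact: lder_vbr.
Qed.

Section Step.
Variables (m0 q : nat) (p : P).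
Hypothesis lower : forall bs, (size bs < q)%N -> (weight bs <= m0)%N -> at0 p bs = 0.

(** At the first length at which [p] may fail to be annihilated, the order of the letters is
    irrelevant, because [at0_swap] changes the value by that of a shorter word. *)
Lemma at0_swap_eq s1 b b' s2 : (size s1 + size s2).+2 = q ->
  (weight (s1 ++ b :: b' :: s2) <= m0)%N ->
  at0 p (s1 ++ b :: b' :: s2) = at0 p (s1 ++ b' :: b :: s2).
Proof.
move=> sz wt; apply/eqP; rewrite -subr_eq0 at0_swap lower //.
  by rewrite size_cat /= -sz addnS.
by move: wt; rewrite !weight_cat /weight /= !addnA.
Qed.

Lemma at0_move s1 b s2 : (size s1 + size s2).+1 = q ->
  (weight (s1 ++ b :: s2) <= m0)%N ->
  at0 p (s1 ++ b :: s2) = at0 p (b :: s1 ++ s2).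
Proof.
elim/last_ind: s1 s2 => [//|s1 c IH] s2 sz wt.
rewrite -cats1 -!catA /= at0_swap_eq.
- rewrite IH //; first by rewrite -sz size_rcons /= addnS.
  by move: wt; rewrite -cats1 !weight_cat /weight /=; lia.
- by rewrite -sz size_rcons addSn.
- by move: wt; rewrite -cats1 -catA.
Qed.

Variables (r : nat) (beta : 'I_r -> magma) (ell : 'I_r -> P).
Hypothesis ell0 : forall l, evp (ell l) 0 = 0.
Local Notation coef b l := (evp (lder (vmag b) (ell l)) 0).
Hypothesis expand : forall b, (n1 b <= m0)%N ->
  val0 (vmag b) = \sum_l coef b l *: val0 (vmag (beta l)).
Hypothesis coef_high : forall b l, (n1 b <= m0)%N -> (n1 b < n1 (beta l))%N -> coef b l = 0.

Lemma at0_expand b bs : (n1 b <= m0)%N ->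
  at0 p (b :: bs) = \sum_l coef b l * at0 p (beta l :: bs).
Proof.
move=> le_b; rewrite at0_cons (expand le_b).
under [RHS]eq_bigr => l _ do rewrite at0_cons mulr_sumr.
rewrite exchange_big /=; apply: eq_bigr => i _.
rewrite summxE mulr_suml; apply: eq_bigr => l _.
by rewrite mxE mulrA.
Qed.

(** Coefficients of the correction: the values of [p] on the words of length [q] in the
    basis brackets. Words of weight above [m0] are put to 0, as nothing is asked of them. *)
Definition correction_coef (s : seq 'I_r) : R :=
  if (size s == q) && (weight (map beta s) <= m0)%N then at0 p (map beta s) else 0.

Lemma correction_coef_sym : symmetric_coef correction_coef.
Proof.
move=> s1 l m s2; rewrite /correction_coef.
have -> : weight (map beta (s1 ++ m :: l :: s2)) = weight (map beta (s1 ++ l :: m :: s2)).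
  by rewrite !map_cat !weight_cat /weight /=; lia.
have -> : size (s1 ++ m :: l :: s2) = size (s1 ++ l :: m :: s2) by rewrite !size_cat.
case: ifP => // /andP[/eqP sz wt]; rewrite !map_cat /= at0_swap_eq //.
  by rewrite !size_map -sz size_cat /= !addnS.
by move: wt; rewrite map_cat.
Qed.

(** Expanding every letter over the basis brackets reproduces the value on the word
    itself. The expansion of a letter involves only basis brackets of at most its own
    weight, hence the words met on the way never exceed the weight [m0]. *)
Lemma contract_correction bs s : (size bs + size s)%N = q ->
  (weight bs + weight (map beta s) <= m0)%N ->
  contract ell (map vmag bs) (fun s' => correction_coef (s ++ s')) =
  at0 p (rev bs ++ map beta s).
Proof.
elim: bs s => [|b bs IH] s sz wt.
  by rewrite /= cats0 /correction_coef -sz eqxx wt.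
rewrite /= rev_cons cat_rcons at0_move; last 2 first.
- by rewrite size_rev size_map -sz.
- move: wt; rewrite weight_cat /weight /= map_rev sumn_rev; lia.
rewrite at0_expand; last by move: wt; rewrite /weight /=; lia.
apply: eq_bigr => m _.
have [lt_b|le_b] := ltnP (n1 b) (n1 (beta m)).
  by rewrite coef_high ?mul0r //; move: wt; rewrite /weight /=; lia.
congr (_ * _); under [in LHS]eq_fun => s' do rewrite -cat_rcons.
rewrite IH.
- rewrite map_rcons -cats1 catA -[beta m :: rev bs ++ _]cats0.
  rewrite -[RHS]/(at0 p (beta m :: (rev bs ++ map beta s) ++ [::])).
  rewrite -[RHS]at0_move ?cats0 //.
  + by rewrite addn0 size_cat size_rev size_map -sz.
  + rewrite !weight_cat /weight /= map_rev sumn_rev.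
    move: wt le_b; rewrite /weight /=; lia.
- by rewrite size_rcons addnS -sz.
- move: wt le_b; rewrite map_rcons -cats1 weight_cat /weight /=; lia.
Qed.

(** One step of the construction: words of length [q] are brought to 0 by subtracting the
    form of degree [q] with coefficients [correction_coef]. It affects neither the shorter
    words nor, when [1 < q], the differential at 0. *)
Lemma correction_exists : exists p' : P,
  [/\ forall bs, (size bs < q.+1)%N -> (weight bs <= m0)%N -> at0 p' bs = 0 &
      (1 < q)%N -> forall i, evp (mderiv i p') 0 = evp (mderiv i p) 0].
Proof.
have sc := correction_coef_sym.
exists (p - mpolyC d (q`!%:R^-1) * hpol ell q correction_coef); split.
  move=> bs; rewrite ltnS leq_eqVlt => /predU1P[sz|lt_bs] wt.
    rewrite /at0 /word_der ldersB evpB -[in hpol _ q _]sz -(size_map vmag).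
    rewrite lders_hpol // size_map sz evpC mulfV ?mul1r; last first.
      by rewrite pnatr_eq0 -lt0n fact_gt0.
    rewrite -map_rev (contract_correction (s := [::])) ?cats0 ?revK ?subrr //.
      by rewrite addn0 size_rev.
    by rewrite addn0 /weight map_rev sumn_rev.
  rewrite /at0 /word_der ldersB evpB lders_hpol_lt ?size_map // subr0.
  exact: lower.
move=> lt1q i; rewrite mderivB evpB.
rewrite [mderiv i (_ * _)]mderiv_lder; set f := (fun j => _).
by rewrite -[lder f _]/(lders [:: f] _) lders_hpol_lt // subr0.
Qed.

End Step.
End Order.

Lemma In_mapP (T : Type) (T' : eqType) (f : T -> T') (s : seq T) (v : T') :
  v \in map f s -> exists2 c, List.In c s & v = f c.
Proof.
elim: s => //= c s IH; rewrite inE => /predU1P[->|/IH[c' ? ->]].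
  by exists c => //; left.
by exists c' => //; right.
Qed.

Lemma map_In (T : Type) (T' : eqType) (f : T -> T') (s : seq T) (c : T) :
  List.In c s -> f c \in map f s.
Proof.
elim: s => //= c' s IH [->|/IH fc]; first by rewrite mem_head.
by rewrite inE fc orbT.
Qed.

Lemma In_nthP (T : Type) (x0 : T) (s : seq T) (c : T) :
  List.In c s -> exists2 j, (j < size s)%N & c = nth x0 s j.
Proof.
elim: s => //= c' s IH [->|/IH[j lt_j ->]]; first by exists 0%N.
by exists j.+1.
Qed.

Section Flag.
Variables (K : fieldType) (d : nat) (val : magma -> 'rV[K]_d).
Hypothesis val_weight0 : forall b, n1 b = 0%N -> val b = 0.

(** Free families of row vectors have at most [d] elements, so adding brackets one at a
    time stops. *)
Lemma free_extension (Q : magma -> Prop) (gam : seq magma) :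
  free (map val gam) ->
  exists gam', [/\ forall b, List.In b gam' -> Q b, free (map val (gam' ++ gam)) &
    forall b, Q b -> val b \in span (map val (gam' ++ gam))].
Proof.
have [k le_k] := ubnP (d.+1 - size gam); elim: k gam le_k => // k IH gam le_k fg.
have [allin|] := pselect (forall b, Q b -> val b \in span (map val gam)).
  by exists [::].
move=> /existsNP[b] /not_implyP[Qb /negP nb].
have fbg : free (map val (b :: gam)) by rewrite /= free_cons nb.
have size_bg : (size gam < d)%N.
  have /dimvS := subvf (span (map val (b :: gam))).
  move/eqP: (fbg) => ->; rewrite size_map /= dimvf /dim /= mul1n; exact.
have [|gam' [Qg' fg' sg']] := IH (b :: gam) _ fbg.
  by rewrite /=; lia.
exists (rcons gam' b); rewrite cat_rcons; split=> // c.
by rewrite -cats1 => /List.in_app_iff[/Qg'//|[<-|[]]].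
Qed.

(** Brackets are added in order of increasing weight, so that every bracket value is
    spanned by basis values of at most its own weight. *)
Lemma flag_basis m : exists gam : seq magma,
  [/\ forall b, List.In b gam -> (0 < n1 b <= m)%N, free (map val gam) &
      forall b, (n1 b <= m)%N ->
        val b \in span (map val [seq c <- gam | (n1 c <= n1 b)%N])].
Proof.
elim: m => [|m [gam [gw gf gs]]].
  exists [::]; split=> //; first by rewrite /= nil_free.
  by move=> b; rewrite leqn0 => /eqP /val_weight0 ->; exact: mem0v.
have [gam' [g'w g'f g's]] := free_extension (fun b => n1 b = m.+1) gf.
have filter_all (s : seq magma) k : (forall b, List.In b s -> (n1 b <= k)%N) ->
    [seq c <- s | (n1 c <= k)%N] = s.
  elim: s => //= c s IHs H; rewrite H; last by left.
  by rewrite IHs // => b bs; apply: H; right.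
exists (gam' ++ gam); split=> // [b /List.in_app_iff[/g'w ->|/gw]|b].
- by rewrite leqnn.
- by move=> /andP[-> /= /leqW].
rewrite leq_eqVlt => /predU1P[b_m|]; last rewrite ltnS => b_m.
  rewrite b_m filter_all; first exact: g's.
  move=> c /List.in_app_iff[/g'w ->//|/gw /andP[_ /leq_trans]]; apply.
  exact: leqnSn.
rewrite filter_cat map_cat span_cat; apply: subvP (gs b b_m); exact: addvSr.
Qed.

End Flag.

Section LinearForm.
Variables (R : numFieldType) (d : nat).

Definition linform (la : 'rV[R]_d -> R) : mpoly d R :=
  \sum_j la (delta_mx 0 j) *: mpolyX R (mnm1 j).

Variable la : {linear 'rV[R]_d -> R^o}.

Lemma evp_linform x : evp (linform la) x = la x.
Proof.
rewrite /linform evp_sum {2}(row_sum_delta x) linear_sum; apply: eq_bigr => j _.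
by rewrite evpZ evpX linearZ /= mulrC.
Qed.

Lemma mderiv_linform i : mderiv i (linform la) = mpolyC d (la (delta_mx 0 i)).
Proof.
rewrite /linform linear_sum (bigD1 i) //= big1 ?addr0 => [|j ji].
  rewrite linearZ /= mderivX mnmE eqxx scale1r -mul_mpolyC.
  have -> : mnm_sub (mnm1 i) (mnm1 i) = mnm0 by apply/mnmP => k; rewrite !mnmE subnn.
  by rewrite mpolyX0 mulr1.
by rewrite linearZ /= mderivX mnmE (negPf ji) scale0r scaler0.
Qed.

Lemma lder_linform0 (f : vfield R d) : evp (lder f (linform la)) 0 = la (val0 f).
Proof.
rewrite evp_lder0 {2}(row_sum_delta (val0 f)) linear_sum; apply: eq_bigr => i _.
by rewrite mderiv_linform evpC linearZ.
Qed.

End LinearForm.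

Section Privileged.
Variables (R : numFieldType) (d : nat).
Variables (F0 F1 : vfield R d).
Hypothesis F00 : val0 F0 = 0.
Local Notation val b := (val0 (vmag F0 F1 b)).

(** A word longer than its weight contains a letter of weight 0. Moved to the front
    it becomes the outermost derivation, along a field that vanishes at 0; the exchanges
    needed for this only produce shorter words. *)
Lemma vanish_of_short m0 p :
  (forall bs, (size bs <= m0)%N -> (weight bs <= m0)%N -> at0 F0 F1 p bs = 0) ->
  vanish F0 F1 m0 p.
Proof.
move=> short bs; have [k] := ubnP (size bs); elim: k bs => // k IH bs.
rewrite ltnS => le_k wt; have [|big] := leqP (size bs) m0; first by move/short; exact.
have [s1 [b [s2 [def_bs b0]]]] : exists s1 b s2, bs = s1 ++ b :: s2 /\ n1 b = 0%N.
  move: big wt {le_k IH}; elim: bs m0 {short} => // b bs IH m0 /= big wt.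
  case b0: (n1 b) => [|w]; first by exists [::], b, bs.
  case: m0 big wt => [|m0] big wt; first by move: wt; rewrite /weight /= b0.
  have [//||s1 [c [s2 [-> c0]]]] := IH m0; first by move: wt; rewrite /weight /= b0; lia.
  by exists (b :: s1), c, s2.
have [sz wts] : (size s1 + size s2).+1 = size bs /\ (weight (s1 ++ b :: s2) <= m0)%N.
  by rewrite def_bs size_cat /= addnS -def_bs.
rewrite def_bs (at0_move (m0 := m0) (q := size bs)) //.
  by rewrite at0_cons val0_vmag0 // big1 // => i _; rewrite mxE mul0r.
by move=> cs szc; apply: IH; exact: leq_trans szc le_k.
Qed.

(** The starting point is a linear form [Phi] that separates [g] from the span; it has the right
    values on words of length at most one. [correction_exists] then treats the lengths
    2, 3, and so on. By [vanish_of_short] it is enough to reach length [m0]. *)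
Theorem privileged_function m0 (g : 'rV[R]_d) :
  ~ lspan [set val b | b in [set b | 0 < n1 b <= m0]%N] g ->
  exists phi : mpoly d R, vanish F0 F1 m0 phi /\
    \sum_i g 0 i * evp (mderiv i phi) 0 = 1.
Proof.
move=> ng.
have [gam [gw gf gs]] := flag_basis (val := fun b => val b) (val0_vmag0 F1 F00) m0.
pose vs := map (fun b => val b) gam.
have in_vs b : (n1 b <= m0)%N -> val b \in span vs.
  move=> le_b; apply: subvP (gs b le_b); apply: sub_span => v /In_mapP[c].
  by move=> /List.filter_In[c_in _] ->; exact: map_In.
have ng' : g \notin span vs.
  apply/negP => gin; apply: ng; exists vs => // v /= /In_mapP[c /gw c_in ->].
  by exists c.
have [Phi [Phi_vs Phi_g]] : exists Phi : {linear 'rV[R]_d -> R^o},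
    (forall v, v \in span vs -> Phi v = 0) /\ Phi g = 1.
  have fr : free (in_tuple (g :: vs)) by rewrite free_cons ng'.
  exists (coord (in_tuple (g :: vs)) ord0); split; last first.
    exact: (coord_free (X := in_tuple (g :: vs)) ord0 ord0 fr).
  move=> v /(coord_span (X := in_tuple vs)) ->; rewrite linear_sum big1 // => i _.
  have := coord_free (X := in_tuple (g :: vs)) (lift ord0 i) ord0 fr.
  by rewrite linearZ /= => ->; rewrite scaler0.
pose ell (l : 'I_(size vs)) := linform (coord (in_tuple vs) l).
have ell0 l : evp (ell l) 0 = 0 by rewrite evp_linform linear0.
have coefE b l : evp (lder (vmag F0 F1 b) (ell l)) 0 = coord (in_tuple vs) l (val b).
  exact: lder_linform0.
have sz_vs : size vs = size gam by rewrite size_map.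
pose beta (l : 'I_(size vs)) := nth X0 gam l.
have valbeta l : val (beta l) = vs`_l.
  by rewrite (nth_map X0) // -sz_vs.
have expand b : (n1 b <= m0)%N -> val b =
    \sum_l evp (lder (vmag F0 F1 b) (ell l)) 0 *: val (beta l).
  move=> /in_vs /(coord_span (X := in_tuple vs)) {1}->; apply: eq_bigr => l _.
  by rewrite coefE valbeta.
have coef_high b l : (n1 b <= m0)%N -> (n1 b < n1 (beta l))%N ->
    evp (lder (vmag F0 F1 b) (ell l)) 0 = 0.
  move=> le_b lt_b; rewrite coefE.
  pose low := map (fun b => val b) [seq c <- gam | (n1 c <= n1 b)%N].
  have := gs b le_b; rewrite -/low => /(coord_span (X := in_tuple low)) ->.
  rewrite linear_sum big1 // => i _; rewrite linearZ /=.
  have : low`_i \in low by rewrite mem_nth.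
  case/In_mapP => c /List.filter_In[c_in c_le] ->.
  have [j def_c] : exists j : 'I_(size vs), c = beta j.
    have [j lt_j ->] := In_nthP X0 c_in.
    have lt_j' : (j < size vs)%N by rewrite sz_vs.
    by exists (Ordinal lt_j').
  have := coord_free (X := in_tuple vs) j l gf.
  rewrite def_c valbeta => ->; have [jl|_] := eqVneq j l; last by rewrite mulr0.
  by move: lt_b; rewrite ltnNge -jl -def_c c_le.
suff [p [p_short p_der]] : exists p : mpoly d R,
    (forall bs, (size bs < m0.+1)%N -> (weight bs <= m0)%N -> at0 F0 F1 p bs = 0) /\
    forall i, evp (mderiv i p) 0 = Phi (delta_mx 0 i).
  exists p; split; first exact: vanish_of_short.
  under eq_bigr => i _ do rewrite p_der.
  rewrite -Phi_g [in RHS](row_sum_delta g) linear_sum.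
  by apply: eq_bigr => i _; rewrite linearZ.
suff H q : exists p : mpoly d R,
    (forall bs, (size bs < q.+2)%N -> (weight bs <= m0)%N -> at0 F0 F1 p bs = 0) /\
    forall i, evp (mderiv i p) 0 = Phi (delta_mx 0 i).
  by have [p [ps pd]] := H m0; exists p; split=> // bs /ltnW; exact: ps.
elim: q => [|q [p [ps pd]]].
  exists (linform Phi); split=> [[|b [|]] // _ wt|i].
  - by rewrite /at0 evp_linform linear0.
  - rewrite /at0 /= lder_linform0 Phi_vs // in_vs //.
    by move: wt; rewrite /weight /= addn0.
  - by rewrite mderiv_linform evpC.
have [p' [p's p'd]] := correction_exists ps ell0 expand coef_high.
by exists p'; split=> // i; rewrite p'd.
Qed.
End Privileged.

(** * Analysis of polynomial functions *)

Section RowVectors.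
Variables (R : realType) (d : nat).
Implicit Types x y z : 'rV[R]_d.

Lemma coord_le_norm x i : `|x 0 i| <= `|x|.
Proof.
have -> : `|x| = mx_norm x by [].
rewrite mx_normrE.
exact: (@le_bigmax _ _ _ 0 (fun ij : 'I_1 * 'I_d => `|x ij.1 ij.2|) (0, i)).
Qed.

Lemma norm_le_coord x (B : R) : 0 <= B -> (forall i, `|x 0 i| <= B) -> `|x| <= B.
Proof.
move=> B0 xB; have -> : `|x| = mx_norm x by [].
rewrite mx_normrE; apply/bigmax_leP; split=> // -[i j] _.
by rewrite /= ord1.
Qed.

Lemma diff_partials (g : 'rV[R]_d -> R) z v : differentiable g z ->
  'd g z v = \sum_i v 0 i * 'D_(delta_mx 0 i) g z.
Proof.
move=> dg; rewrite {1}(row_sum_delta v) linear_sum; apply: eq_bigr => i _.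
by rewrite linearZ /= deriveE.
Qed.

(** Mean value theorem along the segment from [y] to [x]. *)
Lemma MVT_segment_rV (g : 'rV[R]_d -> R) x y (r : R) :
  (forall z, `|z| <= r -> differentiable g z) -> `|x| <= r -> `|y| <= r ->
  exists z, [/\ `|z| <= Num.max `|x| `|y|, `|z - y| <= `|x - y| &
    g x - g y = \sum_i (x - y) 0 i * 'D_(delta_mx 0 i) g z].
Proof.
move=> dg xr yr.
pose c (s : R) : 'rV[R]_d := y + s *: (x - y).
have c_le (s : R) : 0 <= s <= 1 -> `|c s| <= Num.max `|x| `|y|.
  move=> /andP[s0 s1]; have -> : c s = (1 - s) *: y + s *: x.
    by rewrite /c scalerBr scalerBl scale1r addrA addrAC.
  apply: le_trans (ler_normD _ _) _; rewrite !normrZ !ger0_norm ?subr_ge0 //.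
  have : `|x| <= Num.max `|x| `|y| by rewrite le_max lexx.
  have : `|y| <= Num.max `|x| `|y| by rewrite le_max lexx orbT.
  move: (Num.max _ _) => m ym xm; nra.
have m_r : Num.max `|x| `|y| <= r by rewrite ge_max xr yr.
have dc (s : R) : is_diff s c (fun h : R => h *: (x - y)).
  have := is_diffD (is_diff_cst y s) (is_diff_scalel s (x - y)).
  by rewrite add0r.
have dgc (s : R) : 0 <= s <= 1 -> is_derive s (1 : R) (g \o c) ('d g (c s) (x - y)).
  move=> s01.
  have dgs : differentiable g (c s) by apply: dg; apply: le_trans (c_le s s01) m_r.
  have dgcs : differentiable (g \o c) s by apply: differentiable_comp.
  split; first exact: diff_derivable.
  by rewrite deriveE // diff_comp //= diff_val scale1r.
have cont : {within `[0, 1], continuous (g \o c)}.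
  apply: derivable_within_continuous => s hs.
  by apply: ex_derive; apply: dgc.
have [s] := @MVT_segment R (g \o c) (fun s => 'd g (c s) (x - y)) 0 1 ler01
  (fun s hs => dgc s (subset_itv_oo_cc hs)) cont.
rewrite in_itv /= => s01; rewrite subr0 mulr1 /c scale0r scale1r addr0 subrKC => ->.
exists (c s); split; first exact: c_le.
  rewrite /c addrC addKr normrZ; case/andP: s01 => s0 s1.
  by rewrite ger0_norm // ler_piMl.
apply: diff_partials; apply: dg; exact: le_trans (c_le s s01) m_r.
Qed.

End RowVectors.

Section MpolyInd.
Variables (R : realType) (d : nat).
Local Notation P := (mpoly d R).

(** Polynomials as formal expressions: facts stable under sum and product need only be
    checked on constants and variables. *)
Lemma mpoly_struct_ind (Q : P -> Prop) :
  (forall c, Q (mpolyC d c)) -> (forall i, Q (mpolyX R (mnm1 i))) ->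
  (forall p q, Q p -> Q q -> Q (p + q)) -> (forall p q, Q p -> Q q -> Q (p * q)) ->
  forall p, Q p.
Proof.
move=> QC QX QD QM; elim/mpolyind => [|c m p _ _ Qp]; first by rewrite -mpolyC0.
apply: QD => //; rewrite -mul_mpolyC; apply: (QM) => //.
rewrite mpolyXE_id; elim/big_ind: _ => [|p1 q1|i _]; [by rewrite -mpolyC1|exact: QM|].
by elim: (m i) => [|k IH]; [rewrite expr0 -mpolyC1 | rewrite exprS; apply: QM].
Qed.

Lemma mderiv_var (i j : 'I_d) : mderiv i (mpolyX R (mnm1 j)) = mpolyC d (i == j)%:R.
Proof.
rewrite mderivX mnmE eq_sym; have [->|_] := eqVneq i j; last by rewrite scale0r mpolyC0.
have -> : mnm_sub (mnm1 j) (mnm1 j) = mnm0 by apply/mnmP => k; rewrite !mnmE subnn.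
by rewrite mpolyX0 scale1r mpolyC1.
Qed.

Definition dirder (v : 'rV[R]_d) (p : P) (x : 'rV[R]_d) : R :=
  \sum_i v 0 i * evp (mderiv i p) x.

Lemma dirderC v c x : dirder v (mpolyC d c) x = 0.
Proof. by rewrite /dirder big1 // => i _; rewrite mderivC evp0 mulr0. Qed.

Lemma dirderX v j x : dirder v (mpolyX R (mnm1 j)) x = v 0 j.
Proof.
rewrite /dirder (bigD1 j) //= mderiv_var eqxx evpC mulr1 big1 ?addr0 // => i ij.
by rewrite mderiv_var (negPf ij) evpC mulr0.
Qed.

Lemma dirderD v p q x : dirder v (p + q) x = dirder v p x + dirder v q x.
Proof.
by rewrite /dirder -big_split; apply: eq_bigr => i _; rewrite mderivD evpD mulrDr.
Qed.

Lemma dirderM v p q x :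
  dirder v (p * q) x = dirder v p x * evp q x + evp p x * dirder v q x.
Proof.
rewrite /dirder mulr_suml mulr_sumr -big_split; apply: eq_bigr => i _ /=.
by rewrite mderivM evpD !evpM; ring.
Qed.

Lemma is_diff_evp p (x : 'rV[R]_d) : is_diff x (evp p) (fun v => dirder v p x).
Proof.
elim/mpoly_struct_ind: p => [c|i|p q dp dq|p q dp dq].
- have -> : evp (mpolyC d c) = cst c by apply/funext => y; rewrite evpC.
  by apply: is_diff_eq; apply/funext => v; rewrite dirderC.
- have -> : evp (mpolyX R (mnm1 i)) = (fun y : 'rV[R]_d => y 0 i).
    by apply/funext => y; rewrite evpX.
  apply: DiffDef; first exact: differentiable_coord.
  have cc : continuous (fun y : 'rV[R]_d => y 0 i) by exact: coord_continuous.
  have lin : linear (fun y : 'rV[R]_d => (y 0 i : R^o)) by move=> a u v; rewrite !mxE.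
  pose f : {linear 'rV[R]_d -> R^o} := HB.pack (fun y : 'rV[R]_d => (y 0 i : R^o))
     (GRing.isLinear.Build _ _ _ _ _ lin).
  have := @diff_lin R 'rV[R]_d R^o f x cc.
  rewrite /= => ->; apply/funext => v; by rewrite dirderX.
- have -> : evp (p + q) = evp p + evp q by apply/funext => y; rewrite evpD.
  by apply: is_diff_eq; apply/funext => v; rewrite dirderD.
- have -> : evp (p * q) = evp p * evp q by apply/funext => y; rewrite evpM.
  apply: is_diff_eq; apply/funext => v; rewrite dirderM.
  by rewrite addrC mulrC.
Qed.

Lemma differentiable_evp p (x : 'rV[R]_d) : differentiable (evp p) x.
Proof. by have [] := is_diff_evp p x. Qed.

Lemma derive_evp p (x : 'rV[R]_d) i : 'D_(delta_mx 0 i) (evp p) x = evp (mderiv i p) x.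
Proof.
rewrite deriveE; last exact: differentiable_evp.
have [_ ->] := is_diff_evp p x; rewrite /dirder (bigD1 i) //= mxE !eqxx mul1r.
by rewrite big1 ?addr0 // => j /negPf ji; rewrite mxE eqxx ji mul0r.
Qed.

Lemma is_derive_curve p (c : R -> 'rV[R]_d) (v : 'rV[R]_d) (t : R) :
  (forall i, is_derive t (1 : R) (fun s => c s 0 i) (v 0 i)) ->
  is_derive t (1 : R) (fun s => evp p (c s)) (dirder v p (c t)).
Proof.
move=> dc; elim/mpoly_struct_ind: p => [a|i|p q dp dq|p q dp dq].
- have -> : (fun s => evp (mpolyC d a) (c s)) = cst a by apply/funext => y; rewrite evpC.
  by rewrite dirderC; exact: is_derive_cst.
- have -> : (fun s => evp (mpolyX R (mnm1 i)) (c s)) = (fun s => c s 0 i).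
    by apply/funext => y; rewrite evpX.
  by rewrite dirderX; exact: dc.
- have -> : (fun s => evp (p + q) (c s)) = (fun s => evp p (c s)) + (fun s => evp q (c s)).
    by apply/funext => y; rewrite evpD.
  by rewrite dirderD; apply: is_deriveD.
- have -> : (fun s => evp (p * q) (c s)) = (fun s => evp p (c s)) * (fun s => evp q (c s)).
    by apply/funext => y; rewrite evpM.
  apply: is_derive_eq; rewrite dirderM /GRing.scale /=; ring.
Qed.

Lemma evp_bounded p : exists2 C : R, 0 <= C & forall x : 'rV[R]_d, `|x| <= 1 -> `|evp p x| <= C.
Proof.
elim/mpoly_struct_ind: p => [a|i|p q [C C0 HC] [D D0 HD]|p q [C C0 HC] [D D0 HD]].
- by exists `|a| => // x _; rewrite evpC.
- by exists 1 => // x x1; rewrite evpX; apply: le_trans (coord_le_norm x i) x1.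
- exists (C + D); first exact: addr_ge0.
  by move=> x x1; rewrite evpD (le_trans (ler_normD _ _)) // lerD ?HC ?HD.
- exists (C * D); first exact: mulr_ge0.
  by move=> x x1; rewrite evpM normrM ler_pM ?HC ?HD.
Qed.

Lemma dirder_le p : exists2 C : R, 0 <= C &
  forall (v x : 'rV[R]_d), `|x| <= 1 -> `|dirder v p x| <= C * `|v|.
Proof.
pose cs i := projT1 (cid2 (evp_bounded (mderiv i p))).
have csP i : 0 <= cs i /\ forall x : 'rV[R]_d, `|x| <= 1 -> `|evp (mderiv i p) x| <= cs i.
  by rewrite /cs; case: cid2.
exists (\sum_i cs i); first by apply: sumr_ge0 => i _; case: (csP i).
move=> v x x1; apply: le_trans (ler_norm_sum _ _ _) _; rewrite mulr_suml.
apply: ler_sum => i _; rewrite normrM mulrC ler_pM //; first by case: (csP i) => _; apply.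
exact: coord_le_norm.
Qed.

Lemma evp_lipschitz p : exists2 C : R, 0 <= C & forall x y : 'rV[R]_d, `|x| <= 1 -> `|y| <= 1 ->
  `|evp p x - evp p y| <= C * `|x - y|.
Proof.
have [C C0 HC] := dirder_le p; exists C => // x y x1 y1.
have [//|//|z [zm _ ->]] := @MVT_segment_rV R d (evp p) x y 1 (fun z _ => differentiable_evp p z).
under eq_bigr => i _ do rewrite derive_evp.
by apply: HC; apply: le_trans zm _; rewrite ge_max x1 y1.
Qed.

Lemma evp_taylor2 p : exists2 C : R, 0 <= C & forall x y : 'rV[R]_d, `|x| <= 1 -> `|y| <= 1 ->
  `|evp p x - evp p y - dirder (x - y) p y| <= C * `|x - y| ^+ 2.
Proof.
elim/mpoly_struct_ind: p => [a|i|p q [C C0 HC] [D D0 HD]|p q [C C0 HC] [D D0 HD]].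
- by exists 0 => // x y _ _; rewrite !evpC dirderC !subrr normr0 mul0r.
- by exists 0 => // x y _ _; rewrite !evpX dirderX !mxE subrr normr0 mul0r.
- exists (C + D); first exact: addr_ge0.
  move=> x y x1 y1; rewrite !evpD dirderD.
  have := HC x y x1 y1; have := HD x y x1 y1; move: (`|x - y| ^+ 2) => h hq hp.
  have -> : evp p x + evp q x - (evp p y + evp q y) - (dirder (x - y) p y + dirder (x - y) q y)
    = (evp p x - evp p y - dirder (x - y) p y) + (evp q x - evp q y - dirder (x - y) q y) by ring.
  by rewrite mulrDl (le_trans (ler_normD _ _)) // lerD.
- have [Bp Bp0 HBp] := evp_bounded p; have [Bq Bq0 HBq] := evp_bounded q.
  have [Lp Lp0 HLp] := evp_lipschitz p; have [Lq Lq0 HLq] := evp_lipschitz q.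
  exists (C * Bq + Bp * D + Lp * Lq); first by rewrite !addr_ge0 // mulr_ge0.
  move=> x y x1 y1; rewrite !evpM dirderM.
  have -> : evp p x * evp q x - evp p y * evp q y -
      (dirder (x - y) p y * evp q y + evp p y * dirder (x - y) q y) =
    (evp p x - evp p y - dirder (x - y) p y) * evp q y +
    evp p y * (evp q x - evp q y - dirder (x - y) q y) +
    (evp p x - evp p y) * (evp q x - evp q y) by ring.
  rewrite [leRHS]mulrDl [X in _ <= X + _]mulrDl.
  apply: le_trans (ler_normD _ _) _; apply: lerD.
    apply: le_trans (ler_normD _ _) _; apply: lerD; rewrite normrM.
      by rewrite mulrAC ler_pM ?HC ?HBq.
    by rewrite -mulrA ler_pM ?HD ?HBp.
  by rewrite normrM expr2 mulrACA ler_pM ?HLp ?HLq.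
Qed.

(** Defined through first derivatives, so that estimates go by induction with the mean value
    theorem. *)
Fixpoint flat (m : nat) (p : P) : Prop :=
  evp p 0 = 0 /\ match m with 0 => True | m'.+1 => forall i, flat m' (mderiv i p) end.

Lemma flat_bound m p : flat m p ->
  exists2 C : R, 0 <= C & forall x : 'rV[R]_d, `|x| <= 1 -> `|evp p x| <= C * `|x| ^+ m.+1.
Proof.
elim: m p => [|m IH] p /= [p0 dp].
  have [C C0 HC] := evp_lipschitz p; exists C => // x x1.
  by have := HC x 0 x1; rewrite normr0 ler01 p0 !subr0 expr1; apply.
pose cs i := projT1 (cid2 (IH _ (dp i))).
have csP i : 0 <= cs i /\ forall x : 'rV[R]_d, `|x| <= 1 -> `|evp (mderiv i p) x| <= cs i * `|x| ^+ m.+1.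
  by rewrite /cs; case: cid2.
exists (\sum_i cs i); first by apply: sumr_ge0 => i _; case: (csP i).
move=> x x1.
have [//||z [zm _]] := @MVT_segment_rV R d (evp p) x 0 1 (fun z _ => differentiable_evp p z).
  by rewrite normr0.
rewrite p0 !subr0 => ->; apply: le_trans (ler_norm_sum _ _ _) _; rewrite mulr_suml.
have zx : `|z| <= `|x| by apply: le_trans zm _; rewrite normr0 ge_max lexx normr_ge0.
apply: ler_sum => i _; rewrite derive_evp normrM exprS mulrCA ler_pM //.
  exact: coord_le_norm.
have [cs0 /(_ z (le_trans zx x1)) /le_trans] := csP i; apply.
by apply: ler_wpM2l => //; rewrite lerXn2r ?nnegrE.
Qed.

(** Linear functionals whose common kernel is the set of flat polynomials. *)
Fixpoint jets (m : nat) : seq (P -> R) :=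
  (fun p => evp p 0) :: match m with
    | 0 => [::]
    | m'.+1 => flatten [seq [seq (fun p => la (mderiv i p)) | la <- jets m'] | i <- enum 'I_d]
    end.

Lemma jets_flat m p : (forall la, List.In la (jets m) -> la p = 0) -> flat m p.
Proof.
elim: m p => [|m IH] p H /=; first by split=> //; apply: (H (fun p => evp p 0)); left.
split; first by apply: (H (fun p => evp p 0)); left.
move=> i; apply: IH => la la_in; apply: (H (fun p => la (mderiv i p))); right.
have : i \in enum 'I_d by rewrite mem_enum.
elim: (enum 'I_d) => //= j s IHs; rewrite inE => /predU1P[<-|/IHs in_s].
  by apply/List.in_app_iff; left; exact: (List.in_map (fun la p => la (mderiv i p))).
by apply/List.in_app_iff; right.
Qed.

Lemma jets_linear m la : List.In la (jets m) ->
  (forall p q, la (p + q) = la p + la q) /\ (forall c p, la (c *: p) = c * la p).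
Proof.
elim: m la => [|m IH] la /=.
  by case=> // <-; split=> *; rewrite ?evpD ?evpZ.
case=> [<-|]; first by split=> *; rewrite ?evpD ?evpZ.
elim: (enum 'I_d) => //= j s IHs /List.in_app_iff[|//].
move=> /List.in_map_iff[mu [<- /IH[muD muZ]]]; split=> *.
  by rewrite mderivD muD.
by rewrite mderivZ muZ.
Qed.

(** A space of polynomials has finite dimension modulo the common kernel of finitely many
    linear functionals. This provides uniform constants for all functions of a given
    order, whose estimates depend on one another. *)
Lemma finite_generation (las : seq (P -> R)) (I : P -> Prop) :
  (forall la, List.In la las ->
    (forall p q, la (p + q) = la p + la q) /\ (forall c p, la (c *: p) = c * la p)) ->
  (forall p q, I p -> I q -> I (p + q)) -> (forall c p, I p -> I (c *: p)) -> I 0 ->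
  exists (r : nat) (ps : nat -> P), (forall i, I (ps i)) /\
    forall p, I p -> exists cs : nat -> R,
      forall la, List.In la las -> la (p - \sum_(i < r) cs i *: ps i) = 0.
Proof.
move=> lin ID IZ I0; elim: las lin => [|mu las IH] lin.
  by exists 0%N, (fun=> 0); split=> // p _; exists (fun=> 0).
have [r [ps [Ips gen]]] := IH (fun la h => lin la (or_intror h)).
have [muD muZ] := lin mu (or_introl erefl).
have [trivial|] := pselect (forall p, I p -> (forall la, List.In la las -> la p = 0) -> mu p = 0).
  exists r, ps; split=> // p Ip; have [cs csP] := gen p Ip; exists cs => la [<-|/csP //].
  apply: trivial => //; apply: (ID) => //; rewrite -scaleN1r; apply: (IZ).
  by elim/big_ind: _ => // i _; exact: (IZ).
move=> /existsNP[p0 /not_implyP[Ip0 /not_implyP[p00 /eqP mu0]]].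
exists r.+1, (fun i => if i == r then p0 else ps i); split=> [i|p Ip]; first by case: ifP.
have [cs csP] := gen p Ip.
pose e := mu (p - \sum_(i < r) cs i *: ps i) / mu p0.
exists (fun i => if i == r then e else cs i) => la la_in.
have -> : \sum_(i < r.+1) (if val i == r then e else cs i) *: (if val i == r then p0 else ps i)
   = \sum_(i < r) cs i *: ps i + e *: p0.
  rewrite big_ord_recr /= eqxx; congr (_ + _); apply: eq_bigr => i _.
  by rewrite ltn_eqF.
have [laD laZ] := lin la la_in.
rewrite opprD addrA laD -scaleNr laZ.
case: la_in => [<-|la_in]; last by rewrite csP // p00 // mulr0 addr0.
by rewrite /e mulNr divfK ?subrr.
Qed.

End MpolyInd.

(** * Elementary inequalities and uniform constants *)

Section Inequalities.
Variable R : realType.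

(** A bounded quantity whose any bound [K] improves to [K / 2 + B] is at most [2 B]: apply
    this to the supremum. It takes the place of Gronwall's inequality. *)
Lemma halving (T : Type) (D : T -> Prop) (w : T -> R) (B : R) :
  (exists K0, forall i, D i -> w i <= K0) ->
  (forall K, (forall i, D i -> w i <= K) -> forall i, D i -> w i <= K / 2 + B) ->
  forall i, D i -> w i <= 2 * B.
Proof.
move=> [K0 wK0] half i0 Di0.
pose E : set R := [set w i | i in D].
have supE : has_sup E.
  by split; [exists (w i0), i0 | exists K0 => _ [i Di <-]; exact: wK0].
have wS i : D i -> w i <= sup E.
  by move=> Di; apply: sup_upper_bound supE _ _; exists i.
have /ge_sup : ubound E (sup E / 2 + B) by move=> _ [i Di <-]; exact: half wS _ Di.
by move=> /(_ supE.1) H; have := wS _ Di0; lra.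
Qed.

(** Young's inequality with a small weight on [w ^+ n]: either [s <= del * w], or [w] is at
    most [del^-1 * s]. *)
Lemma power_mixed (n j : nat) (del w s : R) : (j < n)%N -> 0 < del <= 1 ->
  0 <= w -> 0 <= s -> w ^+ j * s ^+ (n - j) <= del * w ^+ n + del^-1 ^+ n * s ^+ n.
Proof.
move=> jn /andP[d0 d1] w0 s0.
have dn : 1 <= del^-1 ^+ n by rewrite exprn_ege1 // invf_ge1.
have wn : 0 <= w ^+ n by exact: exprn_ge0.
have sn : 0 <= s ^+ n by exact: exprn_ge0.
have [small|big] := leP s (del * w).
  rewrite -[leLHS]addr0 lerD //; last by rewrite mulr_ge0 // (le_trans ler01).
  have -> : w ^+ n = w ^+ j * w ^+ (n - j) by rewrite -exprD subnKC // ltnW.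
  rewrite mulrCA ler_wpM2l ?exprn_ge0 //.
  apply: le_trans (_ : (del * w) ^+ (n - j) <= _); first by rewrite lerXn2r ?nnegrE ?mulr_ge0 ?(ltW d0).
  rewrite exprMn ler_wpM2r ?exprn_ge0 //.
  by rewrite -(subnSK jn) exprS ler_piMr ?exprn_ile1 // ltW.
rewrite -[leLHS]add0r lerD //; first by rewrite mulr_ge0 // ltW.
have -> : s ^+ n = s ^+ j * s ^+ (n - j) by rewrite -exprD subnKC // ltnW.
rewrite mulrA ler_wpM2r ?exprn_ge0 //.
apply: le_trans (_ : del^-1 ^+ j * s ^+ j <= _).
  rewrite -exprMn lerXn2r ?nnegrE ?mulr_ge0 ?invr_ge0 ?(ltW d0) //.
  by rewrite mulrC ler_pdivlMr // mulrC ltW.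
by rewrite ler_wpM2r ?exprn_ge0 // ler_weXn2l ?invf_ge1 // ltnW.
Qed.

Lemma power_mixed1 (n j : nat) (w s : R) : (j <= n)%N ->
  0 <= w -> 0 <= s -> w ^+ j * s ^+ (n - j) <= w ^+ n + s ^+ n.
Proof.
rewrite leq_eqVlt => /predU1P[->|jn] w0 s0.
  by rewrite subnn expr0 mulr1 lerDl exprn_ge0.
by have := @power_mixed n j 1 w s jn; rewrite invr1 expr1n !mul1r ltr01 lexx; exact.
Qed.

Lemma power_sum_le (k : nat) (a b : R) : 0 <= a -> 0 <= b ->
  (a + b) ^+ k <= 2 ^+ k * (a ^+ k + b ^+ k).
Proof.
move=> a0 b0.
wlog ab : a b a0 b0 / a <= b.
  move=> H; have [/H|/ltW /H] := leP a b; first exact.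
  by rewrite addrC [X in _ <= _ * X]addrC; exact.
apply: le_trans (_ : (2 * b) ^+ k <= _).
  rewrite lerXn2r ?nnegrE ?addr_ge0 ?mulr_ge0 //; lra.
by rewrite exprMn ler_wpM2l ?exprn_ge0 // lerDr exprn_ge0.
Qed.

(** Finitely many existence statements merge into one, because the constants may be enlarged
    and the time bounds reduced. *)
Lemma uniform_constants (r : nat) (Q : nat -> R -> R -> Prop) :
  (forall i C C' t t', Q i C t -> C <= C' -> 0 < t' <= t -> Q i C' t') ->
  (forall i, (i < r)%N -> exists C t, [/\ 0 <= C, 0 < t & Q i C t]) ->
  exists C t, [/\ 0 <= C, 0 < t & forall i, (i < r)%N -> Q i C t].
Proof.
move=> mono; elim: r => [|r IH] H; first by exists 0, 1.
have [//|C [t [C0 t0 HC]]] := IH _; first by move=> i ir; apply: H; exact: ltnW.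
have [//|C' [t' [C'0 t'0 HC']]] := H r _.
exists (C + C'), (Num.min t t'); split; [exact: addr_ge0 | by rewrite lt_min t0 |].
move=> i; rewrite ltnS leq_eqVlt => /predU1P[->|ir].
  by apply: mono HC' _ _; [lra | rewrite lt_min t0 t'0 ge_min lexx orbT].
by apply: mono (HC i ir) _ _; [lra | rewrite lt_min t0 t'0 ge_min lexx].
Qed.

Lemma uniform_fin (T : finType) (Q : T -> R -> Prop) :
  (forall i C C', Q i C -> C <= C' -> Q i C') ->
  (forall i, exists2 C, 0 <= C & Q i C) -> exists2 C, 0 <= C & forall i, Q i C.
Proof.
move=> mono H; pose cs i := projT1 (cid2 (H i)).
have csP i : 0 <= cs i /\ Q i (cs i) by rewrite /cs; case: cid2.
exists (\sum_i cs i) => [|i]; first by apply: sumr_ge0 => i _; case: (csP i).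
have [_ /mono] := csP i; apply; rewrite (bigD1 i) //= lerDl.
by apply: sumr_ge0 => j _; case: (csP j).
Qed.

Lemma uniform_fin2 (T : finType) (Q : T -> R -> R -> Prop) :
  (forall i C C' t t', Q i C t -> C <= C' -> 0 < t' <= t -> Q i C' t') ->
  (forall i, exists C t, [/\ 0 <= C, 0 < t & Q i C t]) ->
  exists C t, [/\ 0 <= C, 0 < t & forall i, Q i C t].
Proof.
move=> mono H.
have [i C C' t t' HQ CC' tt' hi|i ir|C [t [C0 t0 HC]]] :=
  @uniform_constants #|T| (fun n C t => forall h : (n < #|T|)%N, Q (enum_val (Ordinal h)) C t).
- exact: mono (HQ hi) CC' tt'.
- have [C [t [C0 t0 HC]]] := H (enum_val (Ordinal ir)).
  by exists C, t; split=> // h; rewrite (bool_irrelevance h ir).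
- exists C, t; split=> // i; rewrite -(enum_rankK i).
  by have := HC (enum_rank i) (ltn_ord _) (ltn_ord _); rewrite (_ : Ordinal _ = enum_rank i) //; exact: val_inj.
Qed.

End Inequalities.

(** * Order of functions along a trajectory in reduced form *)

Section Reduced.
Variables (R : realType) (d n : nat).
Hypothesis lt1n : (1 < n)%N.
Let n0 : (0 < n)%N := ltnW lt1n.
Local Notation P := (mpoly d R).
Variables (F0 F1 : vfield R d).
Hypothesis F00 : val0 F0 = 0.

Definition adfield j := vmag F0 F1 (ad_X1 j X0).

Lemma n1_ad j : n1 (ad_X1 j X0) = j.
Proof. by rewrite /ad_X1; elim: j => //= j ->. Qed.

(** Derivative of [p] along the field [sum_j v^j / j! ad_{F1}^j(F0)]. *)
Definition drift (p : P) (v : R) (x : 'rV[R]_d) : R :=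
  \sum_(j < n.+1) v ^+ j / j`!%:R * evp (lder (adfield j) p) x.

(** A trajectory [y] of the equation driven by [v], in integrated form. The function [I] stands
    for the integral of [|v|^n], and [red_incr] says that a pointwise bound on the derivative of
    [p(y) - kap I], including the error [K p * (|v| + |y|)^(n+1)] of the equation of [p], may be
    integrated. *)
Record reduced (K : P -> R) (t : R) (v : R -> R) (y : R -> 'rV[R]_d) (I : R -> R)
  : Prop := Reduced {
  red_t : 0 <= t <= 1;
  red_v : forall s, 0 <= s <= t -> `|v s| <= 1;
  red_y : forall s, 0 <= s <= t -> `|y s| <= 1;
  red_y0 : y 0 = 0;
  red_I : forall s, 0 <= s <= t -> 0 <= I s <= I t;
  red_incr : forall p kap al be, 0 <= al -> 0 <= be ->
    (forall s, 0 <= s <= t ->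
       `|drift p (v s) (y s) - kap * `|v s| ^+ n| + K p * (`|v s| + `|y s|) ^+ n.+1
       <= al * `|v s| ^+ n + be) ->
    forall s, 0 <= s <= t -> `|evp p (y s) - evp p 0 - kap * I s| <= al * I s + be * s
}.

Variable K : P -> R.
Hypothesis K0 : forall p, 0 <= K p.

(** [sig] is the scale of the trajectory; it dominates [I t ^ (1/n)]. *)
Definition admissible (t0 t : R) v y I (sig : R) :=
  [/\ reduced K t v y I, t <= t0, 0 < sig <= 1 & I t <= sig ^+ n].

Definition order_bound (m : nat) (p : P) (C t0 : R) :=
  forall t v y I sig, admissible t0 t v y I sig ->
    forall s, 0 <= s <= t -> `|evp p (y s)| <= C * sig ^+ m.

Definition has_order (m : nat) (p : P) :=
  exists C t0, [/\ 0 <= C, 0 < t0 & order_bound m p C t0].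

Lemma admissible_mono t0 t1 t v y I sig :
  t1 <= t0 -> admissible t1 t v y I sig -> admissible t0 t v y I sig.
Proof. by move=> le_t [red le_t1 sg It]; split=> //; exact: le_trans le_t1 le_t. Qed.

Lemma order_bound_mono m p C C' t t' :
  order_bound m p C t -> C <= C' -> 0 < t' <= t -> order_bound m p C' t'.
Proof.
move=> ob CC' /andP[_ tt'] u v y I sig adm s us.
have /le_trans := ob _ _ _ _ _ (admissible_mono tt' adm) s us; apply.
by case: adm => _ _ /andP[/ltW sg0 _] _; rewrite ler_wpM2r ?exprn_ge0.
Qed.

Lemma drift_split p v x :
  drift p v x = evp (lder F0 p) x +
    \sum_(j < n) v ^+ j.+1 / (j.+1)`!%:R * evp (lder (adfield j.+1) p) x.
Proof. by rewrite /drift big_ord_recl /= expr0 divr1 mul1r. Qed.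

Lemma fact_inv_le1 j : `|(j`!%:R : R)^-1| <= 1.
Proof.
by rewrite ger0_norm ?invr_ge0 // invf_le1 ?ltr0n ?fact_gt0 // ler1n fact_gt0.
Qed.

(** The coordinates are the functions of order one. The factor
    [del + t * del^-1 ^+ n] can be made small, which is more than order one; it comes
    from Young's inequality applied to the terms linear in [v]. *)
Lemma state_bound : exists C t0, [/\ 0 <= C, 0 < t0 &
  forall t v y I sig, admissible t0 t v y I sig -> forall del, 0 < del <= 1 ->
    forall s, 0 <= s <= t -> `|y s| <= C * (del + t * del^-1 ^+ n) * sig].
Proof.
pose X (i : 'I_d) : P := mpolyX R (mnm1 i).
have lin0 (i : 'I_d) : exists2 C : R, 0 <= C &
    forall x : 'rV[R]_d, `|x| <= 1 -> `|evp (lder F0 (X i)) x| <= C * `|x|.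
  have [C C0 HC] := evp_lipschitz (lder F0 (X i)); exists C => // x x1.
  have := HC x 0 x1; rewrite normr0 ler01 !subr0 evp_lder0 big1 ?subr0; first exact.
  by move=> j _; rewrite F00 mxE mul0r.
have rhs (i : 'I_d) : exists2 C : R, 0 <= C & forall (v : R) (x : 'rV[R]_d),
    `|v| <= 1 -> `|x| <= 1 ->
    `|drift (X i) v x| + K (X i) * (`|v| + `|x|) ^+ n.+1 <= C * (`|v| + `|x|).
  have [C C0 HC] := lin0 i.
  pose Cj (j : nat) := projT1 (cid2 (evp_bounded (lder (adfield j.+1) (X i)))).
  have CjP j : 0 <= Cj j /\ forall x, `|x| <= 1 -> `|evp (lder (adfield j.+1) (X i)) x| <= Cj j.
    by rewrite /Cj; case: cid2.
  exists (C + \sum_(j < n) Cj j + K (X i) * 2 ^+ n).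
    by rewrite !addr_ge0 ?mulr_ge0 ?exprn_ge0 ?sumr_ge0 // => j _; case: (CjP j).
  move=> v x v1 x1; have nv := normr_ge0 v; have nx := normr_ge0 x.
  rewrite 2!mulrDl; apply: lerD.
    rewrite drift_split; apply: le_trans (ler_normD _ _) _; apply: lerD.
      by apply: le_trans (HC x x1) _; rewrite ler_wpM2l // lerDr.
    apply: le_trans (ler_norm_sum _ _ _) _; rewrite mulr_suml.
    apply: ler_sum => j _; have [Cj0 HCj] := CjP j.
    rewrite !normrM normrX mulrC ler_pM ?mulr_ge0 ?exprn_ge0 ?HCj //.
    apply: le_trans (_ : `|v| <= _); last by rewrite lerDl.
    rewrite -[leRHS]mulr1 ler_pM ?exprn_ge0 ?fact_inv_le1 //.
    by rewrite exprS ler_piMr // exprn_ile1.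
  rewrite -mulrA ler_wpM2l // exprSr ler_wpM2r ?addr_ge0 //.
  rewrite lerXn2r ?nnegrE ?addr_ge0 //; lra.
have [C C0 HC] := uniform_fin (Q := fun i C => forall (v : R) (x : 'rV[R]_d),
    `|v| <= 1 -> `|x| <= 1 ->
    `|drift (X i) v x| + K (X i) * (`|v| + `|x|) ^+ n.+1 <= C * (`|v| + `|x|))
  (fun i C C' H CC' v x v1 x1 => le_trans (H v x v1 x1)
     (ler_wpM2r (addr_ge0 (normr_ge0 v) (normr_ge0 x)) CC')) rhs.
exists (2 * C), (2 * C + 1)^-1; split; first by rewrite mulr_ge0.
  by rewrite invr_gt0; lra.
move=> t v y I sig [red le_t /andP[sig0 sig1] It] del del01 s0 s0t.
have [/andP[t0 t1] v1 y1 y00 I01 incr] := red.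
have Ct : t * C <= 1 / 2.
  have : t * (2 * C + 1) <= 1 by rewrite -ler_pdivlMr ?mul1r //; lra.
  by lra.
pose B := C * (del + t * del^-1 ^+ n) * sig.
suff : `|y s0| <= 2 * B by rewrite /B !mulrA.
apply: (@halving _ _ (fun s => 0 <= s <= t) (fun s => `|y s|) B _ _ s0 s0t).
  by exists 1 => s; exact: y1.
have del0 : 0 < del by case/andP: del01.
have dn0 : 0 < del^-1 ^+ n by rewrite exprn_gt0 ?invr_gt0.
move=> L yL s st.
have L0 : 0 <= L by apply: le_trans (yL s st).
have sn1 : 0 < sig ^+ n.-1 by rewrite exprn_gt0.
have snE : sig ^+ n = sig ^+ n.-1 * sig by rewrite -exprSr prednK.
have B0 : 0 <= B by rewrite /B !mulr_ge0 ?addr_ge0 ?mulr_ge0 // ltW.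
apply: norm_le_coord => [|i]; first by rewrite addr_ge0 ?divr_ge0.
have := incr (X i) 0 (C * del / sig ^+ n.-1) (C * (del^-1 ^+ n) * sig + C * L).
have dC : 0 <= C * del / sig ^+ n.-1 by rewrite !mulr_ge0 ?invr_ge0 // ltW.
have dB : 0 <= C * (del^-1 ^+ n) * sig + C * L.
  by rewrite addr_ge0 ?mulr_ge0 // ltW.
move=> /(_ dC dB) H; have {}H := H _ s st.
have := H; rewrite !evpX mxE subr0 mul0r subr0 => {}H.
apply: le_trans (H _) _.
  move=> r rt; have [vr yr] := (v1 r rt, y1 r rt).
  rewrite mul0r subr0; apply: le_trans (HC i (v r) (y r) vr yr) _.
  rewrite mulrDr addrA lerD ?ler_wpM2l ?yL //.
  have := power_mixed lt1n del01 (normr_ge0 (v r)) (ltW sig0).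
  rewrite expr1 subn1 snE => pm.
  rewrite -!mulrA -mulrDr ler_wpM2l //.
  rewrite -(ler_pM2r sn1) mulrDl; apply: le_trans pm _.
  rewrite le_eqVlt; apply/orP; left; apply/eqP.
  by field; rewrite gt_eqF.
have [Is0 IsI] := andP (I01 s st).
have [ss0 sst] := andP st.
have H1 : C * del / sig ^+ n.-1 * I s <= C * del * sig.
  rewrite -!mulrA !ler_wpM2l // ?(ltW del0) // ler_pdivrMl // -snE.
  exact: le_trans IsI It.
have H2 : (C * del^-1 ^+ n * sig + C * L) * s <= C * (t * del^-1 ^+ n) * sig + L / 2.
  apply: le_trans (_ : (C * del^-1 ^+ n * sig + C * L) * t <= _).
    by rewrite ler_wpM2l.
  rewrite mulrDl; apply: lerD.
    by rewrite le_eqVlt; apply/orP; left; apply/eqP; ring.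
  by have := ler_wpM2l L0 Ct; lra.
apply: le_trans (lerD H1 H2) _.
rewrite le_eqVlt; apply/orP; left; apply/eqP; rewrite /B; ring.
Qed.

Lemma state_order : exists C t0, [/\ 0 <= C, 0 < t0 &
  forall t v y I sig, admissible t0 t v y I sig ->
    forall s, 0 <= s <= t -> `|y s| <= C * sig].
Proof.
have [C [t0 [C0 t00 HC]]] := state_bound; exists (C * 2), t0; split=> //.
  by rewrite mulr_ge0.
move=> t v y I sig adm s st; have [[/andP[tt0 tt1] _ _ _ _ _] _ /andP[sg0 _] _] := adm.
apply: le_trans (HC _ _ _ _ _ adm 1 _ s st) _; first by rewrite ltr01 lexx.
rewrite invr1 expr1n mulr1 ler_wpM2r ?(ltW sg0) // ler_wpM2l //; lra.
Qed.

(** Every term of the equation of a function of order [m.+1], apart from the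
    one without control, has the size of [sig ^+ m.+1] after integration. *)
Lemma controlled_part m p : (m < n)%N ->
  (forall j, (0 < j <= m)%N -> has_order (m.+1 - j) (lder (adfield j) p)) ->
  exists C t0, [/\ 0 <= C, 0 < t0 & forall t v y I sig, admissible t0 t v y I sig ->
    forall s, 0 <= s <= t ->
    `|drift p (v s) (y s) - evp (lder F0 p) (y s)| + K p * (`|v s| + `|y s|) ^+ n.+1
    <= C * ((`|v s| ^+ n + sig ^+ n) / sig ^+ (n - m.+1))].
Proof.
move=> ltmn ord.
have small (v sig : R) j : (j <= m.+1)%N -> 0 < sig <= 1 -> `|v| <= 1 ->
    `|v| ^+ j * sig ^+ (m.+1 - j) <= (`|v| ^+ n + sig ^+ n) / sig ^+ (n - m.+1).
  move=> jm /andP[sg0 sg1] v1.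
  rewrite ler_pdivlMr ?exprn_gt0 // -mulrA -exprD.
  have -> : (m.+1 - j + (n - m.+1))%N = (n - j)%N by lia.
  by apply: power_mixed1 => //; [lia | exact: ltW].
pose Q (i : nat) (C t0 : R) := forall t v y I sig, admissible t0 t v y I sig ->
  forall s, 0 <= s <= t ->
  `|v s ^+ i.+1 / (i.+1)`!%:R * evp (lder (adfield i.+1) p) (y s)|
    <= C * ((`|v s| ^+ n + sig ^+ n) / sig ^+ (n - m.+1)).
have Qmono i C C' t t' : Q i C t -> C <= C' -> 0 < t' <= t -> Q i C' t'.
  move=> QC CC' /andP[_ tt'] u v y I sig adm s us.
  apply: le_trans (QC _ _ _ _ _ (admissible_mono tt' adm) s us) _.
  case: adm => _ _ /andP[sg0 _] _; rewrite ler_wpM2r // divr_ge0 ?addr_ge0 ?exprn_ge0 //.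
  - exact: ltW.
  - exact: ltW.
have Qi i : (i < n)%N -> exists C t, [/\ 0 <= C, 0 < t & Q i C t].
  move=> iltn; have [im|mi] := leqP i.+1 m.
    have [C [t0 [C0 t00 HC]]] := ord i.+1 im; exists C, t0; split=> //.
    move=> t v y I sig adm s st; have [red _ sg _] := adm.
    have v1 := red_v red st.
    have := small (v s) sig i.+1 (leqW im) sg v1 => {}small.
    have := ler_wpM2l C0 small; apply: le_trans.
    rewrite mulrCA !normrM normrX -mulrA ler_wpM2l ?exprn_ge0 //.
    rewrite -[leRHS]mul1r ler_pM ?fact_inv_le1 //; exact: HC adm s st.
  have [C C0 HC] := evp_bounded (lder (adfield i.+1) p); exists C, 1; split=> //.
  move=> t v y I sig [red _ sg _] s st; have v1 := red_v red st.
  have := small (v s) sig m.+1 (leqnn _) sg v1; rewrite subnn expr0 mulr1 => {}small.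
  have := ler_wpM2l C0 small; apply: le_trans.
  rewrite mulrC !normrM normrX ler_pM ?mulr_ge0 ?exprn_ge0 //.
    exact: HC (red_y red st).
  rewrite -[leRHS]mulr1 ler_pM ?exprn_ge0 ?fact_inv_le1 //.
  by apply: ler_wiXn2l.
have [C [t0 [C0 t00 HC]]] := uniform_constants Qmono Qi.
have [Y [t1 [Y0 t10 HY]]] := state_order.
pose E := K p * 2 ^+ n.+1 * (1 + Y ^+ n.+1).
have E0 : 0 <= E by rewrite !mulr_ge0 ?addr_ge0 ?exprn_ge0.
exists (n%:R * C + E * 2), (Num.min t0 t1); split.
- by apply: addr_ge0; apply: mulr_ge0.
- by rewrite lt_min t00.
move=> t v y I sig adm s st.
have adm0 : admissible t0 t v y I sig by apply: admissible_mono adm; rewrite ge_min lexx.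
have adm1 : admissible t1 t v y I sig by apply: admissible_mono adm; rewrite ge_min lexx orbT.
have [red _ sg _] := adm; have v1 := red_v red st; have [sg0 sg1] := andP sg.
rewrite drift_split addrAC subrr add0r mulrDl; apply: lerD.
  apply: le_trans (ler_norm_sum _ _ _) _.
  apply: (@le_trans _ _ (\sum_(i < n) C * ((`|v s| ^+ n + sig ^+ n) / sig ^+ (n - m.+1)))).
    by apply: ler_sum => i _; exact: (HC i (ltn_ord i) _ _ _ _ _ adm0 s st).
  by rewrite sumr_const card_ord -[leLHS]mulr_natl [leLHS]mulrA.
set Z := (_ + _) / sig ^+ _; have -> : E * 2 * Z = K p * (2 ^+ n.+1 * ((1 + Y ^+ n.+1) * (2 * Z))).
  by rewrite /E; ring.
apply: ler_wpM2l => //.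
have nv := normr_ge0 (v s); have ny := normr_ge0 (y s).
apply: le_trans (power_sum_le n.+1 nv ny) _.
rewrite ler_wpM2l ?exprn_ge0 //.
have H1 : `|v s| ^+ n.+1 <= Z.
  have := small (v s) sig m.+1 (leqnn _) sg v1; rewrite subnn expr0 mulr1.
  by apply: le_trans; apply: ler_wiXn2l => //; exact: leqW.
have H2 : `|y s| ^+ n.+1 <= Y ^+ n.+1 * Z.
  have := small (v s) sig 0%N isT sg v1; rewrite expr0 mul1r subn0 => H3.
  apply: le_trans (_ : (Y * sig) ^+ n.+1 <= _).
    rewrite lerXn2r ?nnegrE ?mulr_ge0 ?(ltW sg0) //; exact: HY adm1 s st.
  rewrite exprMn ler_wpM2l ?exprn_ge0 //; apply: le_trans _ H3.
  by apply: ler_wiXn2l; [exact: ltW | exact: sg1 | exact: leqW].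
have Z0 : 0 <= Z by apply: le_trans _ H1; rewrite exprn_ge0.
have YZ : 0 <= Y ^+ n.+1 * Z by rewrite mulr_ge0 ?exprn_ge0.
move: H1 H2 YZ; move: (Y ^+ n.+1) (`|v s| ^+ n.+1) (`|y s| ^+ n.+1) => a b c; lra.
Qed.

(** Induction on [m]. The term without control sends functions of order [m.+1] to
    functions of the same order; it is handled for a finite generating family at once, where
    a common bound [L] of the generators reproduces itself up to the factor [t * C <= 1 / 2]. *)
Theorem vanish_order m p : (m < n)%N -> vanish F0 F1 m p -> has_order m.+1 p.
Proof.
have [k] := ubnP m; elim: k m p => // k IH m p mk ltmn vp.
have vad q j : (j <= m)%N -> vanish F0 F1 m q ->
    vanish F0 F1 (m - j) (lder (adfield j) q).
  by move=> jm vq; have := vanish_lder (b := ad_X1 j X0) _ vq; rewrite n1_ad; exact.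
have ord q : vanish F0 F1 m q ->
    forall j, (0 < j <= m)%N -> has_order (m.+1 - j) (lder (adfield j) q).
  by move=> vq j /andP[j0 jm]; rewrite subSn //; apply: IH; [lia|lia|exact: vad].
have [Y [t1 [Y0 t10 HY]]] := state_order.
have flat_order q : flat m q -> has_order m.+1 q.
  move=> /flat_bound[C C0 HC]; exists (C * Y ^+ m.+1), t1; split=> //.
    by rewrite mulr_ge0 ?exprn_ge0.
  move=> t v y I sig adm s st; have [red _ /andP[sg0 _] _] := adm.
  apply: le_trans (HC _ (red_y red st)) _; rewrite -mulrA ler_wpM2l // -exprMn.
  rewrite lerXn2r ?nnegrE ?mulr_ge0 ?(ltW sg0) //; exact: HY adm s st.
have [r [ps [vps gen]]] := finite_generation (@jets_linear R d m)
  (@vanishD _ _ F0 F1 m) (@vanishZ _ _ F0 F1 m) (@vanish0 _ _ F0 F1 m).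
have {gen} gen q : vanish F0 F1 m q -> exists cs : nat -> R,
    flat m (q - \sum_(i < r) cs i *: ps i).
  by move=> /gen[cs csP]; exists cs; exact: jets_flat.
pose bnd (L t : R) (y : R -> 'rV[R]_d) :=
  forall l s, (l < r)%N -> 0 <= s <= t -> `|evp (ps l) (y s)| <= L.
have comb q : vanish F0 F1 m q -> exists C t0, [/\ 0 <= C, 0 < t0 &
    forall t v y I sig, admissible t0 t v y I sig -> forall L, 0 <= L -> bnd L t y ->
    forall s, 0 <= s <= t -> `|evp q (y s)| <= C * (L + sig ^+ m.+1)].
  move=> /gen[cs /flat_order[C [t0 [C0 t00 HC]]]].
  exists (\sum_(i < r) `|cs i| + C), t0; split=> //; first by rewrite addr_ge0 ?sumr_ge0.
  move=> t v y I sig adm L L0 bL s st; have [_ _ /andP[/ltW sg0 _] _] := adm.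
  have -> : q = \sum_(i < r) cs i *: ps i + (q - \sum_(i < r) cs i *: ps i) by rewrite subrKC.
  have H1 : `|evp (\sum_(i < r) cs i *: ps i) (y s)| <= \sum_(i < r) `|cs i| * L.
    rewrite evp_sum; apply: le_trans (ler_norm_sum _ _ _) _; apply: ler_sum => i _.
    by rewrite evpZ normrM ler_wpM2l //; apply: bL.
  have H2 := HC _ _ _ _ _ adm s st; rewrite evpD; apply: le_trans (ler_normD _ _) _.
  have sgm : 0 <= sig ^+ m.+1 by rewrite exprn_ge0.
  rewrite [leRHS]mulrDl !mulrDr.
  have H3 : 0 <= (\sum_(i < r) `|cs i|) * sig ^+ m.+1 by rewrite mulr_ge0 ?sumr_ge0.
  have CL : 0 <= C * L by rewrite mulr_ge0.
  rewrite -mulr_suml in H1; lra.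
pose Q (i : nat) (C t0 : R) := forall t v y I sig, admissible t0 t v y I sig ->
  forall L, 0 <= L -> bnd L t y -> forall s, 0 <= s <= t ->
  `|drift (ps i) (v s) (y s)| + K (ps i) * (`|v s| + `|y s|) ^+ n.+1
    <= C * (L + (`|v s| ^+ n + sig ^+ n) / sig ^+ (n - m.+1)).
have Qmono i C C' t t' : Q i C t -> C <= C' -> 0 < t' <= t -> Q i C' t'.
  move=> QC CC' /andP[_ tt'] u v y I sig adm L L0 bL s us.
  apply: le_trans (QC _ _ _ _ _ (admissible_mono tt' adm) L L0 bL s us) _.
  case: adm => _ _ /andP[sg0 _] _.
  by rewrite ler_wpM2r // addr_ge0 // divr_ge0 ?addr_ge0 ?exprn_ge0 // ltW.
have sgE (sig : R) : 0 < sig -> sig ^+ n / sig ^+ (n - m.+1) = sig ^+ m.+1.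
  move=> sg0; have {1}-> : n = (m.+1 + (n - m.+1))%N by lia.
  by rewrite exprD mulfK // gt_eqF // exprn_gt0.
have Qi i : (i < r)%N -> exists C t, [/\ 0 <= C, 0 < t & Q i C t].
  move=> ir.
  have v0 : vanish F0 F1 m (lder (adfield 0) (ps i)).
    by have := vad (ps i) 0%N (leq0n _) (vps i); rewrite subn0.
  have [A [ta [A0 ta0 HA]]] := comb _ v0.
  have [B [tb [B0 tb0 HB]]] := controlled_part ltmn (ord _ (vps i)).
  exists (A + B), (Num.min ta tb); split; first exact: addr_ge0.
    by rewrite lt_min ta0.
  move=> t v y I sig adm L L0 bL s st.
  have adma : admissible ta t v y I sig by apply: admissible_mono adm; rewrite ge_min lexx.
  have admb : admissible tb t v y I sig by apply: admissible_mono adm; rewrite ge_min lexx orbT.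
  have [_ _ /andP[sg0 _] _] := adm.
  have := HA _ _ _ _ _ adma L L0 bL s st; have := HB _ _ _ _ _ admb s st.
  rewrite mulrDl sgE // -[adfield 0]/F0.
  have tri := ler_normD (drift (ps i) (v s) (y s) - evp (lder F0 (ps i)) (y s))
    (evp (lder F0 (ps i)) (y s)).
  rewrite subrK in tri.
  have W0 : 0 <= `|v s| ^+ n / sig ^+ (n - m.+1) by rewrite divr_ge0 ?exprn_ge0 // ltW.
  move: tri W0; set W := _ / _; set G := _ ^+ m.+1; have G0 : 0 <= G by rewrite exprn_ge0 // ltW.
  move=> tri W0 h1 h2.
  have AW := mulr_ge0 A0 W0; have BL := mulr_ge0 B0 L0.
  lra.
have [C [t2 [C0 t20 HC]]] := uniform_constants Qmono Qi.
have [A [ta [A0 ta0 HA]]] := comb p vp.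
pose t3 := Num.min t2 (Num.min ta (2 * C + 1)^-1).
have t30 : 0 < t3.
  by rewrite !lt_min t20 ta0 invr_gt0; apply: ltr_wpDl => //; apply: mulr_ge0.
exists (A * (4 * C + 1)), t3; split=> //.
  by apply: mulr_ge0 => //; apply: addr_ge0 => //; apply: mulr_ge0.
move=> t v y I sig adm s st.
have adm2 : admissible t2 t v y I sig by apply: admissible_mono adm; rewrite ge_min lexx.
have adma : admissible ta t v y I sig.
  by apply: admissible_mono adm; rewrite /t3 minCA ge_min lexx.
have [red tle /andP[sg0 sg1] It] := adm.
have [/andP[t_0 t_1] v1 y1 y00 I01 incr] := red.
have Ct : t * C <= 1 / 2.
  have : t * (2 * C + 1) <= 1.
    rewrite -ler_pdivlMr ?mul1r; last by apply: ltr_wpDl => //; apply: mulr_ge0.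
    by apply: le_trans tle _; rewrite /t3 !ge_min lexx !orbT.
  lra.
have G0 : 0 <= sig ^+ m.+1 by rewrite exprn_ge0 // ltW.
suff bL : bnd (2 * (2 * C * sig ^+ m.+1)) t y.
  apply: le_trans (HA _ _ _ _ _ adma _ _ bL s st) _.
    by do 2!apply: mulr_ge0 => //; apply: mulr_ge0.
  rewrite -[leRHS]mulrA; apply: ler_wpM2l => //; lra.
move=> l {}s lr {}st.
have := @halving R (nat * R)%type (fun ls => (ls.1 < r)%N /\ 0 <= ls.2 <= t)
  (fun ls => `|evp (ps ls.1) (y ls.2)|) (2 * C * sig ^+ m.+1) _ _ (l, s) (conj lr st).
apply.
  have [|B [_ [_ _ HB]]] := @uniform_constants R r (fun i B _ => forall s, 0 <= s <= t ->
    `|evp (ps i) (y s)| <= B) (fun i C C' _ _ H CC' _ u ut => le_trans (H u ut) CC') _.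
    move=> i _; have [B B0 HB] := evp_bounded (ps i); exists B, 1; split=> // u ut.
    by apply: HB; exact: y1.
  by exists B => -[i u] /= [ir ut]; exact: HB.
move=> L HL [i u] [/= ir ut].
have L0 : 0 <= L by apply: le_trans (HL (i, u) (conj ir ut)).
have bL : bnd L t y by move=> l' u' lr' ut'; exact: (HL (l', u') (conj lr' ut')).
have D0 : 0 < sig ^+ (n - m.+1) by rewrite exprn_gt0.
have CD : 0 <= C / sig ^+ (n - m.+1) by rewrite divr_ge0 // ltW.
have CG : 0 <= C * (L + sig ^+ m.+1) by rewrite mulr_ge0 ?addr_ge0.
have := incr (ps i) 0 _ _ CD CG; rewrite (vanish_evp0 (vps i)) => H.
have {}H := H _ u ut; rewrite mul0r !subr0 in H.
apply: le_trans (H _) _.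
  move=> w wt; rewrite mul0r subr0.
  apply: le_trans (HC i ir _ _ _ _ _ adm2 L L0 bL w wt) _.
  by rewrite mulrDl sgE // le_eqVlt; apply/orP; left; apply/eqP; ring.
have [Iu0 IuI] := andP (I01 u ut); have [u0 u_t] := andP ut.
have H1 : C / sig ^+ (n - m.+1) * I u <= C * sig ^+ m.+1.
  rewrite -sgE // -mulrA ler_wpM2l // mulrC ler_wpM2r ?invr_ge0 ?(ltW D0) //.
  exact: le_trans IuI It.
have H2 : C * (L + sig ^+ m.+1) * u <= L / 2 + C * sig ^+ m.+1.
  apply: le_trans (_ : C * (L + sig ^+ m.+1) * t <= _); first by rewrite ler_wpM2l.
  have := ler_wpM2l L0 Ct; have : C * sig ^+ m.+1 * t <= C * sig ^+ m.+1.
    by rewrite ler_piMr // mulr_ge0.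
  lra.
lra.
Qed.
End Reduced.

Section PrivilegedDrift.
Variables (R : realType) (d n : nat).
Hypothesis lt1n : (1 < n)%N.
Hypothesis even_n : forall v : R, v ^+ n = `|v| ^+ n.
Local Notation P := (mpoly d R).
Variables (F0 F1 : vfield R d).
Hypothesis F00 : val0 F0 = 0.
Variable K : P -> R.
Hypothesis K0 : forall p, 0 <= K p.
Variable phi : P.
Hypothesis vphi : vanish F0 F1 n.-1 phi.

Let n0 : (0 < n)%N := ltnW lt1n.
Local Notation adf := (adfield F0 F1).
Local Notation adm := (admissible n F0 F1 K).
Let g := evp (lder (adf n) phi) 0.

(** In the equation of [phi] the coefficient of [v^j], for [j < n], is of order [n - j];
    the coefficient of [v^n / n!] is [g] up to [O(sig)]. Evenness of [n] identifies [v^n]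
    with [|v|^n]. *)
Lemma privileged_drift : exists C t0, [/\ 0 <= C, 0 < t0 &
  forall t v y I sig, adm t0 t v y I sig ->
  forall rho, (forall s, 0 <= s <= t -> `|v s| <= rho) ->
  forall del, 0 < del <= 1 ->
  `|evp phi (y t) - g / n`!%:R * I t|
    <= C * (del + rho + sig + t * del^-1 ^+ n) * sig ^+ n].
Proof.
have [Y [ty [Y0 ty0 HY]]] := state_order lt1n F1 F00 K0.
pose Q (j : nat) (C t0 : R) :=
  order_bound n F0 F1 K (n - j) (lder (adf j) phi) C t0.
have Qmono j C C' t t' : Q j C t -> C <= C' -> 0 < t' <= t -> Q j C' t'.
  exact: order_bound_mono.
have Qj j : (j < n)%N -> exists C t, [/\ 0 <= C, 0 < t & Q j C t].
  move=> jn; have vj : vanish F0 F1 (n.-1 - j) (lder (adf j) phi).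
    have := vanish_lder (F0 := F0) (F1 := F1) (b := ad_X1 j X0) _ vphi.
    by rewrite n1_ad; apply; lia.
  have -> : Q j = order_bound n F0 F1 K (n.-1 - j).+1 (lder (adf j) phi).
    by rewrite /Q; congr order_bound; lia.
  by apply: vanish_order vj => //; lia.
have [C [t0 [C0 t00 HC]]] := uniform_constants Qmono Qj.
have [L L0 HL] := evp_lipschitz (lder (adf n) phi).
pose E := n%:R * C + L * Y + K phi * 2 ^+ n.+1 * (1 + Y ^+ n.+1).
have nC : 0 <= n%:R * C by apply: mulr_ge0.
have LY : 0 <= L * Y by apply: mulr_ge0.
have KE : 0 <= K phi * 2 ^+ n.+1 * (1 + Y ^+ n.+1).
  by apply: mulr_ge0; [apply: mulr_ge0 | apply: addr_ge0]; rewrite ?exprn_ge0.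
have E0 : 0 <= E by rewrite /E !addr_ge0.
exists (2 * E), (Num.min t0 ty); split.
- by apply: mulr_ge0.
- by rewrite lt_min t00.
move=> t v y I sig admt rho vrho del del01.
have adm0 : adm t0 t v y I sig by apply: admissible_mono admt; rewrite ge_min lexx.
have admy : adm ty t v y I sig by apply: admissible_mono admt; rewrite ge_min lexx orbT.
have [red tle /andP[sg0 sg1] It] := admt.
have [/andP[t_0 t_1] v1 y1 y00 I01 incr] := red.
have tt : 0 <= t <= t by rewrite t_0 lexx.
have [del0 del1] := andP del01.
have rho0 : 0 <= rho by apply: le_trans (vrho t tt).
have dn : 1 <= del^-1 ^+ n by rewrite exprn_ege1 // invf_ge1.
have dn0 : 0 <= del^-1 ^+ n by apply: le_trans dn.
have sn0 : 0 <= sig ^+ n by rewrite exprn_ge0 // ltW.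
pose al := E * (del + rho + sig).
pose be := E * (del^-1 ^+ n + sig) * sig ^+ n.
have al0 : 0 <= al by apply: mulr_ge0 => //; rewrite !addr_ge0 // ltW.
have be0 : 0 <= be.
  by apply: mulr_ge0 => //; apply: mulr_ge0 => //; rewrite addr_ge0 // ltW.
have phi0 : evp phi 0 = 0 by exact: vanish_evp0 vphi.
have rhs s : 0 <= s <= t -> `|drift n F0 F1 phi (v s) (y s) - g / n`!%:R * `|v s| ^+ n| +
    K phi * (`|v s| + `|y s|) ^+ n.+1 <= al * `|v s| ^+ n + be.
  move=> st; have vn0 : 0 <= `|v s| ^+ n by rewrite exprn_ge0.
  have H1 : `|\sum_(j < n) v s ^+ j / j`!%:R * evp (lder (adf j) phi) (y s)| <=
      n%:R * C * (del * `|v s| ^+ n + del^-1 ^+ n * sig ^+ n).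
    apply: le_trans (ler_norm_sum _ _ _) _.
    apply: (@le_trans _ _ (\sum_(j < n) C * (del * `|v s| ^+ n + del^-1 ^+ n * sig ^+ n))).
      apply: ler_sum => j _.
      have := power_mixed (ltn_ord j) del01 (normr_ge0 (v s)) (ltW sg0).
      move=> /(ler_wpM2l C0); apply: le_trans.
      rewrite mulrCA !normrM normrX -mulrA ler_wpM2l ?exprn_ge0 //.
      rewrite -[leRHS]mul1r ler_pM ?fact_inv_le1 //.
      exact: (HC j (ltn_ord j) _ _ _ _ _ adm0 s st).
    by rewrite sumr_const card_ord -[leLHS]mulr_natl [leLHS]mulrA.
  have H2 : `|v s ^+ n / n`!%:R * evp (lder (adf n) phi) (y s) - g / n`!%:R * `|v s| ^+ n| <=
      L * Y * sig * `|v s| ^+ n.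
    rewrite even_n; have -> : `|v s| ^+ n / n`!%:R * evp (lder (adf n) phi) (y s) -
        g / n`!%:R * `|v s| ^+ n =
      (n`!%:R^-1 * (evp (lder (adf n) phi) (y s) - g)) * `|v s| ^+ n by ring.
    rewrite normrM [X in _ * X]ger0_norm // ler_wpM2r // normrM.
    rewrite -[leRHS]mul1r ler_pM ?fact_inv_le1 //.
    have := HL (y s) 0 (y1 s st); rewrite normr0 ler01 subr0 => /(_ isT) /le_trans; apply.
    by rewrite -mulrA ler_wpM2l //; exact: HY admy s st.
  have H3 : K phi * (`|v s| + `|y s|) ^+ n.+1 <= K phi * 2 ^+ n.+1 * (1 + Y ^+ n.+1) *
      (rho * `|v s| ^+ n + sig * sig ^+ n).
    rewrite -!mulrA ler_wpM2l //.
    apply: le_trans (power_sum_le n.+1 (normr_ge0 _) (normr_ge0 _)) _.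
    rewrite ler_wpM2l ?exprn_ge0 //.
    have a1 : `|v s| ^+ n.+1 <= rho * `|v s| ^+ n.
      by rewrite exprS ler_wpM2r // vrho.
    have a2 : `|y s| ^+ n.+1 <= Y ^+ n.+1 * (sig * sig ^+ n).
      rewrite -exprS -exprMn lerXn2r ?nnegrE ?mulr_ge0 ?(ltW sg0) //.
      exact: HY admy s st.
    have b1 : 0 <= rho * `|v s| ^+ n by rewrite mulr_ge0.
    have b2 : 0 <= sig * sig ^+ n by rewrite mulr_ge0 // ltW.
    have b3 : 0 <= Y ^+ n.+1 * (rho * `|v s| ^+ n) by rewrite mulr_ge0 ?exprn_ge0.
    rewrite [leRHS]mulrDl mul1r [X in _ <= _ + X]mulrDr; apply: lerD.
      by apply: le_trans a1 _; rewrite lerDl.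
    by apply: le_trans a2 _; rewrite lerDr.
  have -> : drift n F0 F1 phi (v s) (y s) - g / n`!%:R * `|v s| ^+ n =
    \sum_(j < n) v s ^+ j / j`!%:R * evp (lder (adf j) phi) (y s) +
    (v s ^+ n / n`!%:R * evp (lder (adf n) phi) (y s) - g / n`!%:R * `|v s| ^+ n).
    by rewrite /drift big_ord_recr /= addrA.
  apply: le_trans (lerD (le_trans (ler_normD _ _) (lerD H1 H2)) H3) _.
  rewrite /al /be /E.
  move: nC LY KE (ltW sg0) (ltW del0) => {H1 H2 H3}.
  move: (n%:R * C) (L * Y) (K phi * _ * _) (`|v s| ^+ n) (sig ^+ n) (del^-1 ^+ n) vn0 sn0 dn0
    => a b c w z e w0 z0 e0 a0 b0 c0 s0 d0.
  have m1 := mulr_ge0 d0 w0; have m2 := mulr_ge0 e0 z0; have m3 := mulr_ge0 s0 w0.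
  have m4 := mulr_ge0 rho0 w0; have m5 := mulr_ge0 s0 z0.
  have -> : (a + b + c) * (del + rho + sig) * w + (a + b + c) * (e + sig) * z =
    a * (del * w + e * z) + b * sig * w + c * (rho * w + sig * z) +
    (a * (rho * w + sig * w + sig * z) + b * (del * w + rho * w + e * z + sig * z)
      + c * (del * w + sig * w + e * z)) by ring.
  by rewrite lerDl !addr_ge0 // mulr_ge0 // !addr_ge0.
have := incr phi (g / n`!%:R) al be al0 be0 rhs t tt; rewrite phi0 subr0 => /le_trans; apply.
have H1 : al * I t <= al * sig ^+ n by rewrite ler_wpM2l.
have H2 : be * t <= E * (t * del^-1 ^+ n + t * sig) * sig ^+ n.
  by rewrite le_eqVlt; apply/orP; left; apply/eqP; rewrite /be; ring.
apply: le_trans (lerD H1 H2) _.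
have -> : al * sig ^+ n + E * (t * del^-1 ^+ n + t * sig) * sig ^+ n =
    E * (del + rho + sig + (t * del^-1 ^+ n + t * sig)) * sig ^+ n by rewrite /al; ring.
rewrite ler_wpM2r // [2 * E]mulrC -mulrA ler_wpM2l //.
have h1 := mulr_ge0 t_0 dn0; have h2 := ler_piMl (ltW sg0) t_1.
move: (t * del^-1 ^+ n) (t * sig) h1 h2 del0 rho0 sg0 => u w; lra.
Qed.

Definition der1_iter m (p : P) := iter m (lder F1) p.

Lemma der1_iter_vanish m : (m < n)%N -> vanish F0 F1 (n.-1 - m) (der1_iter m phi).
Proof.
elim: m => [_|m IH mn]; first by rewrite subn0.
have := vanish_lder (F0 := F0) (F1 := F1) (b := X1) _ (IH (ltnW mn)).
by rewrite -subnDA addn1; apply; rewrite /=; lia.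
Qed.

(** If [x] is the point reached from [y] by the flow of [F1] in time [a], this is the
    remainder of order [n] of the exponential series of [p]. *)
Definition flow_error (x y : 'rV[R]_d) (a : R) (p : P) : R :=
  evp p x - \sum_(m < n) a ^+ m / m`!%:R * evp (der1_iter m p) y.

(** Here [x] is the end point and [y t] its image by the flow. All terms of the
    exponential series but the first carry a factor [v t], which is [O(eps * sig)] since it is
    bounded by [x] and [y t]; and [phi] differs from its differential at 0 by [O(|x|^2)]. *)
Lemma endpoint_drift (A : R) : 0 <= A -> exists C t0, [/\ 0 <= C, 0 < t0 &
  forall t v y I sig, adm t0 t v y I sig ->
  forall rho, (forall s, 0 <= s <= t -> `|v s| <= rho) ->
  forall del, 0 < del <= 1 -> forall x : 'rV[R]_d,
  `|x| <= 1 -> `|x| <= sig ^+ n -> `|v t| <= A * (`|x| + `|y t|) ->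
  `|flow_error x (y t) (v t) phi| <=
     K phi * (`|v t| ^+ n + `|v t| * (`|v t| + `|y t|) ^+ n) ->
  forall eps, del + rho + sig + t * del^-1 ^+ n <= eps -> eps <= 1 ->
  `|dirder x phi 0 - g / n`!%:R * I t| <= C * eps * sig ^+ n].
Proof.
move=> A0.
have [C1 [t1 [C10 t10 H1]]] := privileged_drift.
have [C2 [t2 [C20 t20 H2]]] := state_bound lt1n F1 F00 K0.
pose Q (m : nat) (C t0 : R) :=
  order_bound n F0 F1 K (n - m) (der1_iter m phi) C t0.
have Qmono j C C' t t' : Q j C t -> C <= C' -> 0 < t' <= t -> Q j C' t'.
  exact: order_bound_mono.
have Qm m : (m < n)%N -> exists C t, [/\ 0 <= C, 0 < t & Q m C t].
  move=> mn; have -> : Q m = order_bound n F0 F1 K (n.-1 - m).+1 (der1_iter m phi).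
    by rewrite /Q; congr order_bound; lia.
  by apply: vanish_order (der1_iter_vanish mn) => //; lia.
have [C3 [t3 [C30 t30 H3]]] := uniform_constants Qmono Qm.
have [C4 C40 H4] := evp_taylor2 phi.
pose B := A * (1 + C2).
have B0 : 0 <= B by rewrite mulr_ge0 ?addr_ge0.
pose C5 := n%:R * ((1 + B) ^+ n * C3).
pose C6 := K phi * (B ^+ n + B * (B + C2) ^+ n).
have C50 : 0 <= C5 by rewrite !mulr_ge0 ?exprn_ge0 ?addr_ge0.
have C60 : 0 <= C6.
  by rewrite mulr_ge0 // addr_ge0 ?mulr_ge0 ?exprn_ge0 ?addr_ge0.
exists (C1 + C5 + C6 + C4), (Num.min t1 (Num.min t2 t3)); split.
- by rewrite !addr_ge0.
- by rewrite !lt_min t10 t20.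
move=> t v y I sig admt rho vrho del del01 x x1 xs va flow eps le_eps eps1.
have adm1 : adm t1 t v y I sig by apply: admissible_mono admt; rewrite ge_min lexx.
have adm2 : adm t2 t v y I sig.
  by apply: admissible_mono admt; rewrite minCA ge_min lexx.
have adm3 : adm t3 t v y I sig.
  by apply: admissible_mono admt; rewrite !ge_min lexx !orbT.
have [red tle /andP[sg0 sg1] It] := admt.
have [/andP[t_0 t_1] v1 y1 y00 I01 incr] := red.
have tt : 0 <= t <= t by rewrite t_0 lexx.
have [del0 del1] := andP del01.
have rho0 : 0 <= rho by apply: le_trans (vrho t tt).
have dn : 1 <= del^-1 ^+ n by rewrite exprn_ege1 // invf_ge1.
have tdn0 : 0 <= t * del^-1 ^+ n by rewrite mulr_ge0 // (le_trans _ dn).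
have sn0 : 0 <= sig ^+ n by rewrite exprn_ge0 // ltW.
have eps0 : 0 < eps by apply: lt_le_trans le_eps; lra.
have sig_eps : sig <= eps by apply: le_trans le_eps; lra.
have y_le : `|y t| <= C2 * (eps * sig).
  apply: le_trans (H2 _ _ _ _ _ adm2 _ del01 t tt) _.
  rewrite -mulrA ler_wpM2l // ler_wpM2r ?(ltW sg0) //; lra.
have x_le : `|x| <= eps * sig.
  apply: le_trans xs _; apply: le_trans (_ : sig ^+ 2 <= _).
    by apply: ler_wiXn2l => //; exact: ltW.
  by rewrite expr2 ler_wpM2r // ltW.
have v_le : `|v t| <= B * (eps * sig).
  apply: le_trans va _; rewrite /B -mulrA ler_wpM2l // mulrDl mul1r; exact: lerD.
have es0 : 0 <= eps * sig by rewrite mulr_ge0 // ltW.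
have epsn m : (0 < m)%N -> eps ^+ m <= eps.
  move=> m0; rewrite -[leRHS]expr1; apply: ler_wiXn2l => //; exact: ltW.
have esn : (eps * sig) ^+ n <= eps * sig ^+ n.
  by rewrite exprMn ler_wpM2r // epsn.
have E1 : `|evp phi (y t) - g / n`!%:R * I t| <= C1 * eps * sig ^+ n.
  apply: le_trans (H1 _ _ _ _ _ adm1 _ vrho _ del01) _.
  by rewrite ler_wpM2r // ler_wpM2l.
have E2 : `|\sum_(m < n) v t ^+ m / m`!%:R * evp (der1_iter m phi) (y t) - evp phi (y t)|
    <= C5 * eps * sig ^+ n.
  rewrite (bigD1 (Ordinal n0)) //= expr0 divr1 mul1r addrAC subrr add0r.
  apply: le_trans (ler_norm_sum _ _ _) _.
  apply: (@le_trans _ _ (\sum_(m < n) (1 + B) ^+ n * C3 * (eps * sig ^+ n))); last first.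
    by rewrite sumr_const card_ord -[leLHS]mulr_natl /C5 !mulrA.
  have T0 : 0 <= (1 + B) ^+ n * C3 * (eps * sig ^+ n).
    by rewrite !mulr_ge0 ?exprn_ge0 ?addr_ge0 // ltW.
  rewrite [leRHS](bigID (fun m => m != Ordinal n0)) /= -[leLHS]addr0.
  apply: lerD; last by apply: sumr_ge0.
  apply: ler_sum => m m_neq0.
  have m_gt0 : (0 < m)%N by rewrite lt0n; apply: contra m_neq0 => /eqP m0; apply/eqP/val_inj.
  have Bm : B ^+ m <= (1 + B) ^+ n.
    apply: (@le_trans _ _ ((1 + B) ^+ m)).
      by rewrite lerXn2r ?nnegrE ?addr_ge0 // lerDr.
    by apply: ler_weXn2l; [rewrite lerDl | exact: ltnW].
  have h := H3 m (ltn_ord m) _ _ _ _ _ adm3 t tt.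
  rewrite !normrM normrX; apply: (@le_trans _ _ ((B * (eps * sig)) ^+ m * (C3 * sig ^+ (n - m)))).
    apply: ler_pM => //.
    rewrite -[leRHS]mulr1 ler_pM ?exprn_ge0 ?fact_inv_le1 //.
    by rewrite lerXn2r ?nnegrE // mulr_ge0.
  have snE : sig ^+ n = sig ^+ m * sig ^+ (n - m) by rewrite -exprD subnKC // ltnW.
  have -> : (B * (eps * sig)) ^+ m * (C3 * sig ^+ (n - m)) = B ^+ m * C3 * (eps ^+ m * sig ^+ n).
    by rewrite snE !exprMn; ring.
  apply: ler_pM (ler_wpM2r C30 Bm) (ler_wpM2r sn0 (epsn _ m_gt0)).
    by apply: mulr_ge0 => //; apply: exprn_ge0.
  by apply: mulr_ge0 => //; apply: exprn_ge0; exact: ltW.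
have E3 : `|flow_error x (y t) (v t) phi| <= C6 * eps * sig ^+ n.
  have -> : C6 * eps * sig ^+ n = K phi * (B ^+ n * (eps * sig ^+ n) +
      B * ((B + C2) ^+ n * (eps * sig ^+ n))) by rewrite /C6; ring.
  apply: le_trans flow _; apply: ler_wpM2l => //; apply: lerD.
    apply: (@le_trans _ _ ((B * (eps * sig)) ^+ n)).
      by rewrite lerXn2r ?nnegrE // mulr_ge0.
    by rewrite exprMn ler_wpM2l ?exprn_ge0.
  have vy : (`|v t| + `|y t|) ^+ n <= (B + C2) ^+ n * (eps * sig ^+ n).
    apply: (@le_trans _ _ (((B + C2) * (eps * sig)) ^+ n)).
      rewrite lerXn2r ?nnegrE ?addr_ge0 //; first by rewrite mulr_ge0 // addr_ge0.
      by rewrite mulrDl; apply: lerD.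
    by rewrite exprMn ler_wpM2l ?exprn_ge0 ?addr_ge0.
  have vB : `|v t| <= B.
    apply: le_trans v_le _; rewrite ler_piMr //.
    by rewrite mulr_ile1 // ltW.
  by apply: ler_pM vB vy.
have E4 : `|evp phi x - dirder x phi 0| <= C4 * eps * sig ^+ n.
  have := H4 x 0 x1; rewrite normr0 ler01 !subr0 (vanish_evp0 vphi) subr0.
  move=> /(_ isT) /le_trans; apply; rewrite -mulrA ler_wpM2l // expr2.
  apply: ler_pM => //; apply: le_trans x_le _.
  by rewrite ler_piMr // ltW.
have -> : dirder x phi 0 - g / n`!%:R * I t =
    (evp phi (y t) - g / n`!%:R * I t) +
    (\sum_(m < n) v t ^+ m / m`!%:R * evp (der1_iter m phi) (y t) - evp phi (y t)) +
    flow_error x (y t) (v t) phi - (evp phi x - dirder x phi 0).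
  by rewrite /flow_error; ring.
rewrite !mulrDl; apply: le_trans (ler_normB _ _) _; apply: lerD => //.
apply: le_trans (ler_normD _ _) _; apply: lerD => //.
by apply: le_trans (ler_normD _ _) _; apply: lerD.
Qed.

End PrivilegedDrift.

(** * Taylor polynomials in several variables *)

Section Schwarz.
Variables (R : realType) (d : nat).
Implicit Types (g : 'rV[R]_d -> 'rV[R]_d) (U : set 'rV[R]_d).

Lemma derive_coord g (x : 'rV[R]_d) k (v : 'rV[R]_d) : differentiable g x ->
  differentiable (fun z => g z 0 k) x /\ 'D_v (fun z => g z 0 k) x = 'D_v g x 0 k.
Proof.
move=> dg; pose X := mpolyX R (mnm1 k).
have gX : (fun z => g z 0 k) = evp X \o g.
  by apply/funext => z; rewrite /= evpX.
have dX := differentiable_evp X (g x).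
have dgX : differentiable (fun z => g z 0 k) x by rewrite gX; exact: differentiable_comp.
split=> //; rewrite !deriveE // gX diff_comp //=.
by have [_ ->] := is_diff_evp X (g x); rewrite dirderX.
Qed.

Lemma is_derive_along g (p v : 'rV[R]_d) k (t : R) :
  differentiable g (p + t *: v) ->
  is_derive t (1 : R) (fun s : R => g (p + s *: v) 0 k) ('D_v g (p + t *: v) 0 k).
Proof.
move=> dg; pose c (s : R) := p + s *: v.
have dc : is_diff t c (fun s : R => s *: v).
  by have := is_diffD (is_diff_cst p t) (is_diff_scalel t v); rewrite add0r.
have [dh dhE] := derive_coord k v dg; rewrite -dhE.
have dhc : differentiable ((fun z => g z 0 k) \o c) t by apply: differentiable_comp.
have -> : (fun s : R => g (p + s *: v) 0 k) = (fun z => g z 0 k) \o c by [].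
split; first exact: diff_derivable.
by rewrite !deriveE // diff_comp //= diff_val scale1r.
Qed.

Lemma MVT_pos (f df : R -> R) (s : R) : 0 < s ->
  (forall a, 0 <= a <= s -> is_derive a (1 : R) f (df a)) ->
  exists a, 0 <= a <= s /\ f s - f 0 = s * df a.
Proof.
move=> s0 df_f.
have [||a] := @MVT_segment R f df 0 s (ltW s0).
- by move=> a; rewrite in_itv /= => /andP[a0 as_]; apply: df_f; rewrite !ltW.
- apply: derivable_within_continuous => a; rewrite in_itv /= => a01.
  by apply: ex_derive; exact: df_f.
by rewrite in_itv /= subr0 => as_ ->; exists a; rewrite mulrC.
Qed.

(** The second difference of [g] on the parallelogram spanned by [s u] and [s v], by two
    applications of the mean value theorem. *)
Lemma mixed_increment g (x u v : 'rV[R]_d) k (e s : R) : 0 < s ->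
  (forall z, `|z - x| <= e -> differentiable g z) ->
  (forall z, `|z - x| <= e -> differentiable ('D_u g) z) ->
  (forall a b : R, 0 <= a <= s -> 0 <= b <= s -> `|a *: u + b *: v| <= e) ->
  exists z, `|z - x| <= e /\
    g (x + s *: u + s *: v) 0 k - g (x + s *: u) 0 k - g (x + s *: v) 0 k + g x 0 k =
    s * s * 'D_v ('D_u g) z 0 k.
Proof.
move=> s0 dg dgu small.
have sm a b : 0 <= a <= s -> 0 <= b <= s -> `|x + a *: u + b *: v - x| <= e.
  by move=> ha hb; rewrite -!addrA addrC -!addrA addNr addr0; exact: small.
have ss : 0 <= s <= s by rewrite ltW /=.
have s00 : 0 <= (0 : R) <= s by rewrite lexx ltW.
have dfa a : 0 <= a <= s -> is_derive a (1 : R)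
    (fun a => g (x + s *: v + a *: u) 0 k - g (x + a *: u) 0 k)
    ('D_u g (x + s *: v + a *: u) 0 k - 'D_u g (x + a *: u) 0 k).
  move=> ha; apply: is_deriveB; apply: is_derive_along; apply: dg.
    have -> : x + s *: v + a *: u = x + a *: u + s *: v by rewrite addrAC.
    exact: (sm a s ha ss).
  have -> : x + a *: u = x + a *: u + 0 *: v by rewrite scale0r addr0.
  exact: (sm a 0 ha s00).
have [a [as_ Ea]] := MVT_pos s0 dfa.
have [b [bs Eb]] := MVT_pos s0 (fun b hb => is_derive_along k (dgu _ (sm a b as_ hb))).
exists (x + a *: u + b *: v); split; first exact: sm.
rewrite -mulrA -Eb; rewrite !scale0r !addr0 in Ea *.
rewrite [x + a *: u + s *: v]addrAC -Ea [x + s *: v + s *: u]addrAC.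
ring.
Qed.

Lemma class_CS n U g : class_C n.+1 U g -> class_C n U g.
Proof.
elim: n g => [|n IH] g [dg cg]; first by move=> x /dg /differentiable_continuous.
by split=> // v; exact: IH.
Qed.

Lemma class_C_le m n U g : (m <= n)%N -> class_C n U g -> class_C m U g.
Proof.
move=> /subnK <-; elim: (n - m)%N => // k IH; rewrite addSn => /class_CS; exact: IH.
Qed.

(** Both mixed derivatives are limits of the same second difference, which is symmetric in
    [u] and [v]. *)
Lemma schwarz U g : open U -> class_C 2 U g -> forall x, U x -> forall u v,
  'D_u ('D_v g) x = 'D_v ('D_u g) x.
Proof.
move=> oU [dg cg] x Ux u v; apply/rowP => k.
apply/eqP; rewrite eq_sym -subr_eq0; apply/eqP/normr0_eq0/eqP.
rewrite eq_le normr_ge0 andbT; apply/ler_addgt0Pr => eps eps0; rewrite add0r.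
pose A (w w' z : 'rV[R]_d) : R := 'D_w ('D_w' g) z 0 k.
have cA w w' : {for x, continuous (A w w')}.
  have [_ /(_ w) cww'] := cg w'.
  apply: (@continuous_comp _ _ _ ('D_w ('D_w' g)) (fun M : 'rV[R]_d => M 0 k) x).
    exact: cww'.
  exact: coord_continuous.
have nA w w' : nbhs x [set z | `|A w w' x - A w w' z| < eps / 2].
  by move: (cA w w') => /cvgrPdist_lt; apply; exact: divr_gt0.
have nU : nbhs x U by exact: open_nbhs_nbhs.
have [e1 /= e10 ball1] := (nbhs_ballP x _).1 nU.
have [e2 /= e20 ball2] := (nbhs_ballP x _).1 (nA u v).
have [e3 /= e30 ball3] := (nbhs_ballP x _).1 (nA v u).
pose e := Num.min e1 (Num.min e2 e3).
have e0 : 0 < e by rewrite !lt_min e10 e20.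
have ball_e z : ball x e z -> [/\ U z, `|A u v x - A u v z| < eps / 2 &
    `|A v u x - A v u z| < eps / 2].
  move=> zb; split; [apply: ball1|apply: ball2|apply: ball3];
    by apply: le_ball zb; rewrite /e !ge_min lexx ?orbT.
pose N := `|u| + `|v| + 1.
have N0 : 0 < N by rewrite ltr_wpDl ?addr_ge0.
pose s := e / 2 / N; have s0 : 0 < s by rewrite !divr_gt0.
have inball z : `|z - x| <= e / 2 -> ball x e z.
  rewrite -ball_normE /= distrC => /le_lt_trans; apply; lra.
have small (u' v' : 'rV[R]_d) : `|u'| + `|v'| + 1 = N ->
   forall a b : R, 0 <= a <= s -> 0 <= b <= s -> `|a *: u' + b *: v'| <= e / 2.
  move=> NE a b /andP[a0 as_] /andP[b0 bs].
  apply: le_trans (ler_normD _ _) _; rewrite !normrZ !ger0_norm //.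
  have -> : e / 2 = s * N by rewrite divfK // gt_eqF.
  rewrite -NE mulrDr mulrDr -[leLHS]addr0 mulr1 lerD ?(ltW s0) //.
  by rewrite lerD // ler_wpM2r.
have dgz z : `|z - x| <= e / 2 -> differentiable g z.
  by move=> /inball /ball_e [Uz _ _]; exact: dg.
have dDg w z : `|z - x| <= e / 2 -> differentiable ('D_w g) z.
  by move=> /inball /ball_e [Uz _ _]; have [+ _] := cg w; exact.
have [z1 [/inball /ball_e [_ Auv _] E1]] :=
  mixed_increment k s0 dgz (dDg v) (small v u (ltac:(by rewrite /N [`|v| + _]addrC))).
have [z2 [/inball /ball_e [_ _ Avu] E2]] :=
  mixed_increment k s0 dgz (dDg u) (small u v erefl).
have E : A u v z1 = A v u z2.
  have ss0 : s * s != 0 by rewrite mulf_neq0 ?gt_eqF.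
  apply: (mulfI ss0); rewrite -[LHS]E1 -[RHS]E2.
  have -> : x + s *: v + s *: u = x + s *: u + s *: v by rewrite addrAC.
  by congr (_ + _); rewrite addrAC.
rewrite -[X in `|X|]/(A v u x - A u v x) (splitr eps).
have -> : A v u x - A u v x = (A v u x - A v u z2) - (A u v x - A u v z1).
  by rewrite E opprB addrA subrK.
exact: le_trans (ler_normB _ _) (lerD (ltW Avu) (ltW Auv)).
Qed.
End Schwarz.

Section Taylor.
Variables (R : realType) (d : nat).
Implicit Types (g : 'rV[R]_d -> 'rV[R]_d) (U : set 'rV[R]_d).
Local Notation e_ i := (delta_mx (0 : 'I_1) i : 'rV[R]_d).
Local Notation X := (fun l : 'I_d => mpolyX R (mnm1 l)).

Lemma partials_ext U s g h : open U -> (forall x, U x -> g x = h x) ->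
  forall x, U x -> partials s g x = partials s h x.
Proof.
move=> oU gh; elim: s => [|i s IH] x Ux; first exact: gh.
rewrite /partials /=.
apply: near_eq_derive; have : nbhs x U by exact: open_nbhs_nbhs.
by apply: filterS => z Uz; exact: IH.
Qed.

Lemma partials_cat s1 s2 g : partials (s1 ++ s2) g = partials s1 (partials s2 g).
Proof. by rewrite /partials foldr_cat. Qed.

Lemma class_C_partials m s U g : class_C (m + size s) U g -> class_C m U (partials s g).
Proof.
elim: s m => [|i s IH] m; first by rewrite addn0.
rewrite /= addnS -addSn => /IH [_ +]; exact.
Qed.

Lemma partials_swap U s1 i j s2 g : open U ->
  class_C (size (s1 ++ i :: j :: s2)) U g -> forall x, U x ->
  partials (s1 ++ i :: j :: s2) g x = partials (s1 ++ j :: i :: s2) g x.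
Proof.
move=> oU cg x Ux; rewrite !partials_cat.
have c2 : class_C 2 U (partials s2 g).
  by apply: class_C_partials; apply: class_C_le cg; rewrite size_cat /=; lia.
by apply: (partials_ext s1 oU _ Ux) => z Uz; exact: (schwarz oU c2 Uz).
Qed.

(** By symmetry of the partial derivatives a first derivative may be taken last; this is how
    the Taylor polynomial of a derivative is recognised as the derivative of the polynomial. *)
Lemma partials_rcons U i s g : open U -> class_C (size s).+1 U g -> forall x, U x ->
  partials (i :: s) g x = partials s ('D_(e_ i) g) x.
Proof.
move=> oU cg x Ux; rewrite -[RHS]/(partials s (partials [:: i] g) x) -partials_cat.
suff H s1 s2 : (size s1 + size s2)%N = size s ->
    partials (s1 ++ i :: s2) g x = partials (s1 ++ s2 ++ [:: i]) g x.
  exact: (H [::] s).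
elim: s2 s1 => [|j s2 IH] s1 sz; first by [].
have cs : class_C (size (s1 ++ i :: j :: s2)) U g.
  by apply: class_C_le cg; rewrite size_cat -sz /=; lia.
rewrite (partials_swap oU cs Ux) -cat_rcons IH ?cat_rcons //.
by rewrite size_rcons addSn -addnS.
Qed.

(** Coefficients of length above [n] are put to 0: only up to [n] are they known to be symmetric. *)
Definition tcoef n g k (s : seq 'I_d) : R :=
  if (size s <= n)%N then partials s g 0 0 k else 0.

Lemma tcoef_sym n g k U : open U -> U 0 -> class_C n U g -> symmetric_coef (tcoef n g k).
Proof.
move=> oU U0 cg s1 l m s2; rewrite /tcoef !size_cat /=.
by case: ifP => // sz; rewrite (partials_swap oU) //; apply: class_C_le cg; rewrite size_cat.
Qed.

(** The [k]-th component of [taylor n g], as a polynomial. *)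
Definition tpoly n g k : mpoly d R :=
  \sum_(q < n.+1) (q`!%:R)^-1 *: hpol X q (tcoef n g k).

Lemma evp_hpol q c (x : 'rV[R]_d) :
  evp (hpol X q c) x = \sum_(s : q.-tuple 'I_d) (\prod_(i <- s) x 0 i) * c s.
Proof.
elim: q c => [|q IH] c /=.
  rewrite evpC (eq_bigl (pred1 [tuple])) ?big_pred1_eq ?big_nil ?mul1r //.
  by move=> s; rewrite /= (tuple0 s); apply/esym/eqP.
rewrite evp_sum (eq_bigr (fun l => \sum_(s : q.-tuple 'I_d)
    x 0 l * ((\prod_(i <- s) x 0 i) * c (l :: s)))); last first.
  by move=> l _; rewrite evpM evpX IH mulr_sumr.
rewrite pair_big /= (reindex (fun s : q.+1.-tuple 'I_d => (thead s, [tuple of behead s]))) /=.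
  apply: eq_bigr => s _; have E : tval s = thead s :: behead s by rewrite {1}(tuple_eta s).
  by rewrite mulrA [in RHS]E big_cons.
exists (fun p : 'I_d * q.-tuple 'I_d => [tuple of p.1 :: p.2]) => [s|[l s]] _ /=.
  by rewrite -tuple_eta.
by congr pair; apply: val_inj.
Qed.

Lemma taylor_tpoly n g k x : taylor n g x 0 k = evp (tpoly n g k) x.
Proof.
rewrite /taylor /tpoly summxE evp_sum; apply: eq_bigr => q _.
rewrite mxE evpZ evp_hpol summxE; congr (_ * _); apply: eq_bigr => s _.
by rewrite mxE /tcoef size_tuple -ltnS ltn_ord.
Qed.

Lemma mderiv_tpoly U n g k i : open U -> U 0 -> class_C n.+1 U g ->
  mderiv i (tpoly n.+1 g k) = tpoly n ('D_(e_ i) g) k.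
Proof.
move=> oU U0 cg; have sc := tcoef_sym k oU U0 cg.
rewrite /tpoly mderiv_lder lder_sum big_ord_recl /= lderZ lderC scaler0 add0r.
apply: eq_bigr => q _; rewrite lderZ -[bump 0 q]/(q.+1) lder_hpol // scalerA.
congr (_ *: _).
  by rewrite factS natrM invfM mulrAC mulVf ?mul1r // pnatr_eq0.
rewrite (bigD1 i) //= big1 ?addr0 => [|m /negPf mi].
  rewrite -mderiv_lder mderiv_var eqxx mpolyC1 mul1r; congr hpol.
  apply/funext => s; rewrite /tcoef /= ltnS; case: ifP => // sz.
  by rewrite -(partials_rcons i oU _ U0) //; apply: class_C_le cg.
by rewrite -mderiv_lder mderiv_var eq_sym mi mpolyC0 mul0r.
Qed.

Lemma tpoly0 n g k : evp (tpoly n g k) 0 = g 0 0 k.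
Proof.
rewrite /tpoly evp_sum big_ord_recl big1 => [|q _].
  by rewrite addr0 /= evpZ evpC invr1 mul1r.
by rewrite evpZ evp_hpol0 ?mulr0 // => l; rewrite evpX mxE.
Qed.

Definition tremainder n g k (x : 'rV[R]_d) : R := g x 0 k - evp (tpoly n g k) x.

Lemma open_ball0 U : open U -> U 0 -> exists2 r : R, 0 < r & forall x, `|x| <= r -> U x.
Proof.
move=> oU U0; have : nbhs (0 : 'rV[R]_d) U by exact: open_nbhs_nbhs.
move=> /nbhs_ballP[e /= e0 eU]; exists (e / 2); first by rewrite divr_gt0.
move=> x xe; apply: eU; rewrite -ball_normE /= sub0r normrN; apply: le_lt_trans xe _; lra.
Qed.

Lemma tremainder_mvt U n g k r (a b : 'rV[R]_d) : open U -> U 0 -> class_C n.+1 U g ->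
  (forall x, `|x| <= r -> U x) -> `|a| <= r -> `|b| <= r ->
  exists2 z : 'rV[R]_d, `|z| <= Num.max `|a| `|b| &
  tremainder n.+1 g k a - tremainder n.+1 g k b =
    \sum_i (a - b) 0 i * tremainder n ('D_(e_ i) g) k z.
Proof.
move=> oU U0 cg rU ar br; have [dg _] := cg.
have [] := @MVT_segment_rV R d (tremainder n.+1 g k) a b r _ ar br.
  move=> z zr; have [dgk _] := derive_coord k 0 (dg z (rU z zr)).
  by apply: differentiableB => //; exact: differentiable_evp.
move=> z [zm _ ->]; exists z => //; apply: eq_bigr => i _; congr (_ * _).
have Uz : U z by apply: rU; apply: le_trans zm _; rewrite ge_max ar br.
have [dgk dE] := derive_coord k (e_ i) (dg z Uz).
rewrite /tremainder deriveB; last 2 first.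
- exact: diff_derivable.
- by apply: diff_derivable; exact: differentiable_evp.
by rewrite dE derive_evp (mderiv_tpoly k i oU U0 cg).
Qed.

Lemma tremainder_lipschitz_of U n g : open U -> U 0 -> class_C n.+1 U g ->
  (forall h, class_C n U h -> exists C r, [/\ 0 <= C, 0 < r &
    forall x, `|x| <= r -> forall k, `|tremainder n h k x| <= C * `|x| ^+ n]) ->
  exists C r, [/\ 0 <= C, 0 < r & forall a b, `|a| <= r -> `|b| <= r -> forall k,
    `|tremainder n.+1 g k a - tremainder n.+1 g k b|
      <= C * Num.max `|a| `|b| ^+ n * `|a - b|].
Proof.
move=> oU U0 cg IH; have [dg cdg] := cg.
have [|i|C [r [C0 r0 HC]]] := @uniform_fin2 R 'I_d (fun i C r => forall x : 'rV[R]_d, `|x| <= r ->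
    forall k, `|tremainder n ('D_(e_ i) g) k x| <= C * `|x| ^+ n).
- move=> i C C' t t' H CC' /andP[_ tt'] x xt k.
  by apply: le_trans (H x (le_trans xt tt') k) _; rewrite ler_wpM2r ?exprn_ge0.
- by have [C [r [C0 r0 HC]]] := IH _ (cdg (e_ i)); exists C, r.
have [r1 r10 rU] := open_ball0 oU U0.
exists (d%:R * C), (Num.min r r1); split; [exact: mulr_ge0|by rewrite lt_min r0|].
move=> a b; rewrite !le_min => /andP[ar ar1] /andP[br br1] k.
have [z zm ->] := tremainder_mvt k oU U0 cg rU ar1 br1.
apply: le_trans (ler_norm_sum _ _ _) _.
apply: (@le_trans _ _ (\sum_(i < d) C * Num.max `|a| `|b| ^+ n * `|a - b|)).
  apply: ler_sum => i _; rewrite normrM mulrC ler_pM //; last exact: coord_le_norm.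
  have zr : `|z| <= r by apply: le_trans zm _; rewrite ge_max ar br.
  apply: le_trans (HC i z zr k) _; rewrite ler_wpM2l //.
  by rewrite lerXn2r ?nnegrE // le_max normr_ge0.
by rewrite sumr_const card_ord -[leLHS]mulr_natl !mulrA.
Qed.

(** Induction on [n]: the partial derivatives of the remainder of order [n.+1] are the
    remainders of order [n] of the partial derivatives, and the mean value theorem gives
    one more power of [|x|]. *)
Theorem tremainder_bound U n g : open U -> U 0 -> class_C n U g ->
  exists C r, [/\ 0 <= C, 0 < r &
    forall x, `|x| <= r -> forall k, `|tremainder n g k x| <= C * `|x| ^+ n].
Proof.
move=> oU U0; elim: n g => [|n IH] g cg.
  have /= := cg 0 U0 => /cvgrPdist_le /(_ 1 ltr01) /nbhs_ballP[e /= e0 He].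
  exists 1, (e / 2); split=> //; first by rewrite divr_gt0.
  move=> x xe k; rewrite expr0 mulr1 /tremainder.
  have -> : evp (tpoly 0 g k) x = g 0 0 k.
    by rewrite /tpoly big_ord1 /= evpZ evpC invr1 mul1r.
  have := He x; rewrite -ball_normE /= sub0r normrN => /(_ _) Hx.
  have {}Hx : `|g 0 - g x| <= 1 by apply: Hx; apply: le_lt_trans xe _; lra.
  apply: le_trans _ Hx; rewrite distrC.
  by have := coord_le_norm (g 0 - g x) k; rewrite !mxE.
have [C [r [C0 r0 HC]]] := tremainder_lipschitz_of oU U0 cg IH.
exists C, r; split=> // x xr k.
have := HC x 0 xr; rewrite normr0 => /(_ (ltW r0) k).
rewrite [X in _ - X]/tremainder tpoly0 subrr !subr0 exprSr mulrA.
by rewrite max_l.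
Qed.

(** For fields of class [C^(n+1)] the remainder is not only of order [n.+1]: its increments
    are of order [n] relative to the distance. This finer form is what the stability
    estimate of the pulled-back drift needs. *)
Theorem tremainder_lipschitz U n g : open U -> U 0 -> class_C n.+1 U g ->
  exists C r, [/\ 0 <= C, 0 < r & forall a b, `|a| <= r -> `|b| <= r -> forall k,
    `|tremainder n.+1 g k a - tremainder n.+1 g k b|
      <= C * Num.max `|a| `|b| ^+ n * `|a - b|].
Proof.
move=> oU U0 cg; apply: (tremainder_lipschitz_of oU U0 cg) => h.
exact: tremainder_bound.
Qed.

End Taylor.

Section BracketLink.
Variables (R : realType) (d : nat) (F0 F1 : vfield R d).

Definition ev_field (F : vfield R d) (x : 'rV[R]_d) : 'rV[R]_d := \row_i evp (F i) x.

Lemma differentiable_ev_field F (x : 'rV[R]_d) : differentiable (ev_field F) x.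
Proof.
have -> : ev_field F = \sum_(i < d) (fun z => evp (F i) z *: delta_mx 0 i).
  apply/funext => z; rewrite [LHS]row_sum_delta fct_sumE.
  by apply: eq_bigr => i _; rewrite mxE.
by apply: differentiable_sum => i; apply: differentiableZl; exact: differentiable_evp.
Qed.

Lemma diff_ev_field F (x v : 'rV[R]_d) k : 'd (ev_field F) x v 0 k = dirder v (F k) x.
Proof.
have [_] := derive_coord k v (differentiable_ev_field F x).
rewrite -deriveE; last exact: differentiable_ev_field.
move=> <-; have -> : (fun z => ev_field F z 0 k) = evp (F k).
  by apply/funext => z; rewrite mxE.
rewrite deriveE; last exact: differentiable_evp.
by have [_ ->] := is_diff_evp (F k) x.
Qed.

Lemma evp_lder f p (x : 'rV[R]_d) : evp (lder f p) x = dirder (ev_field f x) p x.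
Proof. by rewrite /lder evp_sum; apply: eq_bigr => i _; rewrite evpM mxE. Qed.

(** The differential of a polynomial map is given by its formal partial derivatives. *)
Lemma bracket_vmag b : bracket (ev_field F0) (ev_field F1) b = ev_field (vmag F0 F1 b).
Proof.
elim: b => //= b1 -> b2 ->; apply/funext => x; apply/rowP => k.
by rewrite /lie_bracket !mxE !diff_ev_field evpB !evp_lder.
Qed.

Lemma ev_field0 F : ev_field F 0 = val0 F.
Proof. by []. Qed.

End BracketLink.

(** * The flow of a bounded Lipschitz field *)

Section Primitive.
Variable R : realType.
Implicit Types (h f : R -> R) (A s : R).

Definition clamp A s : R := Num.max (- A) (Num.min A s).

Lemma clamp_le A s : 0 <= A -> `|clamp A s| <= A.
Proof.
move=> A0; rewrite /clamp ler_norml le_max lexx /= ge_max ge_min lexx /= andbT; lra.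
Qed.

Lemma clamp_id A s : `|s| <= A -> clamp A s = s.
Proof. by rewrite ler_norml => /andP[s1 s2]; rewrite /clamp min_r // max_r. Qed.

Lemma clamp_lip A s t : `|clamp A s - clamp A t| <= `|s - t|.
Proof.
rewrite /clamp.
case: (leP A s); case: (leP A t); case: (leP (- A) s); case: (leP (- A) t);
  case: (leP (- A) A) => *; rewrite ler_norml; apply/andP;
  (have [?|?] := leP 0 (s - t); [rewrite ger0_norm // | rewrite ltr0_norm //]); split; lra.
Qed.

(** Mean value inequality. *)
Lemma deriv_lip f df A C (a b : R) :
  (forall r, `|r| < A -> is_derive r (1 : R) f (df r)) ->
  (forall r, `|r| < A -> `|df r| <= C) -> `|a| < A -> `|b| < A ->
  `|f a - f b| <= C * `|a - b|.
Proof.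
move=> dfP dfC; wlog ab : a b / b <= a => [H aA bA|aA bA].
  have [ba|/ltW ab] := leP b a; first exact: H.
  by rewrite distrC [X in _ * X]distrC; exact: H.
have inA r : b <= r <= a -> `|r| < A.
  move: aA bA; rewrite !ltr_norml => /andP[? ?] /andP[? ?] /andP[? ?]; apply/andP; split; lra.
have [||r] := @MVT_segment R f df b a ab.
- by move=> r; rewrite in_itv /= => /andP[br ra]; apply: dfP; apply: inA; rewrite !ltW.
- apply: derivable_within_continuous => r; rewrite in_itv /= => rab.
  by apply: ex_derive; apply: dfP; exact: inA.
by rewrite in_itv /= => rab ->; rewrite normrM ler_wpM2r // dfC // inA.
Qed.

Definition prim0 A h s : R := \int[@lebesgue_measure R]_(r in `[- A, s]) h r -
  \int[@lebesgue_measure R]_(r in `[- A, 0]) h r.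

Lemma prim0_0 A h : prim0 A h 0 = 0.
Proof. by rewrite /prim0 subrr. Qed.

Lemma is_derive_prim0 A h s : continuous h -> `|s| < A -> is_derive s (1 : R) (prim0 A h) (h s).
Proof.
move=> hc; rewrite ltr_norml => /andP[As sA].
have intA : (@lebesgue_measure R).-integrable `[- A, A] (EFin \o h).
  apply: continuous_compact_integrable; first exact: segment_compact.
  exact: continuous_subspaceT.
have [dF FE] := continuous_FTC1_closed sA intA As (hc s).
rewrite derive1E in FE.
have := is_deriveB (DeriveDef dF FE) (is_derive_cst
   (\int[@lebesgue_measure R]_(r in `[- A, 0]) h r) s (1 : R)).
by rewrite subr0.
Qed.

(** Primitive of [h] that vanishes at 0 on [-A, A], extended by constants. *)
Definition prim A h s : R := prim0 (A + 1) h (clamp A s).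

Lemma prim_0 A h : 0 <= A -> prim A h 0 = 0.
Proof. by move=> A0; rewrite /prim clamp_id ?normr0 // prim0_0. Qed.

Lemma near_norm_lt A s : `|s| < A -> \forall r \near s, `|r| < A.
Proof.
move=> sA; have e0 : 0 < A - `|s| by rewrite subr_gt0.
exists (A - `|s|) => //= r; rewrite /ball_ /= => rs.
have := ler_normD (r - s) s; rewrite subrK distrC; lra.
Qed.

Lemma is_derive_prim A h s : continuous h -> `|s| < A -> is_derive s (1 : R) (prim A h) (h s).
Proof.
move=> hc sA.
have sA1 : `|s| < A + 1 by apply: lt_trans sA _; rewrite ltrDl.
apply: near_eq_is_derive (is_derive_prim0 hc sA1).
by have := near_norm_lt sA; apply: filterS => r /ltW rA; rewrite /prim clamp_id.
Qed.

Lemma clamp_lt A s : 0 <= A -> `|clamp A s| < A + 1.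
Proof. by move=> A0; apply: le_lt_trans (clamp_le s A0) _; rewrite ltrDl. Qed.

Lemma prim_lip A h C s t : 0 <= A -> continuous h -> (forall r, `|h r| <= C) ->
  `|prim A h s - prim A h t| <= C * `|s - t|.
Proof.
move=> A0 hc hC.
have C0 : 0 <= C by apply: le_trans (hC 0).
apply: le_trans (ler_wpM2l C0 (clamp_lip A s t)).
exact: (deriv_lip (fun r => is_derive_prim0 hc) (fun r _ => hC r) (clamp_lt s A0) (clamp_lt t A0)).
Qed.

Lemma prim_bound A h C s : 0 <= A -> continuous h -> (forall r, `|h r| <= C) ->
  `|prim A h s| <= C * A.
Proof.
move=> A0 hc hC; have C0 : 0 <= C by apply: le_trans (hC 0).
have A1 : `|0 : R| < A + 1 by rewrite normr0 ltr_wpDl.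
have := deriv_lip (fun r => is_derive_prim0 hc) (fun r _ => hC r) (clamp_lt s A0) A1.
rewrite prim0_0 !subr0 => /le_trans; apply.
by rewrite ler_wpM2l // clamp_le.
Qed.

Lemma prim_diff A h f C s : 0 <= A -> continuous h -> continuous f ->
  (forall r, `|h r - f r| <= C) -> `|prim A h s - prim A f s| <= C * A.
Proof.
move=> A0 hc fc hfC; have C0 : 0 <= C by apply: le_trans (hfC 0).
have d r : `|r| < A + 1 -> is_derive r (1 : R) (prim0 (A + 1) h - prim0 (A + 1) f) (h r - f r).
  by move=> rA; apply: is_deriveB; exact: is_derive_prim0.
have := deriv_lip d (fun r _ => hfC r) (clamp_lt s A0) (_ : `|0| < A + 1).
rewrite normr0 ltr_wpDl // => /(_ isT).
rewrite -[(prim0 (A + 1) h - prim0 (A + 1) f) 0]/(prim0 (A + 1) h 0 - prim0 (A + 1) f 0).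
rewrite !prim0_0 !subr0 => /le_trans; apply.
by rewrite ler_wpM2l // clamp_le.
Qed.

Lemma lipschitz_continuous h C : (forall s t, `|h s - h t| <= C * `|s - t|) -> continuous h.
Proof.
move=> hC s; have C0 : 0 <= C.
  by have := hC 1 0; rewrite subr0 normr1 mulr1; apply: le_trans.
apply/cvgrPdist_le => e e0; exists (e / (C + 1)) => /=.
  by rewrite divr_gt0 // ltr_wpDl.
move=> t; rewrite /ball_ /= ltr_pdivlMr ?ltr_wpDl // => st.
apply: le_trans (hC s t) _; apply: le_trans (ltW st); rewrite mulrC ler_wpM2l //; lra.
Qed.

(** The limit is the supremum of the lower bounds [u n - 2 * c / 2 ^+ n]. *)
Lemma geometric_limit (u : nat -> R) (c : R) :
  (forall n, `|u n.+1 - u n| <= c / 2 ^+ n) ->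
  exists l, forall n, `|l - u n| <= 2 * c / 2 ^+ n.
Proof.
move=> uc; pose w n := 2 * c / 2 ^+ n.
have c0 : 0 <= c by have := uc 0%N; rewrite expr0 divr1; apply: le_trans.
have wS n : w n = c / 2 ^+ n + w n.+1.
  by rewrite /w exprS; field; rewrite expf_neq0.
have w0 n : 0 <= w n by rewrite /w !mulr_ge0 ?invr_ge0 ?exprn_ge0.
have up k n : u n - w n <= u (n + k)%N - w (n + k)%N /\ u (n + k)%N + w (n + k)%N <= u n + w n.
  elim: k => [|k [IH1 IH2]]; first by rewrite addn0 !lexx.
  rewrite addnS; have := uc (n + k)%N; have := wS (n + k)%N; rewrite ler_norml => e /andP[? ?].
  split; lra.
have le_uw n m : u n - w n <= u m + w m.
  have [nm|mn] := leqP n m.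
    by have [+ _] := up (m - n)%N n; rewrite subnKC // => ?; have := w0 m; lra.
  by have [_] := up (n - m)%N m; rewrite subnKC ?(ltnW mn) // => ?; have := w0 n; lra.
pose E : set R := range (fun n => u n - w n).
have supE : has_sup E.
  by split; [exists (u 0%N - w 0%N), 0%N | exists (u 0%N + w 0%N) => _ [n _ <-]; exact: le_uw].
exists (sup E) => n; rewrite -/(w n) ler_norml; apply/andP; split.
  have : u n - w n <= sup E by apply: sup_upper_bound supE _ _; exists n.
  lra.
have : sup E <= u n + w n by apply: ge_sup supE.1 _ => _ [m _ <-]; exact: le_uw.
lra.
Qed.

Lemma le_of_geometric (a c : R) : (forall n, a <= c / 2 ^+ n) -> a <= 0.
Proof.
move=> ac; rewrite leNgt; apply/negP => a0.
have [n] : exists n : nat, c / a < n%:R.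
  by exists (Num.trunc (`|c / a|)).+1; apply: le_lt_trans (ler_norm _) _; exact: truncnS_gt.
rewrite ltr_pdivrMr // => cn; have := ac n; rewrite ler_pdivlMr ?exprn_gt0 //.
have : n%:R < 2 ^+ n :> R by rewrite -natrX ltr_nat ltn_expl.
move: (2 ^+ n) => z nz; nra.
Qed.

End Primitive.

Section Flow.
Variables (R : realType) (d : nat) (F : 'rV[R]_d -> 'rV[R]_d) (K L A : R).
Hypotheses (K0 : 0 <= K) (L0 : 0 <= L) (A0 : 0 < A) (LA : L * A <= 1 / 2).
Hypothesis F_bounded : forall x, `|F x| <= K.
Hypothesis F_lip : forall x y, `|F x - F y| <= L * `|x - y|.

Lemma rV_diff_le (x y : 'rV[R]_d) (B : R) : 0 <= B ->
  (forall i, `|x 0 i - y 0 i| <= B) -> `|x - y| <= B.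
Proof. by move=> B0 xyB; apply: norm_le_coord => // i; rewrite !mxE. Qed.

Lemma rV_diff_coord (x y : 'rV[R]_d) i : `|x 0 i - y 0 i| <= `|x - y|.
Proof. by have := coord_le_norm (x - y) i; rewrite !mxE. Qed.

(** Derivatives of curves are taken coordinatewise, which keeps them within real functions
    of a real variable. *)
Definition is_curve_deriv (c : R -> 'rV[R]_d) (v : 'rV[R]_d) (s : R) :=
  forall i, is_derive s (1 : R) (fun r => c r 0 i) (v 0 i).

Section Iterates.
Variable x : 'rV[R]_d.

(** Since [prim] is constant outside [-A, A], every iterate is defined and [K]-Lipschitz on
    the whole line. *)
Definition picard_step (c : R -> 'rV[R]_d) (s : R) : 'rV[R]_d :=
  \row_i (x 0 i + prim A (fun r => F (c r) 0 i) s).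

Definition K_lip (c : R -> 'rV[R]_d) := forall s t, `|c s - c t| <= K * `|s - t|.

Lemma field_continuous c i : K_lip c -> continuous (fun r => F (c r) 0 i).
Proof.
move=> cK; apply: (@lipschitz_continuous _ _ (L * K)) => s t.
apply: le_trans (rV_diff_coord _ _ i) _; apply: le_trans (F_lip _ _) _.
by rewrite -mulrA ler_wpM2l.
Qed.

Lemma field_coord_le (c : R -> 'rV[R]_d) i (r : R) : `|F (c r) 0 i| <= K.
Proof. exact: le_trans (coord_le_norm _ i) (F_bounded _). Qed.

Lemma picard_step_lip c : K_lip c -> K_lip (picard_step c).
Proof.
move=> cK s t; apply: rV_diff_le => [|i]; first by rewrite mulr_ge0.
rewrite !mxE opprD addrACA subrr add0r.
apply: prim_lip; [exact: ltW|exact: field_continuous|exact: field_coord_le].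
Qed.

Lemma picard_step_diff c c' B : K_lip c -> K_lip c' -> 0 <= B ->
  (forall r, `|c r - c' r| <= B) -> forall s, `|picard_step c s - picard_step c' s| <= B / 2.
Proof.
move=> cK c'K B0 ccB s; apply: rV_diff_le => [|i]; first by rewrite divr_ge0.
rewrite !mxE opprD addrACA subrr add0r.
have diffF r : `|F (c r) 0 i - F (c' r) 0 i| <= L * B.
  apply: le_trans (rV_diff_coord _ _ i) _; apply: le_trans (F_lip _ _) _.
  by rewrite ler_wpM2l.
apply: (@le_trans _ _ (L * B * A)).
  by apply: prim_diff; [exact: ltW|exact: field_continuous|exact: field_continuous|].
by have := ler_wpM2l B0 LA; rewrite mulrAC mulrC; lra.
Qed.

Definition picard n : R -> 'rV[R]_d := iter n picard_step (cst x).

Lemma picard_lip n : K_lip (picard n).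
Proof.
elim: n => [s t|n IH]; last exact: picard_step_lip.
by rewrite /picard /= subrr normr0 mulr_ge0.
Qed.

(** Since [L * A <= 1 / 2], a step of the iteration halves distances. *)
Lemma picard_diff n s : `|picard n.+1 s - picard n s| <= K * A / 2 ^+ n.
Proof.
elim: n s => [|n IH] s; last first.
  have KA : 0 <= K * A / 2 ^+ n by rewrite divr_ge0 ?exprn_ge0 // mulr_ge0 // ltW.
  apply: le_trans (picard_step_diff (picard_lip n.+1) (picard_lip n) KA IH s) _.
  by rewrite exprSr invfM mulrA.
rewrite expr0 divr1; apply: rV_diff_le => [|i]; first by rewrite mulr_ge0 // ltW.
rewrite /picard /= !mxE addrAC subrr add0r.
apply: prim_bound; first exact: ltW.
  by move=> r; exact: cst_continuous.
by move=> r; exact: (field_coord_le (cst x) i r).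
Qed.

Theorem picard_solution : exists c : R -> 'rV[R]_d,
  [/\ c 0 = x, K_lip c & forall s, `|s| < A -> is_curve_deriv c (F (c s)) s].
Proof.
have lim s i : exists l : R, forall n, `|l - picard n s 0 i| <= 2 * (K * A) / 2 ^+ n.
  apply: geometric_limit => n.
  exact: le_trans (rV_diff_coord _ _ i) (picard_diff n s).
pose c s : 'rV[R]_d := \row_i projT1 (cid (lim s i)).
have eps0 n : 0 <= 2 * (K * A) / 2 ^+ n.
  by rewrite divr_ge0 ?exprn_ge0 // mulr_ge0 // mulr_ge0 // ltW.
have cn n s : `|c s - picard n s| <= 2 * (K * A) / 2 ^+ n.
  by apply: rV_diff_le => // i; rewrite mxE; case: cid.
have cK : K_lip c.
  move=> s t; rewrite -subr_le0; apply: (@le_of_geometric _ _ (4 * (K * A))) => n.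
  have := cn n s; have := cn n t; have := picard_lip n s t.
  have e : c s - c t = (c s - picard n s) + (picard n s - picard n t) - (c t - picard n t).
    by rewrite addrA subrK opprB addrA subrK.
  have := ler_normB ((c s - picard n s) + (picard n s - picard n t)) (c t - picard n t).
  have := ler_normD (c s - picard n s) (picard n s - picard n t).
  rewrite -e; have -> : 4 * (K * A) / 2 ^+ n = 2 * (2 * (K * A) / 2 ^+ n) by ring.
  lra.
have fix_c s : c s = picard_step c s.
  apply/eqP; rewrite -subr_eq0 -normr_le0; apply: (@le_of_geometric _ _ (2 * (K * A))) => n.
  have h1 := cn n.+1 s.
  have h2 := picard_step_diff (picard_lip n) cK (eps0 n) (fun r => (_ : _ <= _)) s.
  have {}h2 : `|picard n.+1 s - picard_step c s| <= 2 * (K * A) / 2 ^+ n / 2.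
    by apply: h2 => r; rewrite distrC; exact: cn.
  have := ler_normD (c s - picard n.+1 s) (picard n.+1 s - picard_step c s).
  have eps_half : 2 * (K * A) / 2 ^+ n.+1 = 2 * (K * A) / 2 ^+ n / 2 by rewrite exprSr invfM !mulrA.
  rewrite addrA subrK => /le_trans; apply.
  rewrite eps_half in h1; rewrite [leRHS]splitr; exact: lerD h1 h2.
exists c; split=> //.
  by rewrite fix_c; apply/rowP => i; rewrite mxE prim_0 ?ltW // addr0.
move=> s sA i.
have -> : (fun r => c r 0 i) = cst (x 0 i) + prim A (fun r => F (c r) 0 i).
  by apply/funext => r; rewrite fix_c mxE.
rewrite -[F (c s) 0 i]add0r; apply: is_deriveD.
by apply: is_derive_prim; first exact: field_continuous.
Qed.

End Iterates.

(** Defined for all times, but a solution only for [|s| < A]. *)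
Definition flow (s : R) (x : 'rV[R]_d) : 'rV[R]_d := sval (cid (picard_solution x)) s.

Lemma flow0 x : flow 0 x = x.
Proof. by have [] := svalP (cid (picard_solution x)). Qed.

Lemma flow_lip_time x s t : `|flow s x - flow t x| <= K * `|s - t|.
Proof. by have [_ cK _] := svalP (cid (picard_solution x)); exact: cK. Qed.

Lemma flow_deriv x s : `|s| < A -> is_curve_deriv (flow^~ x) (F (flow s x)) s.
Proof. by have [_ _ dc] := svalP (cid (picard_solution x)) => sA; exact: dc. Qed.

Lemma flow_dist x s : `|flow s x - x| <= K * `|s|.
Proof. by have := flow_lip_time x s 0; rewrite flow0 subr0. Qed.

End Flow.

Section Stability.
Variables (R : realType) (d : nat).

(** Gronwall's inequality on an interval so short that the linear term can be
    absorbed. *)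
Lemma short_gronwall (D D' : R -> 'rV[R]_d) (L e S B : R) :
  0 <= L -> 0 <= e -> 0 < S -> L * S <= 1 / 2 ->
  (forall s, `|s| < S -> is_curve_deriv D (D' s) s) ->
  (forall s, `|s| < S -> `|D' s| <= L * `|D s| + e) ->
  (forall s, `|s| < S -> `|D s| <= B) ->
  forall s, `|s| < S -> `|D s| <= 2 * (`|D 0| + e * S).
Proof.
move=> L0 e0 S0 LS dD D'le DB; apply: halving; first by exists B.
move=> K DK s sS; have K0 : 0 <= K by apply: le_trans (DK s sS).
have LKe : 0 <= L * K + e by rewrite addr_ge0 // mulr_ge0.
have D0S : `|0 : R| < S by rewrite normr0.
suff : `|D s - D 0| <= (L * K + e) * S.
  have := ler_normD (D s - D 0) (D 0); rewrite subrK.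
  have := ler_wpM2l K0 LS; rewrite mulrDl => h1 h2 h3.
  have e1 : L * K * S = K * (L * S) by ring.
  lra.
apply: rV_diff_le => [|i]; first by rewrite mulr_ge0 // ltW.
have d' r : `|r| < S -> `|D' r 0 i| <= L * K + e.
  move=> rS; apply: le_trans (coord_le_norm _ i) _; apply: le_trans (D'le r rS) _.
  by rewrite lerD2r ler_wpM2l // DK.
apply: le_trans (deriv_lip (fun r rS => dD r rS i) d' sS D0S) _.
by rewrite subr0 ler_wpM2l // ltW.
Qed.

End Stability.

Section FlowProperties.
Variables (R : realType) (d : nat) (F : 'rV[R]_d -> 'rV[R]_d) (K L A : R).
Hypotheses (K0 : 0 <= K) (L0 : 0 <= L) (A0 : 0 < A) (LA : L * A <= 1 / 2).
Hypothesis F_bounded : forall x, `|F x| <= K.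
Hypothesis F_lip : forall x y, `|F x - F y| <= L * `|x - y|.
Local Notation Phi := (flow K0 L0 A0 LA F_bounded F_lip).

Lemma curve_derivB (c c' : R -> 'rV[R]_d) v v' s :
  is_curve_deriv c v s -> is_curve_deriv c' v' s ->
  is_curve_deriv (fun r => c r - c' r) (v - v') s.
Proof.
move=> dc dc' i.
have -> : (fun r => (c r - c' r) 0 i) = (fun r => c r 0 i) - (fun r => c' r 0 i).
  by apply/funext => r; rewrite !mxE.
rewrite !mxE; exact: is_deriveB.
Qed.

Lemma curve_deriv_shift (c : R -> 'rV[R]_d) v s t :
  is_curve_deriv c v (s + t) -> is_curve_deriv (fun r => c (r + t)) v s.
Proof.
move=> dc i.
rewrite -[v 0 i]mulr1.
apply: (@is_derive1_comp R (fun r => c r 0 i) (shift t) s (v 0 i) 1).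
  exact: dc.
exact: is_derive_shift.
Qed.

Lemma curve_deriv_opp (c : R -> 'rV[R]_d) v s :
  is_curve_deriv c v (- s) -> is_curve_deriv (fun r => c (- r)) (- v) s.
Proof.
move=> dc i; rewrite mxE -[- v 0 i]mulrN1.
apply: (@is_derive1_comp R (fun r => c r 0 i) -%R s (v 0 i) (-1)).
  exact: dc.
Qed.

Lemma flow_lip_state x z s : `|s| < A -> `|Phi s x - Phi s z| <= 2 * `|x - z|.
Proof.
move=> sA.
have := @short_gronwall R d (fun s => Phi s x - Phi s z) (fun s => F (Phi s x) - F (Phi s z))
  L 0 A (K * A + K * A + `|x - z|) L0 (lexx 0) A0 LA.
rewrite mul0r addr0 !flow0; apply=> // r rA.
- by apply: curve_derivB; exact: flow_deriv.
- by rewrite addr0; exact: F_lip.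
- have h1 := flow_dist K0 L0 A0 LA F_bounded F_lip x r.
  have h2 := flow_dist K0 L0 A0 LA F_bounded F_lip z r.
  have hK : K * `|r| <= K * A by rewrite ler_wpM2l // ltW.
  have -> : Phi r x - Phi r z = (Phi r x - x) - (Phi r z - z) + (x - z).
    by apply/rowP => i; rewrite !mxE; ring.
   apply: le_trans (ler_normD _ _) _; rewrite lerD2r.
  by apply: le_trans (ler_normB _ _) _; apply: lerD; [exact: le_trans h1 hK|exact: le_trans h2 hK].
Qed.

(** Both sides solve the same equation from the same point; [short_gronwall] gives uniqueness. *)
Lemma flow_add x s t : `|s| + `|t| < A -> Phi s (Phi t x) = Phi (s + t) x.
Proof.
move=> stA; have tA : `|t| < A by apply: le_lt_trans stA; rewrite lerDr.
pose S := A - `|t|; have S0 : 0 < S by rewrite subr_gt0.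
have LS : L * S <= 1 / 2.
  by apply: le_trans LA; rewrite ler_wpM2l // lerBlDr lerDl.
have sS : `|s| < S by rewrite ltrBrDr.
pose z := Phi t x.
have := @short_gronwall R d (fun s => Phi s z - Phi (s + t) x)
  (fun s => F (Phi s z) - F (Phi (s + t) x))
  L 0 S (K * A + K * A) L0 (lexx 0) S0 LS.
rewrite mul0r addr0 flow0 add0r subrr normr0 mulr0 => /(_ _ _ _ s sS) H.
apply/eqP; rewrite -subr_eq0 -normr_le0; apply: H => r rS.
- apply: curve_derivB; first by apply: flow_deriv; apply: lt_le_trans rS _; rewrite lerBlDr lerDl.
  apply: (@curve_deriv_shift (fun r => Phi r x)); apply: flow_deriv.
  by apply: le_lt_trans (ler_normD _ _) _; rewrite -ltrBrDr.
- by rewrite addr0; exact: F_lip.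
have -> : Phi r z - Phi (r + t) x = (Phi r z - z) - (Phi (r + t) x - Phi t x).
  by rewrite /z opprB addrA subrK.
have rA : `|r| <= A by apply: le_trans (ltW rS) _; rewrite lerBlDr lerDl.
apply: le_trans (ler_normB _ _) _; apply: lerD.
  apply: le_trans (flow_dist K0 L0 A0 LA F_bounded F_lip z r) _.
  by rewrite ler_wpM2l.
apply: le_trans (flow_lip_time K0 L0 A0 LA F_bounded F_lip x _ _) _.
by rewrite addrK ler_wpM2l.
Qed.

Lemma flow_expansion z s : `|s| < A -> `|Phi s z - z - s *: F z| <= 2 * (L * K) * `|s| ^+ 2.
Proof.
move=> sA; have LK : 0 <= L * K by rewrite mulr_ge0.
have [->|s_neq0] := eqVneq s 0.
  by rewrite flow0 subrr scale0r subr0 normr0 mulr_ge0 // mulr_ge0.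
have s_gt0 : 0 < `|s| by rewrite normr_gt0.
(* an open interval around [0] and [s], as derivatives are two-sided *)
pose S := Num.min (2 * `|s|) A.
have sS : `|s| < S by rewrite lt_min sA andbT; lra.
have zS : `|0 : R| < S by rewrite normr0 (lt_trans s_gt0).
have SA : S <= A by rewrite ge_min lexx orbT.
have S2 : S <= 2 * `|s| by rewrite ge_min lexx.
apply: norm_le_coord => [|i]; first by rewrite mulr_ge0 ?exprn_ge0 // mulr_ge0.
have dc r : `|r| < S -> is_derive r (1 : R) ((fun r => Phi r z 0 i) - (fun r => r * F z 0 i))
    (F (Phi r z) 0 i - F z 0 i).
  move=> rS; apply: is_deriveB; first by apply: flow_deriv; exact: lt_le_trans rS SA.
  have -> : (fun r => r * F z 0 i) = (F z 0 i \*: id) :> (R -> R).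
    by apply/funext => q; rewrite /= mulrC.
  by rewrite -[X in is_derive _ _ _ X]mulr1; exact: is_deriveZ.
have bc r : `|r| < S -> `|F (Phi r z) 0 i - F z 0 i| <= L * K * (2 * `|s|).
  move=> rS; apply: le_trans (rV_diff_coord _ _ i) _; apply: le_trans (F_lip _ _) _.
  rewrite -mulrA ler_wpM2l //.
  apply: le_trans (flow_dist K0 L0 A0 LA F_bounded F_lip z r) _.
  by rewrite ler_wpM2l // (le_trans (ltW rS)).
have := deriv_lip dc bc sS zS.
rewrite -[X in `|X - _|]/(Phi s z 0 i - s * F z 0 i).
rewrite -[X in `|_ - X|]/(Phi 0 z 0 i - 0 * F z 0 i) flow0 mul0r subr0 subr0 !mxE.
rewrite addrAC => /le_trans; apply.
by rewrite expr2 le_eqVlt; apply/orP; left; apply/eqP; ring.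
Qed.

End FlowProperties.

(** * The drift pulled back by the flow *)

Section Pullback.
Variables (R : realType) (d n : nat) (G0 G1 : vfield R d).
Local Notation adf := (adfield G0 G1).

(** Truncated series of the pull-back of [G0] by the flow of [G1] at time [s]. *)
Definition pullback (s : R) (y : 'rV[R]_d) : 'rV[R]_d :=
  \sum_(j < n.+1) (s ^+ j / j`!%:R) *: ev_field (adf j) y.

Lemma pullbackE s y i : pullback s y 0 i = \sum_(j < n.+1) s ^+ j / j`!%:R * evp (adf j i) y.
Proof. by rewrite /pullback summxE; apply: eq_bigr => j _; rewrite !mxE. Qed.

Lemma dirder_sum I (r : seq I) (v : I -> 'rV[R]_d) (p : mpoly d R) (x : 'rV[R]_d) :
  dirder (\sum_(i <- r) v i) p x = \sum_(i <- r) dirder (v i) p x.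
Proof.
rewrite /dirder exchange_big; apply: eq_bigr => i _ /=.
by rewrite summxE mulr_suml.
Qed.

Lemma dirderZv c (v : 'rV[R]_d) (p : mpoly d R) (x : 'rV[R]_d) :
  dirder (c *: v) p x = c * dirder v p x.
Proof. by rewrite /dirder mulr_sumr; apply: eq_bigr => i _; rewrite mxE mulrA. Qed.

Lemma dirderDv (u v : 'rV[R]_d) (p : mpoly d R) (x : 'rV[R]_d) :
  dirder (u + v) p x = dirder u p x + dirder v p x.
Proof. by rewrite /dirder -big_split; apply: eq_bigr => i _; rewrite mxE mulrDl. Qed.

Lemma dirderNv (v : 'rV[R]_d) (p : mpoly d R) (x : 'rV[R]_d) :
  dirder (- v) p x = - dirder v p x.
Proof. by rewrite -scaleN1r dirderZv mulN1r. Qed.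

Lemma dirder_pullback s (y : 'rV[R]_d) p : dirder (pullback s y) p y = drift n G0 G1 p s y.
Proof.
rewrite /pullback dirder_sum; apply: eq_bigr => j _.
by rewrite dirderZv evp_lder.
Qed.

Lemma is_derive_divided_power j (t : R) :
  is_derive t (1 : R) (fun s => s ^+ j / j`!%:R)
    (if j is j'.+1 then t ^+ j' / j'`!%:R else 0).
Proof.
have -> : (fun s : R => s ^+ j / j`!%:R) = (j`!%:R^-1 \*: (fun s => s ^+ j)).
  by apply/funext => s; rewrite /= mulrC.
have dX : is_derive t (1 : R) (@GRing.exp R ^~ j) (j%:R * t ^+ j.-1).
  split; first exact: exprn_derivable.
  by rewrite exp_derive /GRing.scale /= mulr1.
apply: (is_derive_eq (@is_deriveZ _ _ _ _ (j`!%:R^-1) _ _ _ dX)).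
case: j dX => [|j] _; first by rewrite mul0r scaler0.
rewrite /GRing.scale /= factS natrM.
by rewrite invfM mulrACA mulVf ?pnatr_eq0 // mul1r mulrC.
Qed.

(** Along a curve y' = - v the pulled-back field solves, up to its last term
    and to the difference between v and the field G1, the variational
    equation of the flow. *)
Lemma is_derive_pullback (y : R -> 'rV[R]_d) (v : 'rV[R]_d) (t : R) i :
  is_curve_deriv y (- v) t ->
  is_derive t (1 : R) (fun s => pullback s (y s) 0 i)
   (- dirder (pullback t (y t)) (G1 i) (y t)
    - \sum_(j < n.+1) t ^+ j / j`!%:R * dirder (v - ev_field G1 (y t)) (adf j i) (y t)
    - t ^+ n / n`!%:R * evp (adf n.+1 i) (y t)).
Proof.
move=> dy.
have -> : (fun s => pullback s (y s) 0 i) =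
    \sum_(j < n.+1) ((fun s => s ^+ j / j`!%:R) * (fun s => evp (adf j i) (y s))).
  by apply/funext => s; rewrite pullbackE fct_sumE.
pose da (j : nat) := if j is j'.+1 then t ^+ j' / j'`!%:R else 0.
have H : is_derive t (1 : R)
    (\sum_(j < n.+1) ((fun s => s ^+ j / j`!%:R) * (fun s => evp (adf j i) (y s))))
    (\sum_(j < n.+1) (t ^+ j / j`!%:R * dirder (- v) (adf j i) (y t) +
       evp (adf j i) (y t) * da j)).
  apply: is_derive_sum => j.
  exact: (is_deriveM (is_derive_divided_power j t) (is_derive_curve (adf j i) dy)).
apply: (is_derive_eq H).
have ad_step j : evp (adf j.+1 i) (y t) =
    dirder (ev_field G1 (y t)) (adf j i) (y t) - dirder (ev_field (adf j) (y t)) (G1 i) (y t).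
  by rewrite -!evp_lder -evpB.
rewrite big_split /= [X in _ + X]big_ord_recl /= mulr0 add0r.
rewrite (eq_bigr (fun j : 'I_n => t ^+ j / j`!%:R * evp (adf j.+1 i) (y t))); last first.
  by move=> j _; rewrite mulrC.
have -> : \sum_(j < n) t ^+ j / j`!%:R * evp (adf j.+1 i) (y t) =
  \sum_(j < n.+1) t ^+ j / j`!%:R * evp (adf j.+1 i) (y t)
   - t ^+ n / n`!%:R * evp (adf n.+1 i) (y t) by rewrite big_ord_recr /= addrK.
rewrite addrA; congr (_ - _).
rewrite [pullback t (y t)]/pullback dirder_sum -!sumrN -!big_split /=.
apply: eq_bigr => j _; rewrite ad_step dirderZv dirderDv !dirderNv; ring.
Qed.

End Pullback.

Section FieldBounds.
Variables (R : realType) (d : nat).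
Local Notation P := (mpoly d R).

Lemma ev_field_lipschitz (G : vfield R d) : exists2 C : R, 0 <= C &
  forall a b : 'rV[R]_d, `|a| <= 1 -> `|b| <= 1 ->
    `|ev_field G a - ev_field G b| <= C * `|a - b|.
Proof.
have [i C C' H CC' a b a1 b1|i|C C0 HC] := @uniform_fin R 'I_d (fun i C =>
    forall a b : 'rV[R]_d, `|a| <= 1 -> `|b| <= 1 ->
    `|evp (G i) a - evp (G i) b| <= C * `|a - b|).
- by apply: le_trans (H a b a1 b1) _; rewrite ler_wpM2r.
- exact: evp_lipschitz.
- exists C => // a b a1 b1; apply: rV_diff_le => [|i]; first by rewrite mulr_ge0.
  by rewrite !mxE; exact: HC.
Qed.

Lemma ev_field_taylor2 (G : vfield R d) : exists2 C : R, 0 <= C &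
  forall (a b : 'rV[R]_d) i, `|a| <= 1 -> `|b| <= 1 ->
    `|evp (G i) a - evp (G i) b - dirder (a - b) (G i) b| <= C * `|a - b| ^+ 2.
Proof.
have [i C C' H CC' a b a1 b1|i|C C0 HC] := @uniform_fin R 'I_d (fun i C =>
    forall a b : 'rV[R]_d, `|a| <= 1 -> `|b| <= 1 ->
    `|evp (G i) a - evp (G i) b - dirder (a - b) (G i) b| <= C * `|a - b| ^+ 2).
- by apply: le_trans (H a b a1 b1) _; rewrite ler_wpM2r ?exprn_ge0.
- exact: evp_taylor2.
- by exists C => // a b i a1 b1; exact: HC.
Qed.

Lemma ev_field_bounded (G : vfield R d) : exists2 C : R, 0 <= C &
  forall (a : 'rV[R]_d), `|a| <= 1 -> `|ev_field G a| <= C.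
Proof.
have [i C C' H CC' a a1|i|C C0 HC] := @uniform_fin R 'I_d (fun i C =>
    forall a : 'rV[R]_d, `|a| <= 1 -> `|evp (G i) a| <= C).
- exact: le_trans (H a a1) CC'.
- exact: evp_bounded.
- exists C => // a a1; apply: norm_le_coord => // i.
  by rewrite mxE; exact: HC.
Qed.

Lemma divided_power_le1 (s : R) j : `|s| <= 1 -> `|s ^+ j / j`!%:R| <= 1.
Proof.
move=> s1; rewrite normrM normrX -[leRHS]mulr1 ler_pM ?exprn_ge0 ?fact_inv_le1 //.
by rewrite exprn_ile1.
Qed.

Variables (n : nat) (G0 G1 : vfield R d).
Local Notation adf := (adfield G0 G1).

Lemma pullback_bounded : exists2 C : R, 0 <= C & forall (s : R) (y : 'rV[R]_d),
  `|s| <= 1 -> `|y| <= 1 -> `|pullback n G0 G1 s y| <= C.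
Proof.
have [j C C' H CC' a a1|j|C C0 HC] := @uniform_fin R 'I_n.+1 (fun j C =>
    forall y : 'rV[R]_d, `|y| <= 1 -> `|ev_field (adf j) y| <= C).
- exact: le_trans (H a a1) CC'.
- exact: ev_field_bounded.
exists (n.+1%:R * C) => [|s y s1 y1]; first exact: mulr_ge0.
rewrite /pullback; apply: le_trans (ler_norm_sum _ _ _) _.
apply: (@le_trans _ _ (\sum_(j < n.+1) C)).
  apply: ler_sum => j _; rewrite normrZ -[leRHS]mul1r ler_pM ?HC //.
  exact: divided_power_le1.
by rewrite sumr_const card_ord -[leLHS]mulr_natl.
Qed.

Lemma pullback_dirder_le : exists2 C : R, 0 <= C &
  forall (s : R) (w y : 'rV[R]_d) i, `|s| <= 1 -> `|y| <= 1 ->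
  `|\sum_(j < n.+1) s ^+ j / j`!%:R * dirder w (adf j i) y| <= C * `|w|.
Proof.
have [[j i] C C' H CC' w y y1|[j i]|C C0 HC] := @uniform_fin R ('I_n.+1 * 'I_d)%type
  (fun ji C => forall w y : 'rV[R]_d, `|y| <= 1 -> `|dirder w (adf ji.1 ji.2) y| <= C * `|w|).
- by apply: le_trans (H w y y1) _; rewrite ler_wpM2r.
- exact: dirder_le.
exists (n.+1%:R * C) => [|s w y i s1 y1]; first exact: mulr_ge0.
apply: le_trans (ler_norm_sum _ _ _) _.
apply: (@le_trans _ _ (\sum_(j < n.+1) C * `|w|)).
  apply: ler_sum => j _; rewrite normrM -[leRHS]mul1r ler_pM //; last exact: (HC (j, i)).
  exact: divided_power_le1.
by rewrite sumr_const card_ord -[leLHS]mulr_natl mulrA.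
Qed.

Lemma pullback0 (x : 'rV[R]_d) : pullback n G0 G1 0 x = ev_field G0 x.
Proof.
rewrite /pullback big_ord_recl /= expr0 divr1 scale1r big1 ?addr0 // => j _.
by rewrite expr0n /= mul0r scale0r.
Qed.

End FieldBounds.

Section PullbackEstimate.
Variables (R : realType) (d n : nat) (G0 G1 : vfield R d).
Hypothesis lt1n : (1 < n)%N.
Variables (f0 F : 'rV[R]_d -> 'rV[R]_d) (r C A : R).
Hypotheses (C0 : 0 <= C) (A0 : 0 < A) (CA : C * A <= 1 / 2).
Hypotheses (r0 : 0 < r) (r1 : r <= 1 / 2).
Hypothesis F_bounded : forall x, `|F x| <= C.
Hypothesis F_lip : forall x y, `|F x - F y| <= C * `|x - y|.
Let rem x := F x - ev_field G1 x.
Hypothesis rem_lip : forall a b, `|a| <= r -> `|b| <= r ->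
  `|rem a - rem b| <= C * Num.max `|a| `|b| ^+ n.-1 * `|a - b|.
Hypothesis F_at0 : F 0 = ev_field G1 0.
Hypothesis f0_rem : forall x, `|x| <= r -> `|f0 x - ev_field G0 x| <= C * `|x| ^+ n.+1.
Hypothesis f0_le : forall x, `|x| <= r -> `|f0 x| <= C * `|x|.
Local Notation Phi := (flow C0 C0 A0 CA F_bounded F_lip).
Local Notation pb := (pullback n G0 G1).

Variables (C1 C2 C3 C4 C5 : R).
Hypotheses (C10 : 0 <= C1) (C20 : 0 <= C2) (C30 : 0 <= C3) (C40 : 0 <= C4) (C50 : 0 <= C5).
Hypothesis HC1 : forall a b : 'rV[R]_d, `|a| <= 1 -> `|b| <= 1 ->
    `|ev_field G1 a - ev_field G1 b| <= C1 * `|a - b|.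
Hypothesis HC2 : forall (a b : 'rV[R]_d) i, `|a| <= 1 -> `|b| <= 1 ->
    `|evp (G1 i) a - evp (G1 i) b - dirder (a - b) (G1 i) b| <= C2 * `|a - b| ^+ 2.
Hypothesis HC3 : forall (s : R) (w y : 'rV[R]_d) i, `|s| <= 1 -> `|y| <= 1 ->
  `|\sum_(j < n.+1) s ^+ j / j`!%:R * dirder w (adfield G0 G1 j i) y| <= C3 * `|w|.
Hypothesis HC4 : forall a : 'rV[R]_d, `|a| <= 1 -> `|ev_field (adfield G0 G1 n.+1) a| <= C4.
Hypothesis HC5 : forall (s : R) (y : 'rV[R]_d), `|s| <= 1 -> `|y| <= 1 -> `|pb s y| <= C5.

(* With this [B] the quantity [W] below bounds both [|t|] and [|y t|] for [|t| <= 2 |s|]; the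
   interval is longer than [0, s] because derivatives are taken in its interior. *)
Let B := 3 * C + 2.
Let E := C2 * C5 ^+ 2 + C * 2 ^+ n.-1 * (1 + (2 * C + 1) ^+ n.-1) * (2 * C) + C3 * C + C4.

Variables (s : R) (x : 'rV[R]_d) (h : R).
Hypotheses (sA : 2 * `|s| < A) (sC : C * (2 * `|s|) <= r / 4) (sB : B * `|s| <= 1 / 8).
Hypothesis sC1 : C1 * (2 * `|s|) <= 1 / 2.
Hypotheses (xr : `|x| <= r / 4) (h0 : 0 <= h) (h1 : h <= 1).
Hypotheses (hC : h * C <= r / 4) (hC5 : h * C5 <= 1 / 4).

Let S := 2 * `|s|.
Let z := x + h *: f0 x.
Let y t := Phi (- t) x.
Let b t := Phi (- t) z.
Let W := `|y s| + B * `|s|.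
Let D t := b t - y t - h *: pb t (y t).

Let f0x : `|f0 x| <= C * `|x|.
Proof. by apply: f0_le; have := xr; have := r0; lra. Qed.

Let B0 : 0 < B.
Proof. by rewrite /B; have := C0; lra. Qed.

Let W0 : 0 <= W.
Proof. by rewrite addr_ge0 // mulr_ge0 // ltW. Qed.

Let hf0 : `|h *: f0 x| <= r / 4.
Proof.
rewrite normrZ ger0_norm //; apply: le_trans hC; apply: ler_wpM2l => //.
by apply: le_trans f0x _; rewrite ler_piMr //; have := xr; have := r1; lra.
Qed.

Let z_le : `|z| <= r / 2.
Proof.
by apply: le_trans (ler_normD _ _) _; have := lerD xr hf0; lra.
Qed.

Let y_s : `|y s| <= r / 2.
Proof.
have := flow_dist C0 C0 A0 CA F_bounded F_lip x (- s); rewrite normrN -/(y s) => H.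
have := ler_normD (y s - x) x; rewrite subrK.
by have := sC; have := xr; have := r0; lra.
Qed.

Let W1 : W <= 1.
Proof. by rewrite /W; have := y_s; have := sB; have := r1; lra. Qed.

Let sW : S <= W.
Proof.
have : 0 <= 3 * C * `|s| by rewrite mulr_ge0 // mulr_ge0.
by have := normr_ge0 (y s); rewrite /S /W /B mulrDl; lra.
Qed.

Let tA (t : R) : `|t| <= S -> `|t| < A.
Proof. by move=> tS; apply: le_lt_trans tS sA. Qed.

Let Ct (t : R) : `|t| <= S -> C * `|t| <= r / 4.
Proof. by move=> tS; apply: le_trans sC; rewrite ler_wpM2l. Qed.

Let tW (t : R) : `|t| <= S -> `|t| <= W.
Proof. by move=> tS; exact: le_trans tS sW. Qed.

Let yW (t : R) : `|t| <= S -> `|y t| <= W.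
Proof.
move=> tS; have := flow_lip_time C0 C0 A0 CA F_bounded F_lip x (- t) (- s).
rewrite -/(y t) -/(y s) => H.
have := ler_normD (y t - y s) (y s); rewrite subrK.
have hts : `|- t - - s| <= 3 * `|s|.
  by apply: le_trans (ler_normB _ _) _; rewrite !normrN; move: tS; rewrite /S; lra.
have := ler_wpM2l C0 hts; rewrite /W /B mulrDl => h2 h3.
have : 0 <= 2 * `|s| by rewrite mulr_ge0.
by move: H h2 h3; lra.
Qed.

Let y_r (t : R) : `|t| <= S -> `|y t| <= r / 2.
Proof.
move=> /Ct Ct'; have := flow_dist C0 C0 A0 CA F_bounded F_lip x (- t).
rewrite normrN -/(y t) => H.
by have := ler_normD (y t - x) x; rewrite subrK; have := xr; move: H Ct'; lra.
Qed.

Let b_r (t : R) : `|t| <= S -> `|b t| <= r.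
Proof.
move=> /Ct Ct'; have := flow_dist C0 C0 A0 CA F_bounded F_lip z (- t).
rewrite normrN -/(b t) => H.
have := ler_normD (b t - z) z; rewrite subrK; have := z_le; have := r0.
by move: H Ct'; lra.
Qed.

Let S00 : `|0 : R| <= S.
Proof. by rewrite normr0 /S mulr_ge0. Qed.

Let x_W : `|x| <= W.
Proof. by have := yW S00; rewrite /y oppr0 flow0. Qed.

Let by_le (t : R) : `|t| <= S -> `|b t - y t| <= h * (2 * C) * W.
Proof.
move=> tS; have := flow_lip_state C0 C0 A0 CA F_bounded F_lip z x (s := - t).
rewrite normrN => /(_ (tA tS)) /le_trans; apply.
rewrite /z addrC addKr normrZ ger0_norm // -mulrA mulrCA ler_wpM2l //.
rewrite -mulrA ler_wpM2l //; apply: le_trans f0x _; rewrite ler_wpM2l //.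
Qed.

Let Q t : 'rV[R]_d := \row_i (- dirder (pb t (y t)) (G1 i) (y t)
    - \sum_(j < n.+1) t ^+ j / j`!%:R * dirder (rem (y t)) (adfield G0 G1 j i) (y t)
    - t ^+ n / n`!%:R * evp (adfield G0 G1 n.+1 i) (y t)).
Let D' t := - F (b t) - (- F (y t)) - h *: Q t.

Let dD (t : R) : `|t| <= S -> is_curve_deriv D (D' t) t.
Proof.
move=> tS; have tA' : `|- t| < A by rewrite normrN tA.
have dphi w : is_curve_deriv (fun t => Phi (- t) w) (- F (Phi (- t) w)) t.
  by apply: (@curve_deriv_opp _ _ (fun t => Phi t w)); exact: flow_deriv.
apply: curve_derivB; first by apply: curve_derivB; exact: dphi.
move=> i; have := is_derive_pullback n G0 G1 i (dphi x).
rewrite -/(y t) => dpb.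
have -> : (fun q => (h *: pb q (y q)) 0 i) = (h \*: (fun q => pb q (y q) 0 i)).
  by apply/funext => q; rewrite mxE.
rewrite mxE; apply: is_deriveZ; rewrite mxE; exact: dpb.
Qed.

Let Wn : 0 <= W ^+ n.
Proof. by rewrite exprn_ge0. Qed.

Let Wn1 : W ^+ n = W ^+ n.-1 * W.
Proof. by rewrite -exprSr prednK // ltnW. Qed.

Let rem_diff (t : R) : `|t| <= S -> `|rem (b t) - rem (y t)| <=
  C * 2 ^+ n.-1 * (1 + (2 * C + 1) ^+ n.-1) * (2 * C) * (h * W ^+ n + h ^+ 2).
Proof.
move=> tS.
have hC2 : 0 <= h * (2 * C) by rewrite mulr_ge0 // mulr_ge0.
have hc : 0 <= h * (2 * C + 1) by rewrite mulr_ge0 // addr_ge0 // mulr_ge0.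
have mx : Num.max `|b t| `|y t| <= W + h * (2 * C + 1).
  have yWt := yW tS; rewrite ge_max; apply/andP; split.
    have := ler_normD (b t - y t) (y t); rewrite subrK.
    have := by_le tS; have : h * (2 * C) * W <= h * (2 * C) by rewrite ler_piMr.
    by rewrite [h * (_ + 1)]mulrDr mulr1; have := h0; move: yWt; lra.
  by apply: le_trans yWt _; rewrite lerDl.
have mx0 : 0 <= Num.max `|b t| `|y t| by rewrite le_max normr_ge0.
have y_rt : `|y t| <= r by have := y_r tS; have := r0; lra.
apply: le_trans (rem_lip (b_r tS) y_rt) _.
have pw : Num.max `|b t| `|y t| ^+ n.-1 <=
    2 ^+ n.-1 * (1 + (2 * C + 1) ^+ n.-1) * (W ^+ n.-1 + h).
  apply: (@le_trans _ _ ((W + h * (2 * C + 1)) ^+ n.-1)).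
    by rewrite lerXn2r ?nnegrE // addr_ge0.
  apply: le_trans (power_sum_le _ W0 hc) _.
  rewrite -mulrA ler_wpM2l ?exprn_ge0 //.
  have q0 : 0 <= (2 * C + 1) ^+ n.-1 by rewrite exprn_ge0 // addr_ge0 // mulr_ge0.
  have w0 : 0 <= W ^+ n.-1 by rewrite exprn_ge0.
  have hn : h ^+ n.-1 <= h.
    rewrite -[leRHS]expr1; apply: ler_wiXn2l => //.
    by rewrite -ltnS prednK // ltnW.
  rewrite exprMn; have hq := ler_wpM2r q0 hn; have qw := mulr_ge0 q0 w0.
  by move: hq qw w0 h0; move: (h ^+ _) (W ^+ _) ((_ + 1) ^+ _) => u v w; nra.
apply: (@le_trans _ _ (C * (2 ^+ n.-1 * (1 + (2 * C + 1) ^+ n.-1) * (W ^+ n.-1 + h)) *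
    (h * (2 * C) * W))).
  apply: ler_pM => //; last exact: by_le.
    by rewrite mulr_ge0 // exprn_ge0.
  by rewrite ler_wpM2l.
have k0 : 0 <= C * 2 ^+ n.-1 * (1 + (2 * C + 1) ^+ n.-1) * (2 * C).
  by rewrite !mulr_ge0 ?addr_ge0 ?exprn_ge0 ?addr_ge0 ?mulr_ge0.
rewrite (_ : _ * _ * (h * (2 * C) * W) = C * 2 ^+ n.-1 * (1 + (2 * C + 1) ^+ n.-1) * (2 * C) *
    (h * (W ^+ n.-1 * W) + h ^+ 2 * W)); last ring.
by rewrite -Wn1 ler_wpM2l // lerD2l ler_piMr // exprn_ge0.
Qed.

Let E0 : 0 <= E.
Proof.
have q0 : 0 <= 2 * C + 1 by rewrite addr_ge0 // mulr_ge0.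
rewrite /E !addr_ge0 //; first by rewrite mulr_ge0 // exprn_ge0.
  by rewrite !mulr_ge0 ?addr_ge0 ?exprn_ge0.
by rewrite mulr_ge0.
Qed.

Let D'_le (t : R) : `|t| <= S -> `|D' t| <= C1 * `|D t| + E * (h * W ^+ n + h ^+ 2).
Proof.
move=> tS.
have t1 : `|t| <= 1 by exact: le_trans (tW tS) W1.
have y1 : `|y t| <= 1 by exact: le_trans (yW tS) W1.
have b1 : `|b t| <= 1 by apply: le_trans (b_r tS) _; have := r1; lra.
have pb_le : `|h *: pb t (y t)| <= h * C5 by rewrite normrZ ger0_norm // ler_wpM2l // HC5.
have ypb1 : `|y t + h *: pb t (y t)| <= 1.
  apply: le_trans (ler_normD _ _) _; have := y_r tS; have := r1; have := hC5.
  by move: pb_le; lra.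
have hW : 0 <= h * W ^+ n by rewrite mulr_ge0.
have h2 : 0 <= h ^+ 2 by rewrite exprn_ge0.
have E4 : 0 <= C2 * C5 ^+ 2 by rewrite mulr_ge0 ?exprn_ge0.
have E5 : 0 <= C3 * C by rewrite mulr_ge0.
apply: norm_le_coord => [|i].
  by apply: addr_ge0; apply: mulr_ge0 => //; apply: addr_ge0.
have I1 : `|evp (G1 i) (b t) - evp (G1 i) (y t + h *: pb t (y t))| <= C1 * `|D t|.
  have := HC1 b1 ypb1; rewrite opprD addrA -/(D t); apply: le_trans.
  by have := rV_diff_coord (ev_field G1 (b t)) (ev_field G1 (y t + h *: pb t (y t))) i; rewrite !mxE.
have I2 : `|evp (G1 i) (y t + h *: pb t (y t)) - evp (G1 i) (y t)
    - h * dirder (pb t (y t)) (G1 i) (y t)| <= C2 * C5 ^+ 2 * h ^+ 2.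
  have := HC2 i ypb1 y1; rewrite [_ + _ - y t]addrC addKr dirderZv => /le_trans; apply.
  rewrite -mulrA ler_wpM2l // -exprMn mulrC.
  by rewrite lerXn2r ?nnegrE // ?mulr_ge0 // mulrC.
have I3 : `|rem (b t) 0 i - rem (y t) 0 i| <=
    C * 2 ^+ n.-1 * (1 + (2 * C + 1) ^+ n.-1) * (2 * C) * (h * W ^+ n + h ^+ 2).
  exact: le_trans (rV_diff_coord _ _ i) (rem_diff tS).
have rem_y : `|rem (y t)| <= C * W ^+ n.
  have y_rt : `|y t| <= r by have := y_r tS; have := r0; lra.
  have r00 : `|0 : 'rV[R]_d| <= r by rewrite normr0 ltW.
  have := rem_lip y_rt r00.
  rewrite {2}/rem F_at0 subrr !subr0 normr0 max_l // -mulrA -exprSr prednK; last exact: ltnW.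
  move=> /le_trans; apply; rewrite ler_wpM2l // lerXn2r ?nnegrE //; exact: yW.
have I4 : `|\sum_(j < n.+1) t ^+ j / j`!%:R * dirder (rem (y t)) (adfield G0 G1 j i) (y t)| <=
    C3 * C * W ^+ n.
  apply: le_trans (HC3 _ i t1 y1) _; by rewrite -mulrA ler_wpM2l.
have I5 : `|t ^+ n / n`!%:R * evp (adfield G0 G1 n.+1 i) (y t)| <= C4 * W ^+ n.
  rewrite normrM mulrC ler_pM //.
    by have := le_trans (coord_le_norm (ev_field (adfield G0 G1 n.+1) (y t)) i) (HC4 y1); rewrite mxE.
  rewrite normrM normrX -[leRHS]mulr1 ler_pM ?exprn_ge0 ?fact_inv_le1 //.
  by rewrite lerXn2r ?nnegrE // tW.
have -> : D' t 0 i = - (evp (G1 i) (b t) - evp (G1 i) (y t + h *: pb t (y t)))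
   - (evp (G1 i) (y t + h *: pb t (y t)) - evp (G1 i) (y t) - h * dirder (pb t (y t)) (G1 i) (y t))
   - (rem (b t) 0 i - rem (y t) 0 i)
   + h * (\sum_(j < n.+1) t ^+ j / j`!%:R * dirder (rem (y t)) (adfield G0 G1 j i) (y t)
          + t ^+ n / n`!%:R * evp (adfield G0 G1 n.+1 i) (y t)).
  rewrite /D' !mxE; ring.
have J4 := ler_normD (\sum_(j < n.+1) t ^+ j / j`!%:R * dirder (rem (y t)) (adfield G0 G1 j i) (y t))
  (t ^+ n / n`!%:R * evp (adfield G0 G1 n.+1 i) (y t)).
apply: le_trans (ler_normD _ _) _; rewrite [X in _ + X]normrM (ger0_norm h0).
have J5 := ler_wpM2l h0 (le_trans J4 (lerD I4 I5)).
apply: (le_trans (lerD (le_trans (ler_normB _ _) (lerD (le_trans (ler_normB _ _) (lerD _ I2)) I3)) J5)).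
  rewrite normrN; exact: I1.
rewrite /E; have k1 := mulr_ge0 E4 hW; have k2 := mulr_ge0 E5 h2; have k3 := mulr_ge0 C40 h2.
move: k1 k2 k3; move: (C1 * _) (C2 * _) (C * _ * _ * _) (W ^+ n) => u v w q; lra.
Qed.

(** Let [D t] be the defect of the step seen from time [t]. By [is_derive_pullback] it solves a
    linear equation up to the quadratic part of [G1], which is [O(h^2)], the increments of the
    remainder of [F], which are [O(h W^n)] by the Lipschitz form of the remainder, and the first
    omitted term of the series, [O(h W^n)] as well. Integration over a time [2 |s| <= W] gives
    [h W^(n+1)], and so does the remainder of [f0] in the initial value [D 0]. *)
Lemma pullback_step_error : `|D s| <= 2 * (C + E) * (h * W ^+ n.+1 + h ^+ 2).
Proof.
have h2 : 0 <= h ^+ 2 by rewrite exprn_ge0.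
have WS0 : 0 <= W ^+ n.+1 by rewrite exprn_ge0.
have D0 : `|D 0| <= C * (h * W ^+ n.+1).
  have -> : D 0 = h *: (f0 x - ev_field G0 x).
    by rewrite /D /b /y oppr0 !flow0 pullback0 /z [x + _]addrC addrK scalerBr.
  rewrite normrZ ger0_norm // mulrCA ler_wpM2l //.
  apply: le_trans (f0_rem _) _; first by have := xr; have := r0; lra.
  by rewrite ler_wpM2l // lerXn2r ?nnegrE.
have [s_eq0|s_neq0] := eqVneq s 0.
  rewrite s_eq0; apply: le_trans D0 _.
  have k1 : 0 <= C * (h * W ^+ n.+1) by rewrite mulr_ge0 // mulr_ge0.
  have k2 : 0 <= E * (h * W ^+ n.+1) by rewrite mulr_ge0 // mulr_ge0.
  have k3 : 0 <= (C + E) * h ^+ 2 by rewrite mulr_ge0 // addr_ge0.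
  by move: k1 k2 k3; move: (W ^+ n.+1) => u; lra.
have S0 : 0 < S by rewrite /S mulr_gt0 // normr_gt0.
have sS : `|s| < S by rewrite /S; have : 0 < `|s| by [rewrite normr_gt0]; lra.
have e0 : 0 <= E * (h * W ^+ n + h ^+ 2) by rewrite mulr_ge0 // addr_ge0 // mulr_ge0.
have D_bounded t : `|t| < S -> `|D t| <= r + 1 + 1.
  move=> /ltW tS; apply: le_trans (ler_normB _ _) _; apply: lerD.
    apply: le_trans (ler_normB _ _) _; apply: lerD; first exact: b_r.
    by apply: le_trans (yW tS) W1.
  rewrite normrZ ger0_norm //; have t1 := le_trans (tW tS) W1; have y1 := le_trans (yW tS) W1.
  by have := ler_wpM2l h0 (HC5 t1 y1); have := hC5; lra.
have := short_gronwall C10 e0 S0 sC1 (fun t tS => dD (ltW tS)) (fun t tS => D'_le (ltW tS))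
  D_bounded sS.
move=> /le_trans; apply.
have SW : (h * W ^+ n + h ^+ 2) * S <= h * W ^+ n.+1 + h ^+ 2.
  rewrite mulrDl; apply: lerD; last by rewrite ler_piMr // (le_trans sW).
  by rewrite -mulrA ler_wpM2l // exprSr ler_wpM2l.
have := ler_wpM2l E0 SW; rewrite mulrA => H.
have k3 : 0 <= C * h ^+ 2 by rewrite mulr_ge0.
by move: H D0 k3; move: (`|D 0|) (E * _ * S) (W ^+ n.+1) => u v w; lra.
Qed.

End PullbackEstimate.

(** * Trajectories seen through the flow *)

Section RealInduction.
Variable R : realType.

(** The minimum of the numbers [e / (c + 1)] is positive. *)
Lemma choose_small (l : seq (R * R)) :
  (forall p, p \in l -> 0 <= p.1 /\ 0 < p.2) ->
  exists2 s : R, 0 < s & forall p, p \in l -> forall u, u <= s -> u * p.1 <= p.2.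
Proof.
elim: l => [|[c e] l IH] H; first by exists 1.
have [p pl|s s0 Hs] := IH; first by apply: H; rewrite inE pl orbT.
have [c0 e0] := H (c, e) (mem_head _ _).
have c1 : 0 < c + 1 by rewrite ltr_wpDl.
exists (Num.min s (e / (c + 1))); first by rewrite lt_min s0 divr_gt0.
move=> p; rewrite inE => /predU1P[-> u|pl u]; rewrite le_min => /andP[us ue] /=; last exact: Hs.
apply: (@le_trans _ _ (e / (c + 1) * c)); first by rewrite ler_wpM2r.
by rewrite mulrAC ler_pdivrMr // ler_wpM2l ?(ltW e0) // lerDl.
Qed.

(** The supremum of the times up to which [Q] holds satisfies [Q] by the left
    condition, and it cannot be less than [T] by the right one. *)
Lemma real_induction (T : R) (Q : R -> Prop) :
  Q 0 ->
  (forall s, 0 <= s <= T -> Q s ->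
     exists2 del, 0 < del & forall r, s <= r <= s + del -> r <= T -> Q r) ->
  (forall s, 0 < s <= T -> (forall r, 0 <= r < s -> Q r) -> Q s) ->
  forall s, 0 <= s <= T -> Q s.
Proof.
move=> Q0 right left s0 /andP[s00 s0T].
pose E : set R := [set s | 0 <= s <= T /\ forall r, 0 <= r <= s -> Q r].
have E0 : E 0.
  split; first by rewrite lexx (le_trans s00).
  by move=> r /andP[r0 r00]; have -> : r = 0 by apply/eqP; rewrite eq_le r0 r00.
have supE : has_sup E by split; [exists 0 | exists T => s [/andP[]]].
pose S := sup E.
have S0 : 0 <= S by exact: sup_upper_bound.
have ST : S <= T by apply: ge_sup supE.1 _ => s [/andP[]].
have belowS r : 0 <= r < S -> Q r.
  move=> /andP[r0 rS]; have [e [_ He] re] : exists2 e, E e & r < e.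
    have rS' : 0 < S - r by rewrite subr_gt0.
    by have [e Ee] := sup_adherent rS' supE; rewrite subKr => re; exists e.
  by apply: He; rewrite r0 ltW.
have QS : Q S.
  have [->//|S_gt0] := eqVneq S 0; apply: left => //.
  by rewrite ST lt_neqAle eq_sym S_gt0 S0.
have allS r : 0 <= r <= S -> Q r.
  by move=> /andP[r0]; rewrite le_eqVlt => /predU1P[->//|rS]; apply: belowS; rewrite r0.
have [|del del0 Hdel] := right S _ QS; first by rewrite S0.
have [le_sS|lt_Ss] := leP s0 S; first by apply: allS; rewrite s00.
exfalso; pose s' := Num.min s0 (S + del).
have Ss' : S < s' by rewrite lt_min lt_Ss ltrDl.
have s'T : s' <= T by rewrite ge_min s0T.
have : E s'.
  split; first by rewrite s'T andbT (le_trans S0 (ltW Ss')).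
  move=> r /andP[r0 rs']; have [rS|Sr] := leP r S; first by apply: allS; rewrite r0.
  apply: Hdel; last exact: le_trans rs' s'T.
  by rewrite ltW //= (le_trans rs') // ge_min lexx orbT.
by move=> /(sup_upper_bound supE); rewrite leNgt Ss'.
Qed.

(** Continuity on [0, T] in epsilon-delta form: trajectories and primitives are only
    controlled on that interval. *)
Definition cont_on (V : normedModType R) (T : R) (f : R -> V) := forall s, 0 <= s <= T -> forall e, 0 < e ->
  exists2 del, 0 < del & forall r, 0 <= r <= T -> `|r - s| <= del -> `|f r - f s| <= e.

(** Increment estimates valid to first order near each time add up; [m] only
    measures the error, its size does not matter. *)
Lemma sum_increments (T : R) (f B m : R -> R) :
  cont_on T f -> cont_on T B -> cont_on T m ->
  (forall s, 0 <= s <= T -> forall e, 0 < e -> exists2 del, 0 < del &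
     forall r, s <= r <= s + del -> r <= T ->
     `|f r - f s| <= B r - B s + e * (m r - m s)) ->
  forall s, 0 <= s <= T -> `|f s - f 0| <= B s - B 0.
Proof.
move=> cf cB cm step s0 s0T.
suff H e : 0 < e -> forall s, 0 <= s <= T ->
    `|f s - f 0| <= B s - B 0 + e * (m s - m 0).
  apply/ler_addgt0Pr => e e0; pose M := `|m s0 - m 0| + 1.
  have M0 : 0 < M by rewrite ltr_wpDl.
  have := H (e / M) (divr_gt0 e0 M0) s0 s0T; move=> /le_trans; apply.
  rewrite lerD2l mulrAC ler_pdivrMr // ler_wpM2l ?(ltW e0) //.
  by apply: le_trans (ler_norm _) _; rewrite lerDl.
move=> e0; apply: real_induction.
- by rewrite !subrr normr0 mulr0 addr0.
- move=> s sT Qs; have [del del0 Hdel] := step s sT e e0; exists del => // r sr rT.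
  have := Hdel r sr rT => h.
  have := ler_normD (f r - f s) (f s - f 0); rewrite addrA subrK => /le_trans; apply.
  by apply: le_trans (lerD h Qs) _; rewrite le_eqVlt; apply/orP; left; apply/eqP; ring.
move=> s /andP[s_gt0 sT] Hr; apply/ler_addgt0Pr => q q0.
have sT' : 0 <= s <= T by rewrite ltW.
pose k := q / (2 + e); have k0 : 0 < k by rewrite divr_gt0 // addr_gt0.
have [d1 d10 H1] := cf s sT' k k0.
have [d2 d20 H2] := cB s sT' k k0.
have [d3 d30 H3] := cm s sT' k k0.
pose dd := Num.min (Num.min d1 d2) (Num.min d3 s).
have dd0 : 0 < dd by rewrite !lt_min d10 d20 d30 s_gt0.
have dds : dd <= s by rewrite /dd !ge_min lexx !orbT.
pose r := s - dd.
have r0s : 0 <= r < s by rewrite subr_ge0 dds ltrBlDr ltrDl.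
have rT : 0 <= r <= T by case/andP: r0s => -> /ltW /le_trans; apply.
have rs : `|r - s| = dd by rewrite /r addrC addKr normrN gtr0_norm.
have h1 := H1 r rT; have h2 := H2 r rT; have h3 := H3 r rT.
rewrite rs !ge_min lexx in h1; rewrite rs !ge_min lexx !orbT in h2.
rewrite rs !ge_min lexx !orbT in h3.
have {h1}h1 := h1 isT; have {h2}h2 := h2 isT; have {h3}h3 := h3 isT.
have Qr := Hr r r0s.
have kq : 2 * k + e * k = q by rewrite -mulrDl /k mulrCA divff ?mulr1 // gt_eqF // addr_gt0.
have tri := ler_normB (f r - f 0) (f r - f s).
have e1 : (f r - f 0) - (f r - f s) = f s - f 0 by ring.
rewrite e1 in tri.
have b1 : B r - B s <= k by apply: le_trans (ler_norm _) h2.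
have b2 : e * (m r - m s) <= e * k.
  by rewrite ler_wpM2l ?(ltW e0) //; apply: le_trans (ler_norm _) h3.
have e2 : e * (m r - m 0) = e * (m s - m 0) + e * (m r - m s) by ring.
rewrite e2 in Qr.
lra.
Qed.

End RealInduction.

Lemma cont_on_comp (R : realType) (T : R) (g f : R -> R) : continuous g ->
  cont_on T f -> cont_on T (fun s => g (f s)).
Proof.
move=> gc fc s sT e e0.
have /cvgrPdist_le/(_ e e0)[eta /= eta0 Hg] := gc (f s).
have [|del del0 H] := fc s sT (eta / 2); first by rewrite divr_gt0.
exists del => // s' s'T ss'; rewrite distrC; apply: Hg; rewrite /ball_ /= distrC.
by apply: le_lt_trans (H s' s'T ss') _; lra.
Qed.

Lemma continuous_normX (R : realType) n : continuous (fun z : R => `|z| ^+ n).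
Proof.
move=> z; apply: (@continuous_comp _ _ _ (@Num.norm _ R) (fun z : R => z ^+ n)).
  exact: norm_continuous.
exact: exprn_continuous.
Qed.

Lemma cont_on_extend (R : realType) (T : R) (h : R -> R) : 0 <= T -> cont_on T h ->
  exists2 w : R -> R, continuous w & forall s, 0 <= s <= T -> w s = h s.
Proof.
move=> T0 hc; pose c s : R := `|clamp T s|.
have c_in s : 0 <= c s <= T by rewrite normr_ge0 clamp_le.
have c_lip s t : `|c s - c t| <= `|s - t|.
  exact: le_trans (ler_dist_dist _ _) (clamp_lip _ _ _).
exists (fun s => h (c s)) => [s|s /andP[s0 sT]]; last by rewrite /c clamp_id ger0_norm.
apply/cvgrPdist_le => e e0; have [del del0 H] := hc _ (c_in s) e e0.
exists del => //= t; rewrite /ball_ /= => st; rewrite distrC; apply: H => //.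
by apply: le_trans (c_lip _ _) _; rewrite distrC ltW.
Qed.

(** After extension of [h] to a continuous function on the line this is [prim], whose first-order
    increments are given by the mean value theorem. *)
Lemma antiderivative_on (R : realType) (T : R) (h : R -> R) : 0 <= T -> cont_on T h ->
  (forall s, 0 <= h s) -> exists I : R -> R, [/\ I 0 = 0, cont_on T I,
    forall s s', 0 <= s -> s <= s' -> s' <= T -> I s <= I s' &
    forall s, 0 <= s <= T -> forall e, 0 < e ->
    exists2 del, 0 < del & forall s', s <= s' <= s + del -> s' <= T ->
      `|I s' - I s - (s' - s) * h s| <= e * (s' - s)].
Proof.
move=> T0 hc hpos; have [w wc wE] := cont_on_extend T0 hc.
pose I := prim (T + 1) w.
have inT s : 0 <= s <= T -> `|s| < T + 1.
  by move=> /andP[s0 sT]; rewrite ger0_norm // ltr_pwDr.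
have dI s : 0 <= s <= T -> is_derive s (1 : R) I (w s).
  by move=> /inT sT; exact: is_derive_prim.
have mvt s s' : 0 <= s -> s <= s' -> s' <= T ->
    exists2 q, s <= q <= s' & I s' - I s = w q * (s' - s).
  move=> s0 ss' s'T; have sub q : s <= q <= s' -> 0 <= q <= T.
    by move=> /andP[sq qs']; rewrite (le_trans s0 sq) (le_trans qs').
  have [||q] := @MVT_segment R I w s s' ss'.
  - by move=> q; rewrite in_itv /= => /andP[sq qs']; apply: dI; apply: sub; rewrite !ltW.
  - apply: derivable_within_continuous => q; rewrite in_itv /= => /sub /dI dq.
    exact: ex_derive.
  by rewrite in_itv /= => qin E; exists q.
exists I; split.
- by apply: prim_0; rewrite addr_ge0.
- move=> s sT e e0; have dq := dI s sT.
  have /derivable1_diffP /differentiable_continuous Ic : derivable I s 1 by exact: ex_derive.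
  move/cvgrPdist_le: Ic => /(_ e e0) [del /= del0 H]; exists (del / 2).
    by rewrite divr_gt0.
  move=> t _ ts; rewrite distrC; apply: H; rewrite /ball_ /= distrC.
  by apply: le_lt_trans ts _; lra.
- move=> s s' s0 ss' s'T; have [q /andP[sq qs'] E] := mvt s s' s0 ss' s'T.
  have qT : 0 <= q <= T by rewrite (le_trans s0 sq) (le_trans qs').
  by rewrite -subr_ge0 E wE // mulr_ge0 ?hpos // subr_ge0.
move=> s sT e e0; have [s0 _] := andP sT; have [del del0 H] := hc s sT e e0.
exists del => // s' /andP[ss' s'd] s'T; have [q /andP[sq qs'] ->] := mvt s s' s0 ss' s'T.
have h0 : 0 <= s' - s by rewrite subr_ge0.
have qT : 0 <= q <= T by rewrite (le_trans s0 sq) (le_trans qs').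
rewrite [w q * _]mulrC -mulrBr normrM (ger0_norm h0) mulrC ler_wpM2r // !wE //.
apply: H => //; rewrite ger0_norm ?subr_ge0 // lerBlDl; exact: le_trans s'd.
Qed.

Section Trajectory.
Variables (R : realType) (d n : nat) (G0 G1 : vfield R d).
Hypothesis lt1n : (1 < n)%N.
Variables (f0 F : 'rV[R]_d -> 'rV[R]_d) (r C A : R).
Hypotheses (C0 : 0 <= C) (A0 : 0 < A) (CA : C * A <= 1 / 2).
Hypotheses (r0 : 0 < r) (r1 : r <= 1 / 2).
Hypothesis F_bounded : forall x, `|F x| <= C.
Hypothesis F_lip : forall x y, `|F x - F y| <= C * `|x - y|.
Hypothesis rem_lip : forall a b, `|a| <= r -> `|b| <= r ->
  `|(F a - ev_field G1 a) - (F b - ev_field G1 b)| <=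
    C * Num.max `|a| `|b| ^+ n.-1 * `|a - b|.
Hypothesis F_at0 : F 0 = ev_field G1 0.
Hypothesis f0_rem : forall x, `|x| <= r -> `|f0 x - ev_field G0 x| <= C * `|x| ^+ n.+1.
Hypothesis f0_le : forall x, `|x| <= r -> `|f0 x| <= C * `|x|.
Local Notation Phi := (flow C0 C0 A0 CA F_bounded F_lip).
Local Notation pb := (pullback n G0 G1).

(** The conditions of [pullback_step_error] hold for small [s] and [h], and [W] is at most a
    multiple of [|s| + |Phi (- s) x|]. *)
Lemma pullback_step_estimate : exists C' s1 h1, [/\ 0 <= C', 0 < s1, 0 < h1 &
  forall s x h, `|s| <= s1 -> `|x| <= r / 4 -> 0 <= h <= h1 ->
    `|Phi (- s) (x + h *: f0 x) - Phi (- s) x - h *: pb s (Phi (- s) x)| <=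
      C' * (h * (`|s| + `|Phi (- s) x|) ^+ n.+1 + h ^+ 2)].
Proof.
have [C1 C10 HC1] := ev_field_lipschitz G1.
have [C2 C20 HC2] := ev_field_taylor2 G1.
have [C3 C30 HC3] := pullback_dirder_le n G0 G1.
have [C4 C40 HC4] := ev_field_bounded (adfield G0 G1 n.+1).
have [C5 C50 HC5] := pullback_bounded n G0 G1.
pose B := 3 * C + 2; have B1 : 1 <= B by rewrite /B; have := C0; lra.
have B0 : 0 <= B by exact: le_trans ler01 B1.
pose E := C2 * C5 ^+ 2 + C * 2 ^+ n.-1 * (1 + (2 * C + 1) ^+ n.-1) * (2 * C) + C3 * C + C4.
have q0 : 0 <= 2 * C + 1 by rewrite addr_ge0 // mulr_ge0.
have E0 : 0 <= E.
  rewrite /E !addr_ge0 //; first by rewrite mulr_ge0 // exprn_ge0.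
    by rewrite !mulr_ge0 ?addr_ge0 ?exprn_ge0.
  by rewrite mulr_ge0.
have [|s1 s10 Hs] := @choose_small R [:: (2, A / 2); (2 * C, r / 4); (B, 1 / 8); (2 * C1, 1 / 2)].
  move=> p; rewrite !inE => /or4P[] /eqP -> /=; split=> //; rewrite ?mulr_ge0 ?divr_gt0 //.
have [|h1 h10 Hh] := @choose_small R [:: (1, 1); (C, r / 4); (C5, 1 / 4)].
  by move=> p; rewrite !inE => /or3P[] /eqP -> /=; split=> //; rewrite ?mulr_ge0 ?divr_gt0.
exists (2 * (C + E) * B ^+ n.+1), s1, h1; split=> //.
  by rewrite mulr_ge0 ?exprn_ge0 // mulr_ge0 // addr_ge0.
move=> s x h ss1 xr /andP[h0 hh1].
have k1 := Hs (2, A / 2) (mem_head _ _) _ ss1.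
have k2 : `|s| * (2 * C) <= r / 4 by apply: (Hs (2 * C, r / 4)) ss1; rewrite !inE eqxx orbT.
have k3 : `|s| * B <= 1 / 8 by apply: (Hs (B, 1 / 8)) ss1; rewrite !inE eqxx !orbT.
have k4 : `|s| * (2 * C1) <= 1 / 2 by apply: (Hs (2 * C1, 1 / 2)) ss1; rewrite !inE eqxx !orbT.
have k5 : h * 1 <= 1 by apply: (Hh (1, 1)) hh1; rewrite !inE eqxx.
have k6 : h * C <= r / 4 by apply: (Hh (C, r / 4)) hh1; rewrite !inE eqxx !orbT.
have k7 : h * C5 <= 1 / 4 by apply: (Hh (C5, 1 / 4)) hh1; rewrite !inE eqxx !orbT.
rewrite mulr1 in k5; rewrite /= in k1.
have sA : 2 * `|s| < A by have := A0; rewrite mulrC; lra.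
have sC : C * (2 * `|s|) <= r / 4 by rewrite mulrCA mulrA mulrC.
have sB : B * `|s| <= 1 / 8 by rewrite mulrC.
have sC1 : C1 * (2 * `|s|) <= 1 / 2 by rewrite mulrCA mulrA mulrC.
have := pullback_step_error lt1n C0 A0 CA r0 r1 F_bounded F_lip rem_lip F_at0 f0_rem f0_le
  C10 C20 C30 C40 C50 HC1 HC2 HC3 HC4 HC5 sA sC sB sC1 xr h0 k5 k6 k7.
move=> /le_trans; apply; rewrite -/B -/E.
have CE : 0 <= 2 * (C + E) by rewrite mulr_ge0 // addr_ge0.
rewrite -[leRHS]mulrA; apply: ler_wpM2l => //; rewrite mulrDr; apply: lerD; last first.
  by rewrite ler_peMl ?exprn_ge0 // exprn_ege1.
have W0 : 0 <= `|Phi (- s) x| + B * `|s| by rewrite addr_ge0 // mulr_ge0.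
have W0' : 0 <= B * (`|s| + `|Phi (- s) x|) by rewrite mulr_ge0 // addr_ge0.
rewrite mulrCA ler_wpM2l // -exprMn lerXn2r //.
by rewrite mulrDr addrC; apply: lerD => //; rewrite ler_peMl.
Qed.

(** Taylor expansion of a function along the flow; [F] enters through [G1], at
    the price of the remainder of order [n]. *)
Lemma flow_error_bound p : exists2 K, 0 <= K & forall y a, `|y| <= r / 2 ->
  2 * `|a| <= 1 -> 2 * `|a| <= A -> C * (2 * `|a|) <= r / 2 ->
  `|flow_error n G1 (Phi a y) y a p| <= K * (`|a| ^+ n + `|a| * (`|a| + `|y|) ^+ n).
Proof.
have err0 (S : R) (y : 'rV[R]_d) : 0 <= S -> 0 <= S ^+ n + S * (S + `|y|) ^+ n.
  by move=> S0; rewrite addr_ge0 ?exprn_ge0 // mulr_ge0 // exprn_ge0 // addr_ge0.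
suff [K K0 HK] : exists2 K, 0 <= K & forall y S, `|y| <= r / 2 -> 0 < S -> S <= 1 -> S <= A ->
    C * S <= r / 2 -> forall t, `|t| < S ->
    `|evp p (Phi t y) - \sum_(m < n) t ^+ m / m`!%:R * evp (der1_iter G1 m p) y|
       <= K * (S ^+ n + S * (S + `|y|) ^+ n).
  exists (K * 2 ^+ n.+1) => [|y a yr a1 aA aC]; first by rewrite mulr_ge0 ?exprn_ge0.
  have [->|a_neq0] := eqVneq a 0.
    rewrite flow0 /flow_error -(prednK (ltnW lt1n)) big_ord_recl /= expr0 divr1 mul1r.
    rewrite big1 => [|i _]; last by rewrite expr0n /= mul0r mul0r.
    rewrite addr0 subrr normr0 mulr_ge0 ?err0 //.
    by rewrite mulr_ge0 ?exprn_ge0.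
  have a0 : 0 < `|a| by rewrite normr_gt0.
  have aS : `|a| < 2 * `|a| by lra.
  have S0 : 0 < 2 * `|a| by rewrite mulr_gt0.
  have := HK y (2 * `|a|) yr S0 a1 aA aC a aS; move=> /le_trans; apply.
  rewrite -mulrA ler_wpM2l // mulrDr; apply: lerD.
    by rewrite exprMn ler_wpM2r ?exprn_ge0 // ler_eXn2l // ltr1n.
  have y0 := normr_ge0 y.
  rewrite (_ : 2 ^+ n.+1 * _ = 2 * `|a| * (2 * (`|a| + `|y|)) ^+ n); last first.
    by rewrite exprS exprMn; ring.
  apply: ler_wpM2l; first exact: ltW.
  by rewrite lerXn2r ?nnegrE ?mulr_ge0 ?addr_ge0 // mulrDr lerD2l; lra.
suff H q p' : exists2 K, 0 <= K & forall y S, `|y| <= r / 2 -> 0 < S -> S <= 1 -> S <= A ->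
    C * S <= r / 2 -> forall t, `|t| < S ->
    `|evp p' (Phi t y) - \sum_(m < q) t ^+ m / m`!%:R * evp (der1_iter G1 m p') y|
       <= K * (S ^+ q + S * (S + `|y|) ^+ n) by exact: H.
elim: q p' => [|q IH] {}p.
  have [K K0 HK] := evp_bounded p; exists K => // y S yr S0 S1 SA SC t tS.
  rewrite big_ord0 subr0 expr0; apply: le_trans (HK _ _) _.
    have := flow_dist C0 C0 A0 CA F_bounded F_lip y t.
    have := ler_normD (Phi t y - y) y; rewrite subrK.
    have := ler_wpM2l C0 (ltW tS); have := r1; have := yr; have := SC; lra.
  by rewrite ler_peMr // lerDl mulr_ge0 ?exprn_ge0 ?addr_ge0 // ltW.
have [K K0 HK] := IH (lder G1 p).
have [D D0 HD] := dirder_le p.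
have C1n : 0 <= (1 + C) ^+ n by rewrite exprn_ge0 ?addr_ge0.
exists (K + D * (C * (1 + C) ^+ n)) => [|y S yr S0 S1 SA SC t tS].
  by rewrite addr_ge0 ?mulr_ge0.
have near w : `|w| < S -> `|Phi w y| <= r /\ `|Phi w y| <= (1 + C) * (S + `|y|).
  move=> wS; have := flow_dist C0 C0 A0 CA F_bounded F_lip y w.
  have := ler_normD (Phi w y - y) y; rewrite subrK.
  have := ler_wpM2l C0 (ltW wS); have := SC; have := yr => h1 h2 h3 h4.
  have := mulr_ge0 C0 (normr_ge0 y); have := S0.
  by rewrite mulrDl mul1r mulrDr; split; lra.
pose e t := evp p (Phi t y) - \sum_(m < q.+1) t ^+ m / m`!%:R * evp (der1_iter G1 m p) y.
pose e' t := dirder (F (Phi t y)) p (Phi t y) -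
   \sum_(m < q) t ^+ m / m`!%:R * evp (der1_iter G1 m (lder G1 p)) y.
have de w : `|w| < S -> is_derive w (1 : R) e (e' w).
  move=> wS; have wA : `|w| < A by apply: lt_le_trans wS SA.
  pose c m : R := evp (der1_iter G1 m p) y.
  have -> : e = (fun t => evp p (Phi t y)) - \sum_(m < q.+1) (fun t => t ^+ m / m`!%:R * c m).
    by apply/funext => w'; rewrite /e fctE; congr (_ - _); rewrite fct_sumE.
  apply: is_deriveB.
    apply: (@is_derive_curve _ _ p (fun t => Phi t y)); exact: flow_deriv.
  have -> : \sum_(m < q) w ^+ m / m`!%:R * evp (der1_iter G1 m (lder G1 p)) y =
      \sum_(m < q.+1) ((if m : nat is m'.+1 then w ^+ m' / m'`!%:R else 0) * c m).
    rewrite big_ord_recl /= mul0r add0r; apply: eq_bigr => m _ /=.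
    by rewrite /c /der1_iter -iterSr.
  apply: is_derive_sum => m.
  have := is_deriveZ (c m) (is_derive_divided_power m w).
  have -> : c m \*: (fun t : R => t ^+ m / m`!%:R) = (fun t => t ^+ m / m`!%:R * c m).
    by apply/funext => w'; exact: mulrC.
  by rewrite [c m *: _]mulrC.
have e0 : e 0 = 0.
  rewrite /e big_ord_recl /= expr0 divr1 mul1r flow0 big1 ?addr0 ?subrr // => i _.
  by rewrite expr0n /= mul0r mul0r.
pose Z := S ^+ q + (S + `|y|) ^+ n.
have W0 : 0 <= S + `|y| by rewrite addr_ge0 // ltW.
have SZ : S ^+ q + S * (S + `|y|) ^+ n <= Z.
  by rewrite lerD2l ler_piMl ?exprn_ge0.
have e'_le w : `|w| < S -> `|e' w| <= (K + D * (C * (1 + C) ^+ n)) * Z.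
  move=> wS; have [xr xW] := near w wS; set x := Phi w y in xr xW *.
  have x1 : `|x| <= 1 by have := r1; lra.
  have remx : `|F x - ev_field G1 x| <= C * (1 + C) ^+ n * (S + `|y|) ^+ n.
    have := rem_lip xr (_ : `|0| <= r); rewrite normr0 => /(_ (ltW r0)).
    rewrite F_at0 subrr !subr0 max_l // -mulrA -exprSr prednK; last exact: ltnW.
    move=> /le_trans; apply; rewrite -mulrA ler_wpM2l // -exprMn.
    by rewrite lerXn2r ?nnegrE // mulr_ge0 // addr_ge0.
  have -> : e' w = (evp (lder G1 p) x -
     \sum_(m < q) w ^+ m / m`!%:R * evp (der1_iter G1 m (lder G1 p)) y) +
     dirder (F x - ev_field G1 x) p x.
    by rewrite /e' -/x evp_lder dirderDv dirderNv; ring.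
  apply: le_trans (ler_normD _ _) _; rewrite mulrDl; apply: lerD.
    apply: le_trans (HK y S yr S0 S1 SA SC w wS) _; exact: ler_wpM2l.
  apply: le_trans (HD _ _ x1) _; rewrite -mulrA; apply: ler_wpM2l => //.
  apply: le_trans remx _; apply: ler_wpM2l; first exact: mulr_ge0.
  by rewrite lerDr exprn_ge0 // ltW.
have := deriv_lip de e'_le tS (_ : `|0| < S); rewrite normr0 => /(_ S0).
rewrite e0 !subr0 => /le_trans; apply.
have M0 : 0 <= (K + D * (C * (1 + C) ^+ n)) * Z.
  rewrite mulr_ge0 //; first by rewrite addr_ge0 // mulr_ge0 // mulr_ge0.
  by rewrite addr_ge0 ?exprn_ge0 // ltW.
apply: le_trans (ler_wpM2l M0 (ltW tS)) _.
by rewrite -mulrA ler_wpM2l ?addr_ge0 ?mulr_ge0 // mulrDl exprSr [S * _]mulrC.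
Qed.

(** What the trajectory analysis uses of a controlled path: [v] is the primitive
    of the control, and [m] a common modulus for time and control. *)
Record driven (T rho : R) (v m : R -> R) (x : R -> 'rV[R]_d) : Prop := Driven {
  dr_x0 : x 0 = 0;
  dr_v0 : v 0 = 0;
  dr_v : forall s, 0 <= s <= T -> `|v s| <= rho;
  dr_xc : cont_on T x;
  dr_mc : cont_on T m;
  dr_vm : forall s s', 0 <= s -> s <= s' -> s' <= T -> `|v s' - v s| <= m s' - m s;
  dr_m : forall s s', 0 <= s -> s <= s' -> s' <= T -> s' - s <= m s' - m s;
  dr_step : forall s, 0 <= s <= T -> `|x s| <= r / 4 -> forall e, 0 < e ->
    exists2 del, 0 < del & forall s', s <= s' <= s + del -> s' <= T ->
    `|x s' - x s - (s' - s) *: f0 (x s) - (v s' - v s) *: F (x s)| <= e * (m s' - m s)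
}.

Section Driven.
Variables (C' s1 h1 : R).
Hypotheses (C'0 : 0 <= C') (s10 : 0 < s1) (h10 : 0 < h1).
Hypothesis pb_est : forall s x h, `|s| <= s1 -> `|x| <= r / 4 -> 0 <= h <= h1 ->
    `|Phi (- s) (x + h *: f0 x) - Phi (- s) x - h *: pb s (Phi (- s) x)| <=
      C' * (h * (`|s| + `|Phi (- s) x|) ^+ n.+1 + h ^+ 2).
Variables (T rho : R) (v m : R -> R) (x : R -> 'rV[R]_d).
Hypothesis dr : driven T rho v m x.
Hypotheses (rho0 : 0 <= rho) (rho_s1 : rho <= s1) (rhoA : 4 * rho < A).

Let y s := Phi (- v s) (x s).

Let m_le s s' : 0 <= s -> s <= s' -> s' <= T -> 0 <= m s' - m s.
Proof.
move=> a b c; apply: le_trans (normr_ge0 _) (dr_vm dr a b c).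
Qed.

Let in_le s s' : 0 <= s -> s <= s' -> s' <= T -> (0 <= s <= T) * (0 <= s' <= T).
Proof. by move=> a b c; rewrite a c (le_trans b c) (le_trans a b). Qed.

Lemma driven_v_cont : cont_on T v.
Proof.
move=> s sT e e0; have [del del0 H] := dr_mc dr sT e0; exists del => // s' s'T ss'.
have [s0 sT'] := andP sT; have [s'0 s'T'] := andP s'T.
have [ab|/ltW ba] := leP s s'.
  by apply: le_trans (dr_vm dr s0 ab s'T') (le_trans (ler_norm _) (H s' s'T ss')).
rewrite distrC; apply: le_trans (dr_vm dr s'0 ba sT') (le_trans (ler_norm _) _).
by rewrite distrC; exact: H.
Qed.

Lemma driven_y_dist s s' : 0 <= s <= T -> 0 <= s' <= T ->
  `|y s' - y s| <= C * `|v s' - v s| + 2 * `|x s' - x s|.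
Proof.
move=> sT s'T.
have vA : `|- v s| < A by rewrite normrN; have := dr_v dr sT; have := rho0; have := rhoA; lra.
have -> : y s' - y s = (Phi (- v s') (x s') - Phi (- v s) (x s')) +
  (Phi (- v s) (x s') - Phi (- v s) (x s)) by rewrite addrA subrK.
apply: le_trans (ler_normD _ _) _; apply: lerD.
  apply: le_trans (flow_lip_time C0 C0 A0 CA F_bounded F_lip _ _ _) _.
  by rewrite -opprD normrN.
exact: flow_lip_state.
Qed.

Lemma driven_y_cont : cont_on T y.
Proof.
move=> s sT e e0.
have C10 : 0 < C + 2 by have := C0; lra.
have k0 : 0 < e / (C + 2) by rewrite divr_gt0.
have [d1 d10 H1] := driven_v_cont sT k0; have [d2 d20 H2] := dr_xc dr sT k0.
exists (Num.min d1 d2) => [|s' s'T]; first by rewrite lt_min d10.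
rewrite le_min => /andP[/(H1 _ s'T) h3 /(H2 _ s'T) h4].
apply: le_trans (driven_y_dist sT s'T) _.
have -> : e = C * (e / (C + 2)) + 2 * (e / (C + 2)) by field; rewrite gt_eqF.
by apply: lerD; apply: ler_wpM2l.
Qed.

(** Local form of [y' = pullback (v s) (y s)]. A step of the system moves the state by
    [(s' - s) * f0] and then along the flow by [v s' - v s], up to the error [k * M]. The
    pull-back at the new value of [v] undoes the second motion, and the first one is what
    [pb_est] describes. *)
Lemma driven_near s (e1 : R) : 0 <= s <= T -> `|x s| <= r / 4 -> 0 < e1 ->
  exists2 del, 0 < del & forall s', s <= s' <= s + del -> s' <= T ->
  `|y s' - y s - (s' - s) *: pb (v s) (y s)| <=
    C' * ((s' - s) * (`|v s| + `|y s|) ^+ n.+1) + e1 * (m s' - m s).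
Proof.
move=> sT xr e10; pose L := 2 * (2 * C ^+ 2 + C + 1) + C' + 1.
have L0 : 0 < L.
  by rewrite /L addr_gt0 // ltr_wpDr // mulr_gt0 // ltr_wpDl // addr_ge0 // mulr_ge0 // exprn_ge0.
pose k := e1 / L; have k0 : 0 < k by rewrite divr_gt0.
have [d1 d10 H1] := dr_step dr sT xr k0.
have [d2 d20 H2] := dr_xc dr sT k0.
have [d3 d30 H3] := driven_v_cont sT k0.
exists (Num.min (Num.min d1 d2) (Num.min d3 (Num.min k h1))).
  by rewrite !lt_min d10 d20 d30 k0 h10.
move=> s' /andP[ss']; rewrite -lerBlDl !le_min => /andP[/andP[hd1 hd2] /and3P[hd3 hdk hdh]] s'T.
have [s0 _] := andP sT; have [_ s'T2] := in_le s0 ss' s'T.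
have h0 : 0 <= s' - s by rewrite subr_ge0.
have hn : `|s' - s| = s' - s by rewrite ger0_norm.
have m0 := m_le s0 ss' s'T; have vm := dr_vm dr s0 ss' s'T; have hm := dr_m dr s0 ss' s'T.
have {H1}H1 := H1 s' _ s'T; have {}H1 := H1 _; rewrite ss' -lerBlDl hd1 in H1.
have {H1}H1 := H1 isT.
have {}H2 := H2 s' s'T2 (_ : `|s' - s| <= d2); rewrite hn in H2; have {H2}H2 := H2 hd2.
have {}H3 := H3 s' s'T2 (_ : `|s' - s| <= d3); rewrite hn in H3; have {H3}H3 := H3 hd3.
have vs := dr_v dr sT; have vs' := dr_v dr s'T2.
pose dv := v s' - v s; pose h := s' - s; pose M := m s' - m s.
have dvA : `|- dv| < A.
  rewrite normrN; apply: le_lt_trans (ler_normB _ _) _; have := rho0; have := rhoA; lra.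
have vA : `|- v s| < A by rewrite normrN; have := rho0; have := rhoA; lra.
have y'E : y s' = Phi (- v s) (Phi (- dv) (x s')).
  rewrite flow_add; first by rewrite /dv /y; congr (Phi _ _); ring.
  rewrite !normrN; have := ler_normB (v s') (v s); rewrite -/dv.
  by have := rho0; have := rhoA; move: vs vs'; lra.
pose z := x s + h *: f0 (x s).
have zdist : `|Phi (- dv) (x s') - z| <= (2 * C ^+ 2 + C + 1) * (k * M).
  have E1 := flow_expansion C0 C0 A0 CA F_bounded F_lip (x s') dvA.
  have -> : Phi (- dv) (x s') - z = (Phi (- dv) (x s') - x s' - (- dv) *: F (x s')) +
     ((x s' - x s - h *: f0 (x s) - dv *: F (x s)) + dv *: (F (x s) - F (x s'))).
    by apply/rowP => i; rewrite !mxE; ring.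
  apply: le_trans (ler_normD _ _) _; rewrite -[2 * C ^+ 2 + C + 1]addrA mulrDl; apply: lerD.
    apply: le_trans E1 _; rewrite normrN -mulrA -expr2 -mulrA ler_wpM2l // ler_wpM2l ?exprn_ge0 //.
    by rewrite expr2; apply: ler_pM.
  apply: le_trans (ler_normD _ _) _; rewrite addrC mulrDl mul1r; apply: lerD => //.
  rewrite normrZ mulrC.
  have Fl : `|F (x s) - F (x s')| <= C * k.
    by apply: le_trans (F_lip _ _) _; rewrite distrC; exact: ler_wpM2l.
  by rewrite mulrA; apply: ler_pM.
have E2 : `|Phi (- v s) (Phi (- dv) (x s')) - Phi (- v s) z| <=
    2 * ((2 * C ^+ 2 + C + 1) * (k * M)).
  by apply: le_trans (flow_lip_state C0 C0 A0 CA F_bounded F_lip _ _ vA) _; exact: ler_wpM2l.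
have hh : 0 <= h <= h1 by rewrite h0.
have E3 := pb_est (le_trans vs rho_s1) xr hh; rewrite -/z -/(y s) in E3.
rewrite y'E.
have -> : Phi (- v s) (Phi (- dv) (x s')) - y s - (s' - s) *: pb (v s) (y s) =
  (Phi (- v s) z - y s - h *: pb (v s) (y s)) +
  (Phi (- v s) (Phi (- dv) (x s')) - Phi (- v s) z).
  by rewrite [RHS]addrC addrA addrA subrK.
apply: le_trans (ler_normD _ _) _; apply: le_trans (lerD E3 E2) _.
rewrite mulrDr -addrA lerD2l.
have hk : h ^+ 2 <= k * M by rewrite expr2; apply: ler_pM.
have := ler_wpM2l C'0 hk => hk'.
have kM : 0 <= k * M by rewrite mulr_ge0 // ltW.
have -> : e1 * M = L * (k * M) by rewrite /k; field; rewrite gt_eqF.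
by rewrite /L; move: hk' kM; move: (k * M) => q; nra.
Qed.

Lemma cont_on_sub (V : normedModType R) (T' : R) (f : R -> V) : T' <= T ->
  cont_on T f -> cont_on T' f.
Proof.
move=> T'T fc s /andP[s0 sT'] e e0.
have [|del del0 H] := fc s _ e e0; first by rewrite s0 (le_trans sT').
by exists del => // s' /andP[s'0 s'T]; apply: H; rewrite s'0 (le_trans s'T).
Qed.

Lemma cont_on_lin c : cont_on T (fun s => c * s).
Proof.
move=> s sT e e0; exists (e / (`|c| + 1)) => [|s' s'T ss'].
  by rewrite divr_gt0 // ltr_wpDl.
rewrite -mulrBr normrM mulrC; apply: le_trans (_ : `|s' - s| * (`|c| + 1) <= _).
  by rewrite ler_wpM2l // lerDl.
by rewrite -ler_pdivlMr // ltr_wpDl.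
Qed.

Variable C5 : R.
Hypothesis C50 : 0 <= C5.
Hypothesis HC5 : forall (s : R) (y : 'rV[R]_d), `|s| <= 1 -> `|y| <= 1 -> `|pb s y| <= C5.
Hypotheses (rho_half : rho <= 1 / 2) (rho_r : C * rho <= r / 16) (T_r : (C5 + C') * T <= r / 16).

Let xy_dist s : 0 <= s <= T -> `|y s - x s| <= r / 16.
Proof.
move=> sT; have := flow_dist C0 C0 A0 CA F_bounded F_lip (x s) (- v s).
by rewrite normrN; have := ler_wpM2l C0 (dr_v dr sT); have := rho_r; rewrite -/(y s); lra.
Qed.

Let y_le1 s : 0 <= s <= T -> `|x s| <= r / 4 -> `|y s| <= 1 / 2.
Proof.
move=> sT xr; have := ler_normD (y s - x s) (x s); rewrite subrK.
by have := xy_dist sT; have := r1; have := r0; lra.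
Qed.

Let vy_pow s : 0 <= s <= T -> `|x s| <= r / 4 -> (`|v s| + `|y s|) ^+ n.+1 <= 1.
Proof.
move=> sT xr; rewrite exprn_ile1 ?addr_ge0 //.
by have := y_le1 sT xr; have := dr_v dr sT; have := rho_half; lra.
Qed.

Let pb_bounded s : 0 <= s <= T -> `|x s| <= r / 4 -> `|pb (v s) (y s)| <= C5.
Proof.
move=> sT xr; apply: HC5; have := y_le1 sT xr; have := dr_v dr sT; have := rho_half; lra.
Qed.

Let y_start : y 0 = 0.
Proof.
rewrite /y (dr_v0 dr) (dr_x0 dr) oppr0; exact: flow0.
Qed.

Let y_growth t : 0 <= t <= T -> (forall s, 0 <= s <= t -> `|x s| <= r / 4) ->
  `|y t| <= (C5 + C') * t.
Proof.
move=> tT xr; have [t0 tT'] := andP tT.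
have CC : 0 <= C5 + C' by rewrite addr_ge0.
have tt : 0 <= t <= t by rewrite t0 lexx.
apply: norm_le_coord => [|i]; first exact: mulr_ge0.
have := @sum_increments R t (fun s => y s 0 i) (fun s => (C5 + C') * s) m _ _ _ _ t tt.
rewrite y_start mulr0 subr0 mxE subr0; apply.
- move=> s st e e0; have [del del0 H] := cont_on_sub tT' driven_y_cont st e0.
  exists del => // s' s't ss'; apply: le_trans (rV_diff_coord _ _ i) _; exact: H.
- exact: (cont_on_sub tT' (cont_on_lin _)).
- exact: (cont_on_sub tT' (dr_mc dr)).
move=> s st e e0; have [s0 st'] := andP st.
have sT : 0 <= s <= T by rewrite s0 (le_trans st').
have [del del0 H] := driven_near sT (xr s st) e0; exists del => // s' ss' s't.
have := H s' ss' (le_trans s't tT') => {}H; have [ss'' _] := andP ss'.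
have h0 : 0 <= s' - s by rewrite subr_ge0.
apply: le_trans (rV_diff_coord _ _ i) _; rewrite -mulrBr.
have := ler_normD (y s' - y s - (s' - s) *: pb (v s) (y s)) ((s' - s) *: pb (v s) (y s)).
rewrite subrK normrZ (ger0_norm h0) => /le_trans; apply.
have k1 := ler_wpM2l h0 (pb_bounded sT (xr s st)).
have k2 := ler_wpM2l C'0 (ler_wpM2l h0 (vy_pow sT (xr s st))).
rewrite mulr1 in k2; rewrite [(C5 + C') * _]mulrDl [C5 * _]mulrC.
by move: H k1 k2; move: (_ * (m s' - m s)) => q; lra.
Qed.

(** Bootstrap: as long as [x] stays in the ball of radius [r / 4], the equation of [y] gives
    [|y t| <= (C5 + C') * t], hence [|x t| <= r / 8], so that the ball is never left.
    Gronwall's inequality in [x] would be of no help, the variation of [v] being unbounded. *)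
Lemma driven_x_small s : 0 <= s <= T -> `|x s| <= r / 4.
Proof.
have key t : 0 <= t <= T -> (forall s, 0 <= s <= t -> `|x s| <= r / 4) -> `|x t| <= r / 8.
  move=> tT xr; have := y_growth tT xr; have [t0 tT'] := andP tT.
  have : (C5 + C') * t <= (C5 + C') * T by rewrite ler_wpM2l // addr_ge0.
  have := ler_normD (x t - y t) (y t); rewrite subrK distrC.
  by have := xy_dist tT; have := T_r; lra.
move=> sT; have [s0 _] := andP sT.
suff H : forall t, 0 <= t <= T -> forall s, 0 <= s <= t -> `|x s| <= r / 4.
  by apply: (H s sT); rewrite s0 lexx.
have r8 : 0 < r / 8 by rewrite divr_gt0.
apply: real_induction => [t /andP[t0 t0']|t tT xr|t /andP[t0 tT] IH t'].
- have -> : t = 0 by apply/eqP; rewrite eq_le t0' t0.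
  by rewrite (dr_x0 dr) normr0 divr_ge0 // ltW.
- have [del del0 H] := dr_xc dr tT r8; exists del => // t' /andP[tt' t'd] t'T w /andP[w0 wt'].
  have [wt|/ltW tw] := leP w t; first by apply: xr; rewrite w0.
  have := H w; rewrite w0 (le_trans wt') // ger0_norm ?subr_ge0 // lerBlDl (le_trans wt') //.
  move=> /(_ isT isT) h; have := ler_normD (x w - x t) (x t); rewrite subrK.
  by have := key t tT xr; lra.
move=> /andP[t'0]; rewrite le_eqVlt => /predU1P[->|t't]; last first.
  by apply: (IH t'); rewrite ?t'0 ?lexx.
have tT' : 0 <= t <= T by rewrite ltW.
have [del del0 H] := dr_xc dr tT' r8.
pose w := Num.max 0 (t - del).
have w0 : 0 <= w by rewrite le_max lexx.
have wt : w < t by rewrite gt_max t0 ltrBlDr ltrDl.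
have wT : 0 <= w <= T by rewrite w0 (le_trans (ltW wt)).
have wd : `|w - t| <= del.
  by rewrite distrC ger0_norm ?subr_ge0 ?(ltW wt) // lerBlDr -lerBlDl le_max lexx orbT.
have := H w wT wd; have w01 : 0 <= w < t by rewrite w0.
have := key w wT (IH w w01); have := ler_normB (x w) (x w - x t); rewrite subKr; lra.
Qed.

Lemma driven_y_small s : 0 <= s <= T -> `|y s| <= 1 / 2.
Proof. by move=> sT; exact: (y_le1 sT (driven_x_small sT)). Qed.

(** First-order expansion of [p]; the quadratic remainder is at most [P2 * (L * M) ^+ 2], and
    [M] tends to 0 by continuity of [m]. *)
Lemma driven_fun_near p P2 D s (e : R) : 0 <= P2 -> 0 <= D ->
  (forall a b : 'rV[R]_d, `|a| <= 1 -> `|b| <= 1 ->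
    `|evp p a - evp p b - dirder (a - b) p b| <= P2 * `|a - b| ^+ 2) ->
  (forall a w : 'rV[R]_d, `|a| <= 1 -> `|dirder w p a| <= D * `|w|) ->
  0 <= s <= T -> 0 < e ->
  exists2 del, 0 < del & forall s', s <= s' <= s + del -> s' <= T ->
  `|evp p (y s') - evp p (y s) - (s' - s) * drift n G0 G1 p (v s) (y s)| <=
    D * C' * ((s' - s) * (`|v s| + `|y s|) ^+ n.+1) + e * (m s' - m s).
Proof.
move=> P20 D0 HP HD sT e0; have xr := driven_x_small sT.
pose L := C5 + C' + 1; have L0 : 0 <= L by rewrite !addr_ge0.
pose k1 := Num.min 1 (e / 2 / (D + 1)).
have k10 : 0 < k1 by rewrite lt_min ltr01 !divr_gt0 // ltr_wpDl.
pose k2 := e / 2 / (P2 * L ^+ 2 + 1).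
have PL0 : 0 <= P2 * L ^+ 2 by rewrite mulr_ge0 // exprn_ge0.
have k20 : 0 < k2 by rewrite !divr_gt0 // ltr_wpDl.
have [d1 d10 H1] := driven_near sT xr k10.
have [d2 d20 H2] := dr_mc dr sT k20.
exists (Num.min d1 d2) => [|s' /andP[ss']]; first by rewrite lt_min d10.
rewrite -lerBlDl le_min => /andP[hd1 hd2] s'T.
have [s0 _] := andP sT; have [_ s'T2] := in_le s0 ss' s'T.
have h0 : 0 <= s' - s by rewrite subr_ge0.
have m0 := m_le s0 ss' s'T; have hm := dr_m dr s0 ss' s'T.
have {H1}H1 := H1 s' _ s'T; rewrite ss' -lerBlDl hd1 in H1; have {H1}H1 := H1 isT.
have {H2}H2 := H2 s' s'T2; rewrite (ger0_norm h0) hd2 in H2; have {H2}H2 := H2 isT.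
have {H2}H2 := le_trans (ler_norm _) H2.
pose M := m s' - m s; rewrite -/M in m0 hm H1 H2 *.
set W := (_ + _) ^+ n.+1 in H1 *.
have W1 : W <= 1 := vy_pow sT xr.
have y1 : `|y s| <= 1 by have := driven_y_small sT; lra.
have y1' : `|y s'| <= 1 by have := driven_y_small s'T2; lra.
have CW : C' * ((s' - s) * W) <= C' * M.
  by apply: ler_wpM2l => //; apply: le_trans hm; rewrite ler_piMr.
have k11 : k1 <= 1 by rewrite ge_min lexx.
have ydist : `|y s' - y s| <= L * M.
  have := ler_normD (y s' - y s - (s' - s) *: pb (v s) (y s)) ((s' - s) *: pb (v s) (y s)).
  rewrite subrK normrZ (ger0_norm h0) => /le_trans; apply.
  have q1 := ler_pM h0 (normr_ge0 _) hm (pb_bounded sT xr).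
  have q2 := ler_wpM2r m0 k11.
  have -> : L * M = M * C5 + C' * M + M by rewrite /L; ring.
  by move: H1 q1 q2 CW; lra.
have -> : evp p (y s') - evp p (y s) - (s' - s) * drift n G0 G1 p (v s) (y s) =
  (evp p (y s') - evp p (y s) - dirder (y s' - y s) p (y s)) +
  dirder (y s' - y s - (s' - s) *: pb (v s) (y s)) p (y s).
  by rewrite (dirderDv (y s' - y s)) dirderNv dirderZv dirder_pullback; ring.
apply: le_trans (ler_normD _ _) _; apply: le_trans (lerD (HP _ _ y1' y1) (HD _ _ y1)) _.
have e1 : P2 * `|y s' - y s| ^+ 2 <= e / 2 * M.
  apply: (@le_trans _ _ (P2 * (L * M) ^+ 2)).
    by rewrite ler_wpM2l // lerXn2r ?nnegrE // mulr_ge0.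
  rewrite exprMn mulrA expr2 mulrA; apply: ler_wpM2r => //.
  apply: (@le_trans _ _ (P2 * L ^+ 2 * k2)); first exact: ler_wpM2l.
  rewrite /k2 mulrA ler_pdivrMr ?ltr_wpDl // mulrC ler_wpM2l ?lerDl //.
  by rewrite divr_ge0 // ltW.
have e2 : D * k1 <= e / 2.
  apply: (@le_trans _ _ ((D + 1) * k1)); first by rewrite ler_wpM2r ?lerDl // ltW.
  by rewrite mulrC -ler_pdivlMr ?ltr_wpDl // ge_min lexx orbT.
have e3 := ler_wpM2r m0 e2; have e4 := ler_wpM2l D0 H1.
rewrite mulrDr !mulrA in e4; rewrite !mulrA in e3 *.
by move: e1 e3 e4; lra.
Qed.

Variable I : R -> R.
Hypotheses (I0 : I 0 = 0) (Ic : cont_on T I).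
Hypothesis I_mono : forall s s', 0 <= s -> s <= s' -> s' <= T -> I s <= I s'.
Hypothesis I_near : forall s, 0 <= s <= T -> forall e, 0 < e ->
  exists2 del, 0 < del & forall s', s <= s' <= s + del -> s' <= T ->
  `|I s' - I s - (s' - s) * `|v s| ^+ n| <= e * (s' - s).

(** Increments are added up by [sum_increments]; the errors of [p] and of [I] are all
    small multiples of the increment of [m]. *)
Lemma driven_incr p P2 D kap al be : 0 <= P2 -> 0 <= D ->
  (forall a b : 'rV[R]_d, `|a| <= 1 -> `|b| <= 1 ->
    `|evp p a - evp p b - dirder (a - b) p b| <= P2 * `|a - b| ^+ 2) ->
  (forall a w : 'rV[R]_d, `|a| <= 1 -> `|dirder w p a| <= D * `|w|) ->
  0 <= al -> 0 <= be ->
  (forall s, 0 <= s <= T ->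
     `|drift n G0 G1 p (v s) (y s) - kap * `|v s| ^+ n| +
       D * C' * (`|v s| + `|y s|) ^+ n.+1 <= al * `|v s| ^+ n + be) ->
  forall s, 0 <= s <= T -> `|evp p (y s) - evp p 0 - kap * I s| <= al * I s + be * s.
Proof.
move=> P20 D0 HP HD al0 be0 H s sT.
have [c c0 Hc] := evp_lipschitz p.
have cD (f g : R -> R) : cont_on T f -> cont_on T g -> forall a b, cont_on T (fun s => a * f s + b * g s).
  move=> fc gc a b t tT e e0.
  have q0 : 0 < `|a| + `|b| + 1 by rewrite ltr_wpDl // addr_ge0.
  have k0 : 0 < e / (`|a| + `|b| + 1) by rewrite divr_gt0.
  have [d1 d10 H1] := fc t tT _ k0; have [d2 d20 H2] := gc t tT _ k0.
  exists (Num.min d1 d2) => [|t' t'T]; first by rewrite lt_min d10.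
  rewrite le_min => /andP[/(H1 _ t'T) h1' /(H2 _ t'T) h2'].
  have -> : a * f t' + b * g t' - (a * f t + b * g t) = a * (f t' - f t) + b * (g t' - g t) by ring.
  apply: le_trans (ler_normD _ _) _; rewrite !normrM.
  have k1 := ler_wpM2l (normr_ge0 a) h1'; have k2 := ler_wpM2l (normr_ge0 b) h2'.
  have : (`|a| + `|b| + 1) * (e / (`|a| + `|b| + 1)) = e by field; rewrite gt_eqF.
  by rewrite !mulrDl mul1r; move: k1 k2 k0; lra.
have pc : cont_on T (fun s => evp p (y s)).
  move=> t tT e e0; have k0 : 0 < e / (c + 1) by rewrite divr_gt0 // ltr_wpDl.
  have [del del0 Hd] := driven_y_cont tT k0; exists del => // t' t'T tt'.
  have y1 w : 0 <= w <= T -> `|y w| <= 1 by move=> /driven_y_small; lra.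
  apply: le_trans (Hc _ _ (y1 _ t'T) (y1 _ tT)) _.
  apply: le_trans (ler_wpM2l c0 (Hd _ t'T tt')) _.
  by rewrite mulrA ler_pdivrMr ?ltr_wpDl // mulrC ler_wpM2l ?lerDl // ltW.
have lin1 := @cont_on_lin 1.
have := @sum_increments R T (fun s => 1 * evp p (y s) + (- kap) * I s)
  (fun s => al * I s + be * (1 * s)) m (cD _ _ pc Ic 1 (- kap)) (cD _ _ Ic lin1 al be)
  (dr_mc dr) _ s sT.
rewrite y_start I0 !mulr0 !addr0 subr0 !mul1r.
have -> : evp p (y s) + - kap * I s - evp p 0 = evp p (y s) - evp p 0 - kap * I s by ring.
apply=> {s sT} s sT e e0; pose k := e / 2 / (`|kap| + al + 1).
have q0 : 0 < `|kap| + al + 1 by rewrite ltr_wpDl // addr_ge0.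
have k0 : 0 < k by rewrite !divr_gt0.
have e20 : 0 < e / 2 by rewrite divr_gt0.
have [d1 d10 H1] := driven_fun_near P20 D0 HP HD sT e20.
have [d2 d20 H2] := I_near sT k0.
exists (Num.min d1 d2) => [|s' /andP[ss']]; first by rewrite lt_min d10.
rewrite -lerBlDl le_min => /andP[hd1 hd2] s'T; have [s0 _] := andP sT.
have h0 : 0 <= s' - s by rewrite subr_ge0.
have m0 := m_le s0 ss' s'T; have hm := dr_m dr s0 ss' s'T.
have {H1}H1 := H1 s' _ s'T; rewrite ss' -lerBlDl hd1 in H1; have {H1}H1 := H1 isT.
have {H2}H2 := H2 s' _ s'T; rewrite ss' -lerBlDl hd2 in H2; have {H2}H2 := H2 isT.
have H3 := ler_wpM2l h0 (H s sT).
set h := s' - s in h0 hm H1 H2 H3 *; set M := m s' - m s in m0 hm H1 *.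
set V := `|v s| ^+ n in H2 H3 *; set W := (_ + _) ^+ n.+1 in H1 H3.
set dft := drift _ _ _ _ _ _ in H1 H3.
have -> : 1 * evp p (y s') + - kap * I s' - (1 * evp p (y s) + - kap * I s) =
  (evp p (y s') - evp p (y s) - h * dft) + (h * (dft - kap * V) - kap * (I s' - I s - h * V)) by ring.
have -> : al * I s' + be * (1 * s') - (al * I s + be * (1 * s)) =
  al * (I s' - I s - h * V) + al * (h * V) + be * h by rewrite /h; ring.
set J := I s' - I s - h * V in H2 *.
apply: le_trans (ler_normD _ _) _.
apply: le_trans (lerD H1 (ler_normB _ _)) _.
rewrite !normrM (ger0_norm h0).
have J1 : - (al * (k * h)) <= al * J.
  by rewrite -mulrN ler_wpM2l //; move: H2; rewrite ler_norml => /andP[].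
have J2 := ler_wpM2l (normr_ge0 kap) H2.
have J3 : (`|kap| + al + 1) * (k * h) <= e / 2 * M.
  have -> : (`|kap| + al + 1) * (k * h) = e / 2 * h by rewrite /k; field; rewrite gt_eqF.
  by rewrite ler_wpM2l // ltW.
have kh : 0 <= k * h by rewrite mulr_ge0 // ltW.
have J4 : (`|kap| + al + 1) * (k * h) = `|kap| * (k * h) + al * (k * h) + k * h by ring.
have J5 : h * (`|dft - kap * V| + D * C' * W) = h * `|dft - kap * V| + D * C' * (h * W) by ring.
have J6 : h * (al * V + be) = al * (h * V) + be * h by ring.
rewrite J4 in J3; rewrite J5 J6 in H3.
by move: H3 J1 J2 J3 kh; lra.
Qed.

Lemma driven_reduced (K : mpoly d R -> R) : T <= 1 -> 0 <= T ->
  (forall p, exists P2 D, [/\ 0 <= P2, 0 <= D, D * C' <= K p,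
    forall a b : 'rV[R]_d, `|a| <= 1 -> `|b| <= 1 ->
    `|evp p a - evp p b - dirder (a - b) p b| <= P2 * `|a - b| ^+ 2 &
  forall a w : 'rV[R]_d, `|a| <= 1 -> `|dirder w p a| <= D * `|w|]) ->
  reduced n G0 G1 K T v y I.
Proof.
move=> T1 T0 HK; split => //.
- by rewrite T0.
- by move=> s sT; have := dr_v dr sT; have := rho_half; lra.
- by move=> s sT; have := driven_y_small sT; lra.
- by move=> s /andP[s0 sT]; rewrite -{1}I0 !I_mono.
move=> p kap al be al0 be0 H s sT; have [P2 [D [P20 D0 DK HP HD]]] := HK p.
apply: (driven_incr P20 D0 HP HD al0 be0 _ sT) => w wT.
apply: le_trans (H w wT); rewrite lerD2l ler_wpM2r ?exprn_ge0 // addr_ge0 //.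
Qed.

Lemma driven_endpoint (t : R) : 0 <= t <= T -> Phi (v t) (y t) = x t /\ `|y t| <= r / 2.
Proof.
move=> tT; split.
  rewrite flow_add ?normrN ?addrN ?flow0 //.
  by have := dr_v dr tT; have := rho0; have := rhoA; lra.
have := ler_normD (y t - x t) (x t); rewrite subrK.
by have := xy_dist tT; have := driven_x_small tT; have := r0; lra.
Qed.

End Driven.

(** The bound on [v T] comes from [x = Phi(v, y)]: to first order the flow displaces [y] by
    [v *: F 0], and [F 0] is not zero. *)
Theorem reduced_of_driven : F 0 != 0 -> exists (K : mpoly d R -> R) rho1 T1 B,
  [/\ forall p, 0 <= K p, 0 < rho1, 0 < T1, 0 <= B &
  forall T rho v m x, driven T rho v m x -> 0 <= T <= T1 -> 0 <= rho <= rho1 ->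
  exists y I, [/\ reduced n G0 G1 K T v y I, `|x T| <= 1,
    `|v T| <= B * (`|x T| + `|y T|) &
    forall p, `|flow_error n G1 (x T) (y T) (v T) p| <=
      K p * (`|v T| ^+ n + `|v T| * (`|v T| + `|y T|) ^+ n)]].
Proof.
move=> F0_neq0; have F0_gt0 : 0 < `|F 0| by rewrite normr_gt0.
have [C' [s1 [h1 [C'0 s10 h10 pb_est]]]] := pullback_step_estimate.
have [C5 C50 HC5] := pullback_bounded n G0 G1.
have [p|PD HPD] := @choice _ _ (fun (p : mpoly d R) (PD : R * R) => [/\ 0 <= PD.1, 0 <= PD.2,
    forall a b : 'rV[R]_d, `|a| <= 1 -> `|b| <= 1 ->
    `|evp p a - evp p b - dirder (a - b) p b| <= PD.1 * `|a - b| ^+ 2 &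
    forall a w : 'rV[R]_d, `|a| <= 1 -> `|dirder w p a| <= PD.2 * `|w|]).
  have [P2 P20 HP] := evp_taylor2 p; have [D D0 HD] := dirder_le p.
  by exists (P2, D); split=> // a w; exact: HD.
have [p|K2 HK2] := @choice _ _ (fun (p : mpoly d R) (K : R) => 0 <= K /\
  forall y a, `|y| <= r / 2 ->
  2 * `|a| <= 1 -> 2 * `|a| <= A -> C * (2 * `|a|) <= r / 2 ->
  `|flow_error n G1 (Phi a y) y a p| <= K * (`|a| ^+ n + `|a| * (`|a| + `|y|) ^+ n)).
  by have [K K0 HK] := flow_error_bound p; exists K.
have [|rho1 rho10 Hrho] := @choose_small R [:: (1, s1); (4, A / 2); (1, 1 / 2); (C, r / 16);
    (2 * (C * C), `|F 0| / 2)].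
  move=> p; rewrite !inE => /orP[|/or4P[]] /eqP -> /=; split=> //; rewrite ?divr_gt0 //.
  by rewrite mulr_ge0 // mulr_ge0.
have [|T1 T10 HT] := @choose_small R [:: (1, 1); (C5 + C', r / 16)].
  by move=> p; rewrite !inE => /orP[] /eqP -> /=; split=> //; rewrite ?addr_ge0 ?divr_gt0.
exists (fun p => (PD p).2 * C' + K2 p), rho1, T1, (2 * (1 + C) / `|F 0|).
split=> // [p||T rho v m x dr /andP[T0 TT1] /andP[rho0 rho_le]].
- by have [_ D0 _ _] := HPD p; have [K20 _] := HK2 p; rewrite addr_ge0 // mulr_ge0.
- by rewrite divr_ge0 // mulr_ge0 // addr_ge0.
have k1 : rho * 1 <= s1 by apply: (Hrho (1, s1)) rho_le; rewrite !inE eqxx ?orbT.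
have k2 : rho * 4 <= A / 2 by apply: (Hrho (4, A / 2)) rho_le; rewrite !inE eqxx ?orbT.
have k3 : rho * 1 <= 1 / 2 by apply: (Hrho (1, 1 / 2)) rho_le; rewrite !inE eqxx ?orbT.
have k4 : rho * C <= r / 16 by apply: (Hrho (C, r / 16)) rho_le; rewrite !inE eqxx ?orbT.
have k5 : rho * (2 * (C * C)) <= `|F 0| / 2.
  by apply: (Hrho (2 * (C * C), `|F 0| / 2)) rho_le; rewrite !inE eqxx ?orbT.
have k6 : T * 1 <= 1 by apply: (HT (1, 1)) TT1; rewrite !inE eqxx ?orbT.
have k7 : T * (C5 + C') <= r / 16 by apply: (HT (C5 + C', r / 16)) TT1; rewrite !inE eqxx ?orbT.
rewrite !mulr1 in k1 k3 k6; rewrite mulrC in k4; rewrite mulrC in k7.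
have rhoA : 4 * rho < A by have := A0; rewrite mulrC; lra.
have TT : 0 <= T <= T by rewrite T0 lexx.
have vc := driven_v_cont dr.
have [I [I0 Ic I_mono I_near]] : exists I : R -> R, [/\ I 0 = 0, cont_on T I,
    forall s s', 0 <= s -> s <= s' -> s' <= T -> I s <= I s' &
    forall s, 0 <= s <= T -> forall e, 0 < e ->
    exists2 del, 0 < del & forall s', s <= s' <= s + del -> s' <= T ->
      `|I s' - I s - (s' - s) * `|v s| ^+ n| <= e * (s' - s)].
  apply: (@antiderivative_on R T (fun s => `|v s| ^+ n) T0).
    exact: (cont_on_comp (@continuous_normX R n) vc).
  by move=> s; exact: exprn_ge0.
have [PhiE y_half] := driven_endpoint C'0 h10 pb_est dr rho0 k1 rhoA C50 HC5 k3 k4 k7 TT.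
set a := v T; set y := fun s => Phi (- v s) (x s); rewrite -/(y T) -/a in PhiE y_half.
have a_rho : `|a| <= rho := dr_v dr TT.
have x_small := driven_x_small C'0 h10 pb_est dr rho0 k1 rhoA C50 HC5 k3 k4 k7 TT.
have Ca := ler_wpM2l C0 a_rho.
exists y, I; split.
- apply: (driven_reduced C'0 h10 pb_est dr rho0 k1 rhoA C50 HC5 k3 k4 k7 I0 Ic I_mono I_near k6 T0) => p.
  have [P20 D0 HP HD] := HPD p; have [K20 _] := HK2 p.
  by exists (PD p).1, (PD p).2; split=> //; rewrite lerDl.
- by have := x_small; have := r1; have := r0; lra.
- have vA : `|a| < A by have := rho0; lra.
  have := flow_expansion C0 C0 A0 CA F_bounded F_lip (y T) vA; rewrite PhiE => E1.
  have E2 := F_lip (y T) 0; rewrite subr0 in E2.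
  rewrite mulrAC ler_pdivlMr // mulrC.
  have e1 : `|F 0| * `|a| = `|a *: F 0| by rewrite normrZ mulrC.
  have E3 : `|a *: F 0| <= `|x T| + `|y T| + `|a| * (C * `|y T|) + 2 * (C * C) * `|a| ^+ 2.
    have -> : a *: F 0 = x T - y T - a *: (F (y T) - F 0) - (x T - y T - a *: F (y T)).
      by apply/rowP => i; rewrite !mxE; ring.
    apply: le_trans (ler_normB _ _) _; apply: lerD => //.
    apply: le_trans (ler_normB _ _) _; apply: lerD; first exact: ler_normB.
    by rewrite normrZ ler_wpM2l.
  have a1 : `|a| <= 1 by lra.
  have E4 : `|a| * (C * `|y T|) <= C * `|y T| by rewrite ler_piMl // mulr_ge0.
  have E5 : 2 * (C * C) * `|a| ^+ 2 <= `|F 0| / 2 * `|a|.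
    rewrite (_ : _ * _ ^+ 2 = `|a| * (2 * (C * C)) * `|a|); last ring.
    apply: ler_wpM2r => //; apply: le_trans k5.
    by rewrite ler_wpM2r // mulr_ge0 // mulr_ge0.
  have E6 := mulr_ge0 C0 (normr_ge0 (x T)).
  rewrite -e1 in E3 *.
  by move: E3 E4 E5 E6; move: `|F 0| `|a| `|x T| `|y T| => q1 q2 q3 q4; nra.
move=> p; have [K20 H] := HK2 p; have [_ D0 _ _] := HPD p.
have a1 : 2 * `|a| <= 1 by lra.
have a2 : 2 * `|a| <= A by lra.
have a3 : C * (2 * `|a|) <= r / 2.
  by rewrite mulrCA; apply: le_trans (ler_wpM2l _ Ca) _ => //; have := r0; lra.
have := H (y T) a y_half a1 a2 a3; rewrite PhiE => /le_trans; apply.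
apply: ler_wpM2r; last by rewrite lerDr mulr_ge0.
by rewrite addr_ge0 ?exprn_ge0 // mulr_ge0 // exprn_ge0 // addr_ge0.
Qed.

End Trajectory.

(** * Primitives of controls and mild solutions *)

Section Primitives.
Variable R : realType.
Local Notation mu := (@lebesgue_measure R).
Implicit Types (f u : R -> R) (s t : R).

Lemma primitive0 f : primitive f 0 = 0.
Proof. by rewrite /primitive set_itv_ge ?bnd_simp ?ltxx // Rintegral_set0. Qed.

Lemma integrable_sub t s s' f : 0 <= s -> s' <= t ->
  mu.-integrable `]0, t[ (EFin \o f) -> mu.-integrable `]s, s'[ (EFin \o f).
Proof.
move=> s0 s't; apply: integrableS => //.
by apply: subset_itv; rewrite bnd_simp.
Qed.

Lemma primitive_diff t f s s' : mu.-integrable `]0, t[ (EFin \o f) ->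
  0 <= s -> s <= s' -> s' <= t ->
  primitive f s' - primitive f s = \int[mu]_(r in `]s, s'[) f r.
Proof.
move=> fi s0; rewrite le_eqVlt => /predU1P[<- _|ss' s't].
  by rewrite subrr set_itv_ge ?bnd_simp ?ltxx // Rintegral_set0.
have fi' : mu.-integrable `]0, s'[ (EFin \o f) by exact: integrable_sub fi.
rewrite -(Rintegral_itvB (a := BRight 0) fi') ?bnd_simp // /primitive; congr (_ - _).
by apply: Rintegral_itv_bndo_bndc; apply: integrable_sub fi => //; apply: le_trans s't; exact: ltW.
Qed.

Lemma within_cont_on (V : normedModType R) (T : R) (f : R -> V) :
  {within `[0, T], continuous f} -> cont_on T f.
Proof.
move=> fc s sT e e0.
have inT : `[0, T]%classic s by rewrite /= in_itv.
move: fc => /subspace_continuousP/(_ s inT)/cvgrPdist_le/(_ e e0).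
rewrite /prop_near1 /within /= => -[del /= del0 H]; exists (del / 2); first by rewrite divr_gt0.
move=> s' s'T ss'; rewrite distrC; apply: H; rewrite ?in_itv //= /ball_ distrC.
by apply: le_lt_trans ss' _; lra.
Qed.

Lemma primitive_cont t f : 0 < t -> mu.-integrable `]0, t[ (EFin \o f) ->
  cont_on t (primitive f).
Proof.
move=> t0 fi; pose g := f \_ `]0, t[.
have gi : mu.-integrable `[0, t] (EFin \o g).
  rewrite -restrict_EFin; apply/integrable_restrict => //.
  by rewrite setIC setIidl //; apply: subset_itv; rewrite bnd_simp.
have := parameterized_integral_continuous (ltW t0) gi.
move=> /within_cont_on H s st e e0; have [del del0 Hd] := H s st e e0.
have E w : 0 <= w <= t -> primitive f w = parameterized_integral mu 0 w g.
  move=> /andP[w0 wt]; rewrite /parameterized_integral -Rintegral_itv_obnd_cbnd; last first.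
    by apply: integrableS gi => //; apply: subset_itv; rewrite bnd_simp.
  rewrite -Rintegral_itv_bndo_bndc; last first.
    by apply: integrableS gi => //; apply: subset_itv; rewrite bnd_simp.
  apply: eq_Rintegral => q; rewrite inE /= in_itv /= => /andP[q0 qw].
  by rewrite /g patchE ifT // inE /= in_itv /= q0 (lt_le_trans qw).
by exists del => // s' s't ss'; rewrite !E //; exact: Hd.
Qed.

(** Over [s, s'] the integrand differs from [a0 + u * b0] by at most [e * (1 + |u|)]. *)
Lemma increment_bound (a b u : R -> R) (t s s' e a0 b0 : R) :
  mu.-integrable `]0, t[ (EFin \o u) ->
  mu.-integrable `]0, t[ (EFin \o (fun r => a r + u r * b r)) ->
  0 <= s -> s <= s' -> s' <= t ->
  (forall r, s < r < s' -> `|a r - a0| <= e /\ `|b r - b0| <= e) ->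
  `|primitive (fun r => a r + u r * b r) s' - primitive (fun r => a r + u r * b r) s
     - (s' - s) * a0 - (primitive u s' - primitive u s) * b0| <=
  e * (s' + primitive (fun r => `|u r|) s' - (s + primitive (fun r => `|u r|) s)).
Proof.
move=> ui gi s0 ss' s't ab.
have ni : mu.-integrable `]0, t[ (EFin \o (fun r => `|u r|)) by exact: integrable_norm.
have mS : measurable (`]s, s'[%classic : set (measurableTypeR R)) by [].
have fS : (mu `]s, s'[%classic < +oo)%E.
  by rewrite lebesgue_measure_itv /=; case: ifPn => // _; rewrite -EFinB ltry.
have ci (c : R) : mu.-integrable `]s, s'[ (EFin \o cst c).
  by apply: measurable_bounded_integrable => //; exact: bounded_cst.
have len (c : R) : \int[mu]_(r in `]s, s'[) c = (s' - s) * c.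
  rewrite Rintegral_cst //= mulrC; congr (_ * _).
  have -> : mu `]s, s'[%classic = (if (s < s')%R then (s' - s)%:E else 0%E).
    by rewrite lebesgue_measure_itv.
  move: ss'; rewrite le_eqVlt => /predU1P[->|ss']; first by rewrite ltxx subrr.
  by rewrite ss'.
have uS : mu.-integrable `]s, s'[ (EFin \o u) := integrable_sub s0 s't ui.
have gS := integrable_sub s0 s't gi; have nS := integrable_sub s0 s't ni.
have dE (q q' : R) : s' + q' - (s + q) = (s' - s) + (q' - q) by ring.
rewrite dE (primitive_diff ui s0 ss' s't) (primitive_diff gi s0 ss' s't) (primitive_diff ni s0 ss' s't).
have ubS : mu.-integrable `]s, s'[ (EFin \o (fun r => u r * b0)).
  by apply: (@eq_integrable _ _ _ mu _ mS _ _ _ (integrableZl mS b0 uS)) => r _; rewrite /= EFinM muleC.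
have gcS : mu.-integrable `]s, s'[ (EFin \o (fun r => a r + u r * b r - a0)).
  by apply: (@eq_integrable _ _ _ mu _ mS _ _ _ (integrableB mS gS (ci a0))) => r _; rewrite /= EFinB.
have allS : mu.-integrable `]s, s'[ (EFin \o (fun r => a r + u r * b r - a0 - u r * b0)).
  by apply: (@eq_integrable _ _ _ mu _ mS _ _ _ (integrableB mS gcS ubS)) => r _; rewrite /= EFinB.
have enS : mu.-integrable `]s, s'[ (EFin \o (fun r => e * `|u r|)).
  by apply: (@eq_integrable _ _ _ mu _ mS _ _ _ (integrableZl mS e nS)) => r _; rewrite /= EFinM.
have nnS : mu.-integrable `]s, s'[ (EFin \o (fun r => e + e * `|u r|)).
  by apply: (@eq_integrable _ _ _ mu _ mS _ _ _ (integrableD mS (ci e) enS)) => r _; rewrite /= EFinD.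
have -> : \int[mu]_(r in `]s, s'[) (a r + u r * b r) - (s' - s) * a0 -
    (\int[mu]_(r in `]s, s'[) u r) * b0 =
    \int[mu]_(r in `]s, s'[) (a r + u r * b r - a0 - u r * b0).
  by rewrite (RintegralB mS gcS ubS) (RintegralB mS gS (ci a0)) (RintegralZr b0 mS uS) len.
apply: le_trans (le_normr_Rintegral mS allS) _.
have -> : e * (s' - s + \int[mu]_(r in `]s, s'[) `|u r|) =
    \int[mu]_(r in `]s, s'[) (e + e * `|u r|).
  by rewrite (RintegralD mS (ci e) enS) (RintegralZl e mS nS) len; ring.
apply: le_Rintegral => //; first exact: integrable_norm.
move=> r /=; rewrite in_itv /= => /ab[ar br].
have -> : a r + u r * b r - a0 - u r * b0 = (a r - a0) + u r * (b r - b0) by ring.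
apply: le_trans (ler_normD _ _) _; apply: lerD => //.
by rewrite normrM mulrC ler_wpM2r.
Qed.

End Primitives.

Section Mild.
Variables (R : realType) (d : nat).
Local Notation mu := (@lebesgue_measure R).

Lemma cont_on_measurable (t : R) (h : R -> R) : 0 < t -> cont_on t h ->
  measurable_fun (`]0, t[%classic : set (measurableTypeR R)) h /\
  [bounded h r | r in `]0, t[%classic].
Proof.
move=> t0 hc; have [w wc wE] := cont_on_extend (ltW t0) hc.
have inE' r : r \in `]0, t[%classic -> w r = h r.
  by rewrite inE /= in_itv /= => /andP[r0 rt]; apply: wE; rewrite !ltW.
split.
  apply: eq_measurable_fun (fun r rt => inE' r rt) _.
  by apply: measurable_funTS; apply: measurable_realfun.continuous_measurable_fun.
have [|c _ Hc] := @EVT_max R (fun r => `|w r|) 0 t (ltW t0).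
  apply: continuous_subspaceT => r; apply: (@continuous_comp _ _ _ w (@Num.norm _ R)).
    exact: wc.
  exact: norm_continuous.
exists `|w c|; split; first by rewrite num_real.
move=> M cM r /= rt; rewrite -inE' ?inE //; apply: le_trans (ltW cM).
by apply: Hc; move: rt; rewrite !in_itv /= => /andP[r0 r_t]; rewrite !ltW.
Qed.

Lemma cont_on_field (U : set 'rV[R]_d) (f : 'rV[R]_d -> 'rV[R]_d) (t : R) (x : R -> 'rV[R]_d) :
  (forall z, U z -> {for z, continuous f}) -> cont_on t x ->
  (forall s, 0 <= s <= t -> U (x s)) -> cont_on t (fun s => f (x s)).
Proof.
move=> fc xc xU s st e e0.
have /cvgrPdist_le/(_ e e0)/nbhs_ballP[eta /= eta0 Hf] := fc _ (xU s st).
have [|del del0 Hx] := xc s st (eta / 2); first by rewrite divr_gt0.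
exists del => // s' s't ss'; rewrite distrC; apply: Hf.
rewrite -ball_normE /ball_ /= distrC.
by apply: le_lt_trans (Hx s' s't ss') _; lra.
Qed.

(** The essential supremum bounds a continuous function everywhere, because open intervals
    have positive measure. *)
Lemma norm_primitive_le (t rho : R) (u : R -> R) : 0 < t -> cont_on t (primitive u) ->
  (norm_Wm1oo t u <= rho%:E)%E -> forall s, 0 <= s <= t -> `|primitive u s| <= rho.
Proof.
move=> t0 vc; rewrite /norm_Wm1oo unlock; case: ifP => [_ /ess_sup_inf.ess_supP H|]; last first.
  have := lebesgue_measure_itv (Interval -oo%O +oo%O : interval R).
  rewrite set_itvNyy /= => ->.
  by rewrite ltry.
have {H} [N [mN N0 HN]] := H.
move=> s st; rewrite leNgt; apply/negP => rs.
pose e := `|primitive u s| - rho; have e0 : 0 < e by rewrite subr_gt0.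
have [|del del0 Hd] := vc s st (e / 2); first by rewrite divr_gt0.
have [s0 s't] := andP st.
pose a := Num.max 0 (s - del); pose b := Num.min t (s + del).
have ab : a < b.
  by rewrite gt_max !lt_min t0 /=; apply/and3P; split; lra.
have sub : `]a, b[%classic `<=` N.
  move=> w /=; rewrite in_itv /= gt_max lt_min => /andP[/andP[w0 ws] /andP[wt ws']].
  apply: HN => /=; apply/negP; rewrite -ltNge patchE ifT; last by rewrite inE /= in_itv /= w0.
  rewrite lte_fin.
  have wt' : 0 <= w <= t by rewrite !ltW.
  have /(Hd w wt') : `|w - s| <= del by rewrite ler_distl; apply/andP; split; lra.
  have := ler_normB (primitive u w) (primitive u w - primitive u s); rewrite subKr.
  by have : `|primitive u s| - rho = e by []; lra.
have : (mu `]a, b[%classic = 0)%E.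
  apply: measure_negligible => //; exists N; split => //.
by rewrite lebesgue_measure_itv /= lte_fin ab -EFinB => -[]; have := ab; lra.
Qed.

(** The common modulus of time and control is [s] plus the integral of [|u|]. *)
Lemma driven_of_mild (U : set 'rV[R]_d) (f0 f1 F : 'rV[R]_d -> 'rV[R]_d) (r t rho : R)
    (u : R -> R) (x : R -> 'rV[R]_d) :
  0 < r -> 0 < t -> 
  (forall z, U z -> {for z, continuous f0}) -> (forall z, U z -> {for z, continuous f1}) ->
  (forall z, `|z| <= r -> F z = f1 z) ->
  L1_control t u -> (norm_Wm1oo t u <= rho%:E)%E -> mild_solution U f0 f1 u t x ->
  driven f0 F r t rho (primitive u) (fun s => s + primitive (fun q => `|u q|) s) x.
Proof.
move=> r0 t0 f0c f1c Ff1 ui vrho [/within_cont_on xc xU xE].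
have xU' s : 0 <= s <= t -> U (x s) by move=> st; apply: xU; rewrite in_itv.
have ni : mu.-integrable `]0, t[ (EFin \o (fun r => `|u r|)) by exact: integrable_norm.
have mt : measurable (`]0, t[%classic : set (measurableTypeR R)) by [].
have ft : (mu `]0%R, t[%classic < +oo)%E.
  by rewrite lebesgue_measure_itv /=; case: ifPn => // _; rewrite -EFinB ltry.
have vc := primitive_cont t0 ui; have nc := primitive_cont t0 ni.
have f0xc := cont_on_field f0c xc xU'; have f1xc := cont_on_field f1c xc xU'.
have coord (g : R -> 'rV[R]_d) i : cont_on t g -> cont_on t (fun s => g s 0 i).
  move=> gc s st e e0; have [del del0 H] := gc s st e e0; exists del => // s' s't ss'.
  exact: le_trans (rV_diff_coord _ _ i) (H s' s't ss').
have gi i : mu.-integrable `]0, t[ (EFin \o (fun q => f0 (x q) 0 i + u q * f1 (x q) 0 i)).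
  have [m0 b0] := cont_on_measurable t0 (coord _ i f0xc).
  have [m1 b1] := cont_on_measurable t0 (coord _ i f1xc).
  have i0 := measurable_bounded_integrable mt ft m0 b0.
  have i1 := integrableMl mt ui m1 b1.
  by apply: (@eq_integrable _ _ _ mu _ mt _ _ _ (integrableD mt i0 i1)) => q _.
have xE' i s : 0 <= s <= t -> x s 0 i = primitive (fun q => f0 (x q) 0 i + u q * f1 (x q) 0 i) s.
  by move=> st; apply: xE; rewrite in_itv.
have tt : 0 <= (0 : R) <= t by rewrite lexx ltW.
have nd s s' : 0 <= s -> s <= s' -> s' <= t ->
    primitive (fun q => `|u q|) s' - primitive (fun q => `|u q|) s = \int[mu]_(q in `]s, s'[) `|u q|.
  exact: primitive_diff.
split.
- by apply/rowP => i; rewrite xE' // primitive0 mxE.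
- exact: primitive0.
- exact: norm_primitive_le.
- exact: xc.
- move=> s st e e0; have [|del del0 H] := nc s st (e / 2); first by rewrite divr_gt0.
  exists (Num.min del (e / 2)) => [|s' s't]; first by rewrite lt_min del0 divr_gt0.
  rewrite le_min => /andP[/(H _ s't) h1 h2].
  have -> : e = e / 2 + e / 2 by field.
  by rewrite opprD addrACA; apply: le_trans (ler_normD _ _) _; apply: lerD.
- move=> s s' s0 ss' s't; rewrite (primitive_diff ui) //.
  have mS : measurable (`]s, s'[%classic : set (measurableTypeR R)) by [].
  have uS := integrable_sub s0 s't ui.
  apply: le_trans (le_normr_Rintegral mS uS) _.
  by rewrite -nd //; move: ss'; set A := primitive _ _; set B := primitive _ _; lra.
- move=> s s' s0 ss' s't.
  have : 0 <= primitive (fun q => `|u q|) s' - primitive (fun q => `|u q|) s.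
    by rewrite nd // Rintegral_ge0.
  by set A := primitive _ _; set B := primitive _ _; lra.
move=> s st xr e e0; have [s0 st'] := andP st.
have [d1 d10 H1] := f0xc s st e e0; have [d2 d20 H2] := f1xc s st e e0.
exists (Num.min d1 d2) => [|s' /andP[ss']]; first by rewrite lt_min d10.
rewrite -lerBlDl le_min => /andP[hd1 hd2] s't.
have s'T : 0 <= s' <= t by rewrite s't (le_trans s0).
have [h0 m0] : 0 <= s' - s /\
   0 <= s' + primitive (fun q => `|u q|) s' - (s + primitive (fun q => `|u q|) s).
  rewrite subr_ge0; split => //; rewrite opprD addrACA addr_ge0 ?subr_ge0 // -subr_ge0 nd //.
  exact: Rintegral_ge0.
apply: norm_le_coord => [|i]; first by rewrite mulr_ge0 // ltW.
rewrite !mxE !xE' // Ff1; last by lra.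
apply: (increment_bound ui (gi i) s0 ss' s't) => q /andP[sq qs'].
have qt : 0 <= q <= t by rewrite (le_trans s0 (ltW sq)) (le_trans (ltW qs')).
have qs : `|q - s| <= s' - s.
  by rewrite ger0_norm ?subr_ge0 ?(ltW sq) // lerD2r ltW.
split; apply: le_trans (rV_diff_coord _ _ i) _.
  by apply: H1 => //; exact: le_trans hd1.
by apply: H2 => //; exact: le_trans hd2.
Qed.

End Mild.

(** * The obstruction *)

Section ClampVector.
Variables (R : realType) (d : nat).

(** Truncation onto the ball of radius [r], used to extend [f1] to a bounded Lipschitz
    field on the whole space. *)
Definition clampV (r : R) (x : 'rV[R]_d) : 'rV[R]_d := \row_i clamp r (x 0 i).

Lemma clampV_le r x : 0 <= r -> `|clampV r x| <= r.
Proof. by move=> r0; apply: norm_le_coord => // i; rewrite mxE clamp_le. Qed.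

Lemma clampV_id r (x : 'rV[R]_d) : `|x| <= r -> clampV r x = x.
Proof.
by move=> xr; apply/rowP => i; rewrite mxE clamp_id // (le_trans (coord_le_norm x i)).
Qed.

Lemma clampV_lip r (x y : 'rV[R]_d) : `|clampV r x - clampV r y| <= `|x - y|.
Proof.
apply: rV_diff_le => // i; rewrite !mxE; apply: le_trans (clamp_lip _ _ _) _.
exact: rV_diff_coord.
Qed.

End ClampVector.

Section System.
Variables (R : realType) (d M n : nat) (U : set 'rV[R]_d) (f0 f1 : 'rV[R]_d -> 'rV[R]_d).
Hypotheses (lt1n : (1 < n)%N) (nM : (n <= M)%N).
Hypotheses (oU : open U) (U0 : U 0) (c0 : class_C M.+1 U f0) (c1 : class_C M U f1).
Hypothesis f00 : f0 0 = 0.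

Definition taylor0 : vfield R d := tpoly M.+1 f0.
Definition taylor1 : vfield R d := tpoly M f1.

Lemma taylor_ev_field : taylor M.+1 f0 = ev_field taylor0 /\ taylor M f1 = ev_field taylor1.
Proof.
by split; apply/funext => x; apply/rowP => k; rewrite mxE taylor_tpoly.
Qed.

Lemma val0_taylor0 : val0 taylor0 = 0.
Proof. by apply/rowP => k; rewrite !mxE tpoly0 f00 mxE. Qed.

Lemma val0_taylor1 : val0 taylor1 = f1 0.
Proof. by apply/rowP => k; rewrite !mxE tpoly0. Qed.

Lemma class_C_continuous m (f : 'rV[R]_d -> 'rV[R]_d) z : class_C m U f -> U z ->
  {for z, continuous f}.
Proof.
by move=> /(class_C_le (leq0n m)); apply.
Qed.

(** The field [f1] may have one derivative less than [f0]: its remainder is integrated along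
    the flow over a time of order [|v|], which gains the missing power. *)
Lemma system_constants : exists C r : R, [/\ 0 <= C, 0 < r, r <= 1 / 2,
  (forall x : 'rV[R]_d, `|x| <= r -> U x) &
  [/\ forall x : 'rV[R]_d, `|f1 (clampV r x)| <= C,
    forall x y : 'rV[R]_d, `|f1 (clampV r x) - f1 (clampV r y)| <= C * `|x - y|,
    forall a b : 'rV[R]_d, `|a| <= r -> `|b| <= r ->
      `|(f1 (clampV r a) - ev_field taylor1 a) - (f1 (clampV r b) - ev_field taylor1 b)| <=
        C * Num.max `|a| `|b| ^+ n.-1 * `|a - b|,
    forall x : 'rV[R]_d, `|x| <= r -> `|f0 x - ev_field taylor0 x| <= C * `|x| ^+ n.+1 &
    forall x : 'rV[R]_d, `|x| <= r -> `|f0 x| <= C * `|x| ] ].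
Proof.
have [ru ru0 HU] := open_ball0 oU U0.
have [Ca [ra [Ca0 ra0 Ha]]] := tremainder_bound oU U0 c0.
have M0 : (0 < M)%N by apply: leq_trans nM; apply: ltnW.
have c1' : class_C M.-1.+1 U f1 by rewrite prednK.
have [Cb [rb [Cb0 rb0 Hb]]] := tremainder_lipschitz oU U0 c1'; rewrite prednK // in Hb.
have [Cd Cd0 Hd] := ev_field_lipschitz taylor1.
have [Ce Ce0 He] := ev_field_lipschitz taylor0.
pose r := Num.min (Num.min ru (1 / 2)) (Num.min ra rb).
have r0 : 0 < r by rewrite !lt_min ru0 ra0 rb0 divr_gt0.
have rru : r <= ru by rewrite !ge_min lexx.
have rh : r <= 1 / 2 by rewrite !ge_min lexx orbT.
have rra : r <= ra by rewrite !ge_min lexx !orbT.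
have rrb : r <= rb by rewrite !ge_min lexx !orbT.
have r1 : r <= 1 by have := rh; lra.
have rem_lip (a b : 'rV[R]_d) : `|a| <= r -> `|b| <= r ->
    `|(f1 a - ev_field taylor1 a) - (f1 b - ev_field taylor1 b)| <=
      Cb * Num.max `|a| `|b| ^+ n.-1 * `|a - b|.
  move=> ar br; have mx0 : 0 <= Num.max `|a| `|b| by rewrite le_max normr_ge0.
  apply: rV_diff_le => [|i].
    by apply: mulr_ge0 => //; apply: mulr_ge0 => //; exact: exprn_ge0.
  rewrite !mxE; apply: le_trans (Hb a b (le_trans ar rrb) (le_trans br rrb) i) _.
  apply: ler_wpM2r => //; apply: ler_wpM2l => //; apply: ler_wiXn2l => //.
    by rewrite ge_max (le_trans ar r1) (le_trans br r1).
  by rewrite -!subn1 leq_sub2r.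
have lip (a b : 'rV[R]_d) : `|a| <= r -> `|b| <= r -> `|f1 a - f1 b| <= (Cb + Cd) * `|a - b|.
  move=> ar br; have := rem_lip a b ar br.
  have mx : Num.max `|a| `|b| ^+ n.-1 <= 1.
    by rewrite exprn_ile1 ?le_max ?normr_ge0 // ge_max (le_trans ar r1) (le_trans br r1).
  have := ler_wpM2r (normr_ge0 (a - b)) (ler_wpM2l Cb0 mx); rewrite mulr1.
  have := Hd a b (le_trans ar r1) (le_trans br r1).
  have := ler_normD ((f1 a - ev_field taylor1 a) - (f1 b - ev_field taylor1 b))
     (ev_field taylor1 a - ev_field taylor1 b).
  have -> : (f1 a - ev_field taylor1 a) - (f1 b - ev_field taylor1 b) +
     (ev_field taylor1 a - ev_field taylor1 b) = f1 a - f1 b.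
    by apply/rowP => i; rewrite !mxE; ring.
  by move: (Cb * _ * _) => q; lra.
have f0_rem (x : 'rV[R]_d) : `|x| <= r -> `|f0 x - ev_field taylor0 x| <= Ca * `|x| ^+ n.+1.
  move=> xr; apply: norm_le_coord => [|i]; first by rewrite mulr_ge0 ?exprn_ge0.
  rewrite !mxE; apply: le_trans (Ha x (le_trans xr rra) i) _; apply: ler_wpM2l => //.
  by apply: ler_wiXn2l => //; exact: le_trans xr r1.
have cl (x : 'rV[R]_d) : `|clampV r x| <= r by apply: clampV_le; exact: ltW.
have r00 : `|0 : 'rV[R]_d| <= r by rewrite normr0 ltW.
pose C := Ca + Cb + Cd + Ce + `|f1 0|.
have leC x q : 0 <= q -> x <= C -> x * q <= C * q by move=> q0; exact: ler_wpM2r.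
have Ca_le : Ca <= C by rewrite /C; have := normr_ge0 (f1 0); lra.
have Cb_le : Cb <= C by rewrite /C; have := normr_ge0 (f1 0); lra.
exists C, r; split=> //.
- by rewrite /C !addr_ge0.
- by move=> x xr; apply: HU; exact: le_trans rru.
split.
- move=> x; have := lip _ _ (cl x) r00; rewrite subr0 => h.
  have := ler_normD (f1 (clampV r x) - f1 0) (f1 0); rewrite subrK.
  have : (Cb + Cd) * `|clampV r x| <= (Cb + Cd) * 1.
    by rewrite ler_wpM2l ?addr_ge0 // (le_trans (cl x)).
  by rewrite /C; lra.
- move=> x y; apply: le_trans (lip _ _ (cl x) (cl y)) _.
  apply: le_trans (ler_wpM2l _ (clampV_lip r x y)) _; first exact: addr_ge0.
  by apply: leC => //; rewrite /C; have := normr_ge0 (f1 0); lra.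
- move=> a b ar br; rewrite !clampV_id //; apply: le_trans (rem_lip a b ar br) _.
  by rewrite -!mulrA leC // mulr_ge0 // exprn_ge0 // le_max normr_ge0.
- by move=> x xr; apply: le_trans (f0_rem x xr) _; rewrite leC ?exprn_ge0.
move=> x xr; have x1 := le_trans xr r1.
have := He x 0 x1; rewrite ev_field0 val0_taylor0 !subr0 normr0 ler01 => /(_ isT) h.
have := f0_rem x xr; have := ler_normD (f0 x - ev_field taylor0 x) (ev_field taylor0 x).
rewrite subrK.
have p1 : Ca * `|x| ^+ n.+1 <= Ca * `|x|.
  by apply: ler_wpM2l => //; rewrite exprS ler_piMr // exprn_ile1.
have p2 : (Ca + Ce) * `|x| <= C * `|x|.
  by apply: leC => //; rewrite /C; have := normr_ge0 (f1 0); lra.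
by move: p1 p2; rewrite mulrDl; move: (C * _) (Ca * _) (Ca * _) (Ce * _) h => q1 q2 q3 q4; lra.
Qed.

Lemma system_reduction : f1 0 != 0 -> exists (K : mpoly d R -> R) rho1 T1 B,
  [/\ forall p, 0 <= K p, 0 < rho1, 0 < T1, 0 <= B &
  forall t rho u x, 0 < t <= T1 -> 0 <= rho <= rho1 ->
  L1_control t u -> (norm_Wm1oo t u <= rho%:E)%E -> mild_solution U f0 f1 u t x ->
  exists v y I, [/\ reduced n taylor0 taylor1 K t v y I,
    forall s, 0 <= s <= t -> `|v s| <= rho,
    `|x t| <= 1,
    `|v t| <= B * (`|x t| + `|y t|) &
    forall p, `|flow_error n taylor1 (x t) (y t) (v t) p| <=
      K p * (`|v t| ^+ n + `|v t| * (`|v t| + `|y t|) ^+ n)]].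
Proof.
move=> f10.
have [C [r [C0 r0 rh HU [F_bounded F_lip rem_lip f0_rem f0_le]]]] := system_constants.
pose A := 1 / 2 / (C + 1); have C1 : 0 < C + 1 by rewrite ltr_wpDl.
have A0 : 0 < A by rewrite !divr_gt0.
have CA : C * A <= 1 / 2 by rewrite /A mulrA ler_pdivrMr // mulrC ler_wpM2l ?divr_ge0 // lerDl.
have F_at0 : f1 (clampV r 0) = ev_field taylor1 0.
  by rewrite clampV_id ?normr0 ?(ltW r0) // ev_field0 val0_taylor1.
have [|K [rho1 [T1 [B [K0 rho10 T10 B0 H]]]]] := reduced_of_driven lt1n C0 A0 CA r0 rh
  F_bounded F_lip rem_lip F_at0 f0_rem f0_le.
  by rewrite clampV_id // normr0 ltW.
exists K, rho1, T1, B; split=> // t rho u x /andP[t0 tT1] rhoP ui vrho mild.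
have dr : driven f0 (fun x => f1 (clampV r x)) r t rho (primitive u)
   (fun s => s + primitive (fun q => `|u q|) s) x.
  apply: (driven_of_mild r0 t0 _ _ _ ui vrho mild).
  - by move=> z Uz; exact: class_C_continuous c0 Uz.
  - by move=> z Uz; exact: class_C_continuous c1 Uz.
  - by move=> z zr; rewrite clampV_id.
have tP : 0 <= t <= T1 by rewrite ltW.
have [y [I [red x1 vB err]]] := H t rho _ _ _ dr tP rhoP.
by exists (primitive u), y, I; split=> //; exact: (dr_v dr).
Qed.

End System.

Lemma exists_root (R : realType) n (q : R) : (0 < n)%N -> 0 < q ->
  exists2 sig : R, 0 < sig & sig ^+ n = q.
Proof.
move=> n0 q0; exists (powR q n%:R^-1); first exact: powR_gt0.
rewrite -powR_mulrn ?powR_ge0 // -powRrM mulVf ?powRr1 ?(ltW q0) //.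
by rewrite pnatr_eq0 -lt0n.
Qed.

Section Obstruction.
Variables (R : realType) (d M n : nat) (U : set 'rV[R]_d) (f0 f1 : 'rV[R]_d -> 'rV[R]_d).
Hypotheses (lt1n : (1 < n)%N) (nM : (n <= M)%N).
Hypothesis even_n : forall v : R, v ^+ n = `|v| ^+ n.
Hypotheses (oU : open U) (U0 : U 0) (c0 : class_C M.+1 U f0) (c1 : class_C M U f1).
Hypotheses (f00 : f0 0 = 0) (f10 : f1 0 != 0).
Local Notation G0 := (taylor0 M f0).
Local Notation G1 := (taylor1 M f1).
Local Notation g := (val0 (adfield G0 G1 n)).
Variable phi : mpoly d R.
Hypothesis vphi : vanish G0 G1 n.-1 phi.
Hypothesis dphi : \sum_i g 0 i * evp (mderiv i phi) 0 = 1.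

(** The choice of constants: first [eps], which makes the error terms at most half of
    the main ones, then [del = eps / 4], then [t], and last [c] after the radius [delta]
    granted by controllability. *)
Lemma unreachable_direction : ~ Wm1oo_STLC U f0 f1.
Proof.
move=> stlc; have n0 : (0 < n)%N := ltnW lt1n.
have [K [rho1 [T1 [B [K0 rho10 T10 B0 H]]]]] := system_reduction lt1n nM oU U0 c0 c1 f00 f10.
have [C [t0 [C0 t00 HC]]] := endpoint_drift lt1n even_n (val0_taylor0 M f00) K0 vphi B0.
have gE : evp (lder (adfield G0 G1 n) phi) 0 = 1 by rewrite evp_lder0.
rewrite gE in HC.
have g0 : 0 < `|g|.
  rewrite normr_gt0; apply/eqP => g_eq0; move: dphi; rewrite g_eq0 big1 => [|i _].
    by move=> /eqP; rewrite eq_sym oner_eq0.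
  by rewrite mxE mul0r.
have fn0 : 0 < n`!%:R^-1 :> R by rewrite invr_gt0 ltr0n fact_gt0.
have [|eps eps0 Heps] := @choose_small R [:: (1, 1); (C, n`!%:R^-1 / 2); (C * `|g|, 1 / 2)].
  move=> p; rewrite !inE => /or3P[] /eqP -> /=; split=> //; rewrite ?divr_gt0 //.
  exact: mulr_ge0.
have e1 : eps * 1 <= 1 by apply: (Heps (1, 1)); rewrite ?inE ?eqxx.
have e2 : eps * C <= n`!%:R^-1 / 2.
  by apply: (Heps (C, n`!%:R^-1 / 2)); rewrite ?inE ?eqxx ?orbT.
have e3 : eps * (C * `|g|) <= 1 / 2.
  by apply: (Heps (C * `|g|, 1 / 2)); rewrite ?inE ?eqxx ?orbT.
rewrite mulr1 in e1.
pose del := eps / 4; have del0 : 0 < del by rewrite divr_gt0.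
have del1 : 0 < del <= 1 by rewrite del0 /del; lra.
pose S := del ^+ n; have S0 : 0 < S by rewrite exprn_gt0.
(* bound for the integral of |v|^n, read off the equation of the zero function *)
pose k := 1 + K 0 * 2 ^+ n.+1.
have k0 : 0 <= k by rewrite addr_ge0 // mulr_ge0 ?exprn_ge0.
have [|t t_gt0 Ht] := @choose_small R [:: (1, T1); (1, t0); (k, S / 2); (del^-1 ^+ n, del)].
  move=> p; rewrite !inE => /or4P[] /eqP -> /=; split=> //; rewrite ?divr_gt0 //.
  by rewrite exprn_ge0 ?invr_ge0 // ltW.
have t1 : t * 1 <= T1 by apply: (Ht (1, T1)); rewrite ?inE ?eqxx.
have t2 : t * 1 <= t0 by apply: (Ht (1, t0)); rewrite ?inE ?eqxx ?orbT.
have t3 : t * k <= S / 2 by apply: (Ht (k, S / 2)); rewrite ?inE ?eqxx ?orbT.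
have t4 : t * del^-1 ^+ n <= del by apply: (Ht (del^-1 ^+ n, del)); rewrite ?inE ?eqxx ?orbT.
rewrite !mulr1 in t1 t2.
pose rho := Num.min rho1 del; have rho0 : 0 < rho by rewrite lt_min rho10.
have [delta delta0 reach] := stlc t rho t_gt0 rho0.
pose c := Num.min (S / 2) (delta / 2) / `|g|.
have c_gt0 : 0 < c by rewrite divr_gt0 // lt_min !divr_gt0.
have cg : c * `|g| = Num.min (S / 2) (delta / 2) by rewrite /c divfK // gt_eqF.
have cgS : c * `|g| <= S / 2 by rewrite cg ge_min lexx.
have cgd : c * `|g| < delta.
  by rewrite cg; apply: le_lt_trans (_ : delta / 2 < _); [rewrite ge_min lexx orbT|lra].
pose xs : 'rV[R]_d := - c *: g.
have xs_norm : `|xs| = c * `|g| by rewrite normrZ normrN gtr0_norm.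
have [|u [ui vrho [x mild xt]]] := reach xs.
  by rewrite -ball_normE /ball_ /= sub0r normrN xs_norm.
have tP : 0 < t <= T1 by rewrite t_gt0.
have rhoP : 0 <= rho <= rho1 by rewrite (ltW rho0) ge_min lexx.
have [v [y [I [red v_rho x1 vB err]]]] := H t rho u x tP rhoP ui vrho mild.
have tt : 0 <= t <= t by rewrite (ltW t_gt0) lexx.
have [I0 _] := andP (red_I red tt).
have It : I t <= S / 2.
  have := red_incr red (p := 0) (kap := 1) (lexx 0) k0 _ tt.
  rewrite -[0 : mpoly d R]/(0) !evp0 subrr sub0r normrN mul1r mul0r add0r ger0_norm // => h.
  apply: le_trans (h _) _ => [s st|]; last by rewrite mulrC.
  rewrite mul0r add0r /drift big1 => [|j _]; last by rewrite lder0 evp0 mulr0.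
  rewrite sub0r normrN mul1r normrX normr_id; apply: lerD.
    by rewrite exprn_ile1 // (red_v red).
  apply: ler_wpM2l => //; rewrite lerXn2r ?nnegrE ?addr_ge0 //.
  by have := red_v red st; have := red_y red st; lra.
pose q := I t + c * `|g|.
have q0 : 0 < q by rewrite ltr_wpDl // mulr_gt0.
have [sig sig0 sigE] := exists_root n0 q0.
have sig_del : sig <= del.
  rewrite leNgt; apply/negP => ds.
  have : del ^+ n < sig ^+ n by rewrite ltr_pXn2r ?nnegrE // ltW.
  by rewrite sigE /q -/S; lra.
have adm : admissible n G0 G1 K t0 t v y I sig.
  split=> //; last by rewrite sigE /q lerDl mulr_ge0 // ltW.
  by rewrite sig0; case/andP: del1 => _; exact: le_trans.
have xq : `|x t| <= sig ^+ n by rewrite sigE xt xs_norm /q lerDr.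
have small : del + rho + sig + t * del^-1 ^+ n <= eps.
  have rd : rho <= del by rewrite ge_min lexx orbT.
  have -> : eps = del + del + del + del by rewrite /del; field.
  by lra.
have := HC _ _ _ _ _ adm rho v_rho del del1 (x t) x1 xq vB (err phi) eps small e1.
have -> : dirder (x t) phi 0 = - c.
  rewrite xt /dirder -[- c]mulr1 -dphi mulr_sumr.
  by apply: eq_bigr => i _; rewrite mxE mulrA.
rewrite mul1r sigE /q => bound.
have b1 : c + n`!%:R^-1 * I t <= C * eps * (I t + c * `|g|).
  apply: le_trans bound; rewrite -normrN; apply: le_trans (ler_norm _).
  by rewrite opprB opprK addrC.
have b2 := ler_wpM2r I0 e2.
have b3 := ler_wpM2r (ltW c_gt0) e3.
have b4 : 0 <= n`!%:R^-1 * I t by rewrite mulr_ge0 // ltW.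
have e4 : C * eps * (I t + c * `|g|) = eps * C * I t + eps * (C * `|g|) * c by ring.
by rewrite e4 in b1; lra.
Qed.

End Obstruction.

Lemma val0_vmag_equilibrium (R : realType) (d : nat) (F0 F1 : vfield R d) b :
  val0 F0 = 0 -> val0 F1 = 0 -> val0 (vmag F0 F1 b) = 0.
Proof.
move=> F00 F10; elim: b => //= b1 IH1 b2 IH2.
apply/rowP => i; rewrite !mxE evpB !evp_lder0 IH1 IH2.
by rewrite !big1 ?subrr // => j _; rewrite mxE mul0r.
Qed.

Theorem corollary11p2 (R : realType) (d M : nat) (U : set 'rV[R]_d)
    (f0 f1 : 'rV[R]_d -> 'rV[R]_d) :
  (1 <= d)%N -> (1 <= M)%N ->
  open U -> U 0 ->
  class_C M.+1 U f0 -> class_C M U f1 -> f0 0 = 0 ->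
  Wm1oo_STLC U f0 f1 ->
  forall k : nat, (1 <= k)%N -> (2 * k <= M)%N ->
    S_at0 M.+1 f0 f1 [set n | (1 <= n <= 2 * k - 1)%N]
      (bracket_at0 M.+1 f0 f1 (ad_X1 (2 * k) X0)).
Proof.
move=> _ _ oU U0 c0 c1 f00 stlc k k1 kM.
pose n := (2 * k)%N; have lt1n : (1 < n)%N by rewrite /n; lia.
have even_n (v : R) : v ^+ n = `|v| ^+ n by rewrite /n !exprM real_normK ?num_real.
pose G0 := taylor0 M f0; pose G1 := taylor1 M f1.
have valE b : bracket_at0 M.+1 f0 f1 b = val0 (vmag G0 G1 b).
  have [E0 E1] := taylor_ev_field M f0 f1.
  by rewrite /bracket_at0 [M.+1.-1]/= E0 E1 bracket_vmag ev_field0.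
have [f10|f10] := eqVneq (f1 0) 0.
  exists [::] => //; rewrite valE val0_vmag_equilibrium ?mem0v //.
    exact: val0_taylor0.
  by rewrite val0_taylor1.
rewrite valE /S_at0.
apply: contrapT => notin.
have [|phi [vphi dphi]] := @privileged_function R d G0 G1 (val0_taylor0 M f00) n.-1
   (val0 (adfield G0 G1 n)).
  move=> [s sS gs]; apply: notin; exists s => // w /sS [b /= /andP[b0 bn] <-].
  exists b; rewrite /= ?valE //; rewrite b0 /=; move: bn; rewrite /n; lia.
exact: (unreachable_direction lt1n kM even_n oU U0 c0 c1 f00 f10 vphi dphi stlc).
Qed.
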